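(* There is a constant $C>0$, independent of $\epsilon$, $\mu$ and $N$, such that the following holds. Assume $\sqrt{\epsilon}<N^{-1}$ if $\sqrt{\alpha}\,\mu\le\sqrt{\rho\epsilon}$, and $\max\{\epsilon/\mu,\ \mu\}<N^{-1}$ if $\sqrt{\alpha}\,\mu>\sqrt{\rho\epsilon}$. Let $y$ be the solution of the boundary value problem $$\epsilon y''+\mu a y'-by=f\ \text{ on }(0,d)\cup(d,1),\qquad y(0)=y_0,\ y(1)=y_1,$$ with $y\in C^0([0,1])\cap C^1((0,1))\cap C^2((0,d)\cup(d,1))$, and let $Y$ be the solution of the upwind difference scheme on the Shishkin-Bakhvalov mesh $\bar\Omega_N=\{x_i\}_{i=0}^N$ described in the context. Then $$\|Y-y\|:=\max_{0\le i\le N}|Y(x_i)-y(x_i)|\le CN^{-1}.$$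
   Context: Problem data. Fix $d\in(0,1)$, $\Omega=(0,1)$, $\Omega^-=(0,d)$, $\Omega^+=(d,1)$, real numbers $y_0,y_1$, and parameters $\epsilon,\mu\in(0,1]$. The function $b$ is in $C^7([0,1])$ with $b\ge\gamma>0$. The functions $a,f$ are defined on $[0,1]\setminus\{d\}$, their restrictions to $[0,d)$ and $(d,1]$ extend to $C^7$ functions on $[0,d]$ and $[d,1]$, and they (and their derivatives) may have jump discontinuities at $d$. Moreover $a\le-\alpha_1<0$ on $[0,d)$ and $a\ge\alpha_2>0$ on $(d,1]$. Put $\alpha=\min\{\alpha_1,\alpha_2\}$ and $\rho=\inf_{x\in[0,1]\setminus\{d\}}|b(x)/a(x)|$. The data $a,b,f,d,y_0,y_1$ are fixed, and constants $C$ may depend on them but not on $\epsilon,\mu,N$. Mesh. If $\sqrt\alpha\mu\le\sqrt{\rho\epsilon}$ put $\theta_1=\theta_2=\frac{\sqrt{\rho\alpha}}{2\sqrt\epsilon}$; if $\sqrt\alpha\mu>\sqrt{\rho\epsilon}$ put $\theta_1=\frac{\alpha\mu}{2\epsilon}$, $\theta_2=\frac{\rho}{2\mu}$. Let $N$ be a positive multiple of $8$, $\sigma_1=\sigma_4=\frac4{\theta_2}\ln N$, $\sigma_2=\sigma_3=\frac4{\theta_1}\ln N$, and assume $\sigma_1+\sigma_2<d$, $\sigma_3+\sigma_4<1-d$. The mesh points are (with $\log$ the natural logarithm) - $x_i=-\frac8{\theta_2}\log\big(1+\frac{8i}N(\frac1{\sqrt N}-1)\big)$ for $0\le i\le\frac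 N8$; - $x_i=\sigma_1+4(d-\sigma_1-\sigma_2)(\frac iN-\frac18)$ for $\frac N8\le i\le\frac{3N}8$; - $x_i=d+\frac8{\theta_1}\log\big(\frac{8i}N(1-\frac1{\sqrt N})+\frac4{\sqrt N}-3\big)$ for $\frac{3N}8\le i\le\frac N2$; - $x_i=d-\frac8{\theta_1}\log\big(\frac{8i}N(\frac1{\sqrt N}-1)+5-\frac4{\sqrt N}\big)$ for $\frac N2\le i\le\frac{5N}8$; - $x_i=d+\sigma_3+4(1-d-\sigma_3-\sigma_4)(\frac iN-\frac58)$ for $\frac{5N}8\le i\le\frac{7N}8$; - $x_i=1+\frac8{\theta_2}\log\big(\frac{8i}N(1-\frac1{\sqrt N})+\frac8{\sqrt N}-7\big)$ for $\frac{7N}8\le i\le N$. In particular $x_0=0$, $x_{N/2}=d$, $x_N=1$. Scheme. For a mesh function $Y$ let $D^+Y(x_i)=\frac{Y(x_{i+1})-Y(x_i)}{x_{i+1}-x_i}$, $D^-Y(x_i)=\frac{Y(x_i)-Y(x_{i-1})}{x_i-x_{i-1}}$, $\delta^2Y(x_i)=\frac{2(D^+Y(x_i)-D^-Y(x_i))}{x_{i+1}-x_{i-1}}$, and $D^*=D^-$ for $i<N/2$, $D^*=D^+$ for $i>N/2$. The discrete problem is: $\epsilon\delta^2Y(x_i)+\mu a(x_i)D^*Y(x_i)-b(x_i)Y(x_i)=f(x_i)$ for $1\le i\le N-1$, $i\ne N/2$; $Y(x_0)=y_0$, $Y(x_N)=y_1$; $D^-Y(x_{N/2})=D^+Y(x_{N/2})$.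 *)

(* Defs.v *)
From Stdlib Require Export Reals Arith.
From Coquelicot Require Export Coquelicot.
Open Scope R_scope.

(* [Ck k D g]: g is k times continuously differentiable on D, all derivatives
   being taken within D.  It is meant for sets without isolated points: at an
   endpoint of a closed interval the derivative is the one-sided one, and at an
   interior point it is the usual one.  Values of g outside D are irrelevant. *)
Fixpoint Ck (k : nat) (D : R -> Prop) (g : R -> R) : Prop :=
  match k with
  | O => forall x, D x -> continue_in g D x
  | S k' => exists g' : R -> R, (forall x, D x -> D_in g g' D x) /\ Ck k' D g'
  end.

(* The value of g at d is left unconstrained: the data a and f are only defined
   off the point d, so their representatives are arbitrary there. *)
Definition piecewise_Ck (k : nat) (d : R) (g : R -> R) : Prop :=
  (exists gl : R -> R, Ck k (fun x => 0 <= x <= d) gl /\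
     forall x, 0 <= x < d -> g x = gl x) /\
  (exists gr : R -> R, Ck k (fun x => d <= x <= 1) gr /\
     forall x, d < x <= 1 -> g x = gr x).

(* rho = inf |b/a| over [0,1] \ {d}; the set is nonempty and bounded below by 0,
   so the greatest lower bound in Rbar is finite. *)
Definition rho_of (d : R) (a b : R -> R) : R :=
  real (Glb_Rbar (fun z => exists x, 0 <= x <= 1 /\ x <> d /\ z = Rabs (b x / a x))).

Section Mesh.

Variables (alpha rho eps mu : R).

Definition theta1 : R :=
  if Rle_dec (sqrt alpha * mu) (sqrt (rho * eps))
  then sqrt (rho * alpha) / (2 * sqrt eps)
  else alpha * mu / (2 * eps).

Definition theta2 : R :=
  if Rle_dec (sqrt alpha * mu) (sqrt (rho * eps))
  then sqrt (rho * alpha) / (2 * sqrt eps)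
  else rho / (2 * mu).

Variables (d : R) (N : nat).

Definition sigma1 : R := 4 / theta2 * ln (INR N).
Definition sigma2 : R := 4 / theta1 * ln (INR N).
Definition sigma3 : R := sigma2.
Definition sigma4 : R := sigma1.

(* The tests compare 8 i with multiples of N.  At the shared indices N/8, 3N/8,
   N/2, 5N/8, 7N/8 the two adjacent formulas give the same value, so the order
   of the tests is immaterial there. *)
Definition mesh (i : nat) : R :=
  let s := INR i / INR N in
  let r := sqrt (INR N) in
  if (8 * i <=? N)%nat then
    - (8 / theta2) * ln (1 + 8 * s * (1 / r - 1))
  else if (8 * i <=? 3 * N)%nat then
    sigma1 + 4 * (d - sigma1 - sigma2) * (s - 1 / 8)
  else if (8 * i <=? 4 * N)%nat then
    d + 8 / theta1 * ln (8 * s * (1 - 1 / r) + 4 / r - 3)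
  else if (8 * i <=? 5 * N)%nat then
    d - 8 / theta1 * ln (8 * s * (1 / r - 1) + 5 - 4 / r)
  else if (8 * i <=? 7 * N)%nat then
    d + sigma3 + 4 * (1 - d - sigma3 - sigma4) * (s - 5 / 8)
  else
    1 + 8 / theta2 * ln (8 * s * (1 - 1 / r) + 8 / r - 7).

End Mesh.

(* Difference quotients on a mesh x; Dminus and delta2 are only used at i >= 1. *)
Definition Dplus (x Y : nat -> R) (i : nat) : R :=
  (Y (S i) - Y i) / (x (S i) - x i).

Definition Dminus (x Y : nat -> R) (i : nat) : R :=
  (Y i - Y (pred i)) / (x i - x (pred i)).

Definition delta2 (x Y : nat -> R) (i : nat) : R :=
  2 * (Dplus x Y i - Dminus x Y i) / (x (S i) - x (pred i)).

(* Its value at i = N/2 is never used. *)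
Definition Dstar (x : nat -> R) (N : nat) (Y : nat -> R) (i : nat) : R :=
  if (i <? N / 2)%nat then Dminus x Y i else Dplus x Y i.

Definition discrete_solution (a b f : R -> R) (eps mu y0 y1 : R)
    (N : nat) (x : nat -> R) (Y : nat -> R) : Prop :=
  (forall i : nat, (1 <= i <= N - 1)%nat -> i <> (N / 2)%nat ->
     eps * delta2 x Y i + mu * a (x i) * Dstar x N Y i - b (x i) * Y i
       = f (x i)) /\
  Y 0%nat = y0 /\ Y N = y1 /\
  Dminus x Y (N / 2)%nat = Dplus x Y (N / 2)%nat.

Definition bvp_solution (d : R) (a b f : R -> R) (eps mu y0 y1 : R)
    (y : R -> R) : Prop :=
  Ck 0 (fun x => 0 <= x <= 1) y /\
  Ck 1 (fun x => 0 < x < 1) y /\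
  Ck 2 (fun x => 0 < x < d \/ d < x < 1) y /\
  (forall x, 0 < x < d \/ d < x < 1 ->
     eps * Derive_n y 2 x + mu * a x * Derive y x - b x * y x = f x) /\
  y 0 = y0 /\ y 1 = y1.

(* max over 0 <= i <= N of |u i| *)
Fixpoint max_norm (N : nat) (u : nat -> R) : R :=
  match N with
  | O => Rabs (u O)
  | S n => Rmax (max_norm n u) (Rabs (u (S n)))
  end.

(* Main.v *)
(* Subtracting the reduced solution v = -f/b leaves z = y - v, which solves the same
   equation with a right-hand side of the order of the outer layer width.  Comparison
   functions give |z| <= K (e^(-th2 x) + e^(-th1 (d-x)) + 1/th2) on the left of the
   interface, and the first-order equations satisfied by z' and z'' turn this into
   derivative bounds of the same form.  In the mesh layers Taylor expansion then gives a
   truncation error of size 1/N, up to a multiple of e^(-th1 (d-x)/8) that is large in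
   the interface layer; on the coarse part eps N^2 and mu N are bounded, so that every
   term of the scheme is of order 1/N by itself.  The function e^(-th1 |x-d|/8), linear
   in the index on the interface layers, is a discrete barrier absorbing both the large
   part of the truncation error and the error of the flux condition at d.  The right half
   is the left half seen through x -> 1 - x; for small N the maximum principle for both
   problems suffices. *)

Require Import Defs.
From Stdlib Require Import Lra Lia Psatz.

(** The solution is not split into regular and layer components. The size assumptions enter as
    [n <= C * th1] and [n <= C * th2], so the remainder [/ th2] left by subtracting only [- f / b]
    is already of order 1/N. The parameters are treated uniformly through inequalities between
    [eps], [mu], [th1], [th2]. The alternative [rg_cases] is opened only where rescaling to the
    width [/ th1] loses too much: if [th1] is far larger than [th2], it would charge the outer layer
    with [th1] instead of [th2]. There [z'] and [z''] are controlled by integrating backward from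
    [d], the direction in which homogeneous solutions decay. The obstacle is the interface layer
    when [mu ^ 2 / eps] is large: [eps * th1 ^ 2] is then unbounded and the truncation error is not
    of order 1/N. The barrier decays at the rate [th1 / 8] of the mesh grading. Across two cells it
    changes by a factor of at most 8, so diffusion contributes at most [eps * th1 ^ 2 / 8] times its
    value at the far node, while convection contributes twice as much with the opposite sign because
    [2 * (eps * th1) = alpha * mu]. Its kink at [d] has size [th1], which matches N times the flux
    error. *)

Ltac nonneg :=
  solve [repeat first [lra | apply Rmult_le_pos | apply Rplus_le_le_0_compat | apply pow_le
                      | apply pow_lt | apply Rabs_pos | left; apply Rinv_0_lt_compat]].

Ltac scaled :=
  solve [apply Rmult_le_compat_l; [nonneg | lra] | apply Rmult_le_compat_r; [nonneg | lra]].

Ltac abs_lra :=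
  repeat match goal with H : Rabs _ <= _ |- _ => apply Rabs_le_between in H end;
  match goal with |- Rabs _ <= _ => apply Rabs_le_between | _ => idtac end; lra.

(** * Inequalities and calculus of one variable *)

Lemma Rabs_mult_le (x y B B' : R) :
  Rabs x <= B -> Rabs y <= B' -> Rabs (x * y) <= B * B'.
Proof.
  intros Hx Hy. rewrite Rabs_mult. apply Rmult_le_compat; trivial; apply Rabs_pos.
Qed.

Ltac prod_bound := repeat first [assumption | apply Rabs_mult_le].

(** Cauchy's mean value theorem against [id] asks for derivatives in the open interval only.
    Intervals often end at 0 or at the interface, where only continuity is at hand. *)
Lemma mvt_open (f f' : R -> R) (p q : R) :
  p < q ->
  (forall x, p < x < q -> is_derive f x (f' x)) ->
  (forall x, p <= x <= q -> continuity_pt f x) ->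
  exists c, p < c < q /\ f q - f p = f' c * (q - p).
Proof.
  intros Hpq Hd Hc.
  assert (pr1 : forall c, p < c < q -> derivable_pt f c).
  { intros c Hc'. exists (f' c). apply is_derive_Reals. now apply Hd. }
  assert (pr2 : forall c, p < c < q -> derivable_pt id c).
  { intros c _. apply derivable_pt_id. }
  destruct (MVT f id p q pr1 pr2 Hpq Hc) as [c [Pc E]].
  { intros c _. apply derivable_continuous_pt, derivable_pt_id. }
  exists c; split; [exact Pc|].
  rewrite (derive_pt_eq_0 id c 1 (pr2 c Pc)) in E by apply derivable_pt_lim_id.
  rewrite (derive_pt_eq_0 f c (f' c) (pr1 c Pc)) in E
    by now apply is_derive_Reals, Hd.
  unfold id in E; lra.
Qed.

Lemma is_derive_continuity_pt (f : R -> R) (x l : R) :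
  is_derive f x l -> continuity_pt f x.
Proof.
  intros H. apply derivable_continuous_pt. exists l.
  now apply is_derive_Reals.
Qed.

Lemma derivative_bound_lipschitz (f f' : R -> R) (p q B x y : R) :
  (forall t, p < t < q -> is_derive f t (f' t)) ->
  (forall t, p < t < q -> Rabs (f' t) <= B) ->
  p <= x <= q -> p <= y <= q -> 0 <= B -> continuity_pt f x -> continuity_pt f y ->
  Rabs (f x - f y) <= (q - p) * B.
Proof.
  intros Hd HB Hx Hy B0 Cx Cy.
  assert (Main : forall s t, p <= s -> s < t -> t <= q -> continuity_pt f s ->
            continuity_pt f t -> Rabs (f t - f s) <= (q - p) * B).
  { intros s t Hs Hst Ht Cs Ct.
    destruct (mvt_open f f' s t Hst) as [c [Hc E]].
    - intros r Hr; apply Hd; lra.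
    - intros r Hr. destruct (Req_dec r s) as [->|]; [exact Cs|].
      destruct (Req_dec r t) as [->|]; [exact Ct|].
      apply (is_derive_continuity_pt _ _ (f' r)), Hd; lra.
    - rewrite E, Rmult_comm. apply Rabs_mult_le; [rewrite Rabs_pos_eq; lra|].
      apply HB; lra. }
  destruct (Rtotal_order x y) as [H|[->|H]].
  - rewrite Rabs_minus_sym. apply Main; trivial; lra.
  - rewrite Rminus_diag, Rabs_R0. nonneg.
  - apply Main; trivial; lra.
Qed.

Lemma is_derive_eq (f : R -> R) (x l l' : R) :
  is_derive f x l -> l = l' -> is_derive f x l'.
Proof. now intros H <-. Qed.

Lemma is_derive_Rext (f g : R -> R) (x l : R) :
  (forall t : R, f t = g t) -> is_derive f x l -> is_derive g x l.
Proof. exact (is_derive_ext f g x l). Qed.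

Lemma is_derive_reflect (f : R -> R) (s x l : R) :
  is_derive f (s - x) l -> is_derive (fun t => f (s - t)) x (- l).
Proof.
  intros H.
  assert (Hg : is_derive (fun t : R => s - t) x (-1)).
  { auto_derive; [exact I | ring]. }
  apply (is_derive_eq _ _ _ _ (is_derive_comp f (fun t => s - t) x l (-1) H Hg)).
  unfold scal; simpl; unfold mult; simpl; ring.
Qed.

Lemma continuity_pt_reflect (f : R -> R) (s x : R) :
  continuity_pt f (s - x) -> continuity_pt (fun t => f (s - t)) x.
Proof.
  intros H. apply (continuity_pt_comp (fun t => s - t) f); [|exact H].
  apply continuity_pt_minus;
    [apply continuity_pt_const; now intros ? ? |
     apply derivable_continuous_pt, derivable_pt_id].
Qed.

Lemma is_derive_interior_min (f : R -> R) (p q x l : R) :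
  p < x < q -> (forall t, p < t < q -> f x <= f t) -> is_derive f x l -> l = 0.
Proof.
  intros Hx Hmin Hd.
  assert (pr : derivable_pt f x) by (exists l; now apply is_derive_Reals).
  rewrite <- (derive_pt_eq_0 f x l pr); [|now apply is_derive_Reals].
  apply (deriv_minimum f p q x pr); try tauto.
  intros t H1 H2; apply Hmin; lra.
Qed.

Lemma is_derive_shift (f : R -> R) (c x l : R) :
  is_derive f x l -> is_derive (fun t => f t + c) x l.
Proof.
  intros Hf.
  apply (is_derive_eq _ _ (l + 0)); [|ring].
  apply is_derive_Reals, (derivable_pt_lim_plus f (fun _ => c)).
  - now apply is_derive_Reals.
  - apply derivable_pt_lim_const.
Qed.

Lemma is_derive_lin2 (f g : R -> R) (k1 k2 x lf lg : R) :
  is_derive f x lf -> is_derive g x lg ->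
  is_derive (fun t => k1 * f t + k2 * g t) x (k1 * lf + k2 * lg).
Proof.
  intros Hf Hg.
  apply (is_derive_plus (fun t => k1 * f t) (fun t => k2 * g t)).
  - now apply (is_derive_scal f x k1 lf).
  - now apply (is_derive_scal g x k2 lg).
Qed.

Lemma continuity_pt_lin2 (f g : R -> R) (k1 k2 x : R) :
  continuity_pt f x -> continuity_pt g x ->
  continuity_pt (fun t => k1 * f t + k2 * g t) x.
Proof.
  intros Hf Hg.
  apply (continuity_pt_plus (fun t => k1 * f t) (fun t => k2 * g t)).
  - now apply (continuity_pt_scal f k1 x).
  - now apply (continuity_pt_scal g k2 x).
Qed.

(** Rolle's theorem, applied twice to [f] minus the quadratic that shares its value and slope at [p]
    and its value at [q]. Continuity is enough at [q], so a mesh cell may end at the boundary or at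
    the interface. *)
Lemma taylor2_right (f f1 f2 : R -> R) (p q : R) :
  p < q ->
  (forall x, p <= x < q -> is_derive f x (f1 x)) ->
  (forall x, p <= x < q -> is_derive f1 x (f2 x)) ->
  continuity_pt f q ->
  exists c, p < c < q /\
    f q = f p + (q - p) * f1 p + (q - p) ^ 2 / 2 * f2 c.
Proof.
  intros Hpq H1 H2 Hq.
  set (k := (f q - f p - (q - p) * f1 p) / (q - p) ^ 2).
  set (g := fun x => 1 * f x + (-1) * (f p + (x - p) * f1 p + k * (x - p) ^ 2)).
  set (g1 := fun x => 1 * f1 x + (-1) * (f1 p + 2 * k * (x - p))).
  assert (Hg : forall x, p <= x < q -> is_derive g x (g1 x)).
  { intros x Hx. apply is_derive_lin2; [now apply H1|].
    auto_derive; [exact I | ring]. }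
  assert (Hg1 : forall x, p <= x < q -> is_derive g1 x (f2 x - 2 * k)).
  { intros x Hx.
    apply (is_derive_eq _ _ (1 * f2 x + (-1) * (2 * k))); [|ring].
    apply is_derive_lin2; [now apply H2|].
    auto_derive; [exact I | ring]. }
  assert (Hgp : g p = 0) by (unfold g; ring).
  assert (Hgq : g q = 0) by (unfold g, k; field; lra).
  destruct (mvt_open g g1 p q Hpq) as [c [Hc E]].
  - intros x Hx; apply Hg; lra.
  - intros x Hx. destruct (Rlt_dec x q) as [Hxq|Hxq].
    + apply (is_derive_continuity_pt _ _ (g1 x)), Hg; lra.
    + replace x with q by lra. apply continuity_pt_lin2; [exact Hq|].
      apply (is_derive_continuity_pt _ _ (f1 p + 2 * k * (q - p))).
      auto_derive; [exact I | ring].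
  - destruct (mvt_open g1 (fun x => f2 x - 2 * k) p c) as [e [He E']].
    + lra.
    + intros x Hx; apply Hg1; lra.
    + intros x Hx. apply (is_derive_continuity_pt _ _ (f2 x - 2 * k)), Hg1; lra.
    + exists e; split; [lra|].
      assert (Hk : f2 e = 2 * k).
      { assert (g1 c = 0).
        { assert (g1 c * (q - p) = 0) by lra.
          apply Rmult_integral in H as [H|H]; lra. }
        assert (Hgp1 : g1 p = 0) by (unfold g1; ring).
        rewrite Hgp1, H in E'.
        assert (H' : (f2 e - 2 * k) * (c - p) = 0) by lra.
        apply Rmult_integral in H' as [H'|H']; lra. }
      rewrite Hk. unfold k. field. lra.
Qed.

Lemma taylor2_left (f f1 f2 : R -> R) (p q : R) :
  p < q ->
  (forall x, p < x <= q -> is_derive f x (f1 x)) ->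
  (forall x, p < x <= q -> is_derive f1 x (f2 x)) ->
  continuity_pt f p ->
  exists c, p < c < q /\
    f p = f q - (q - p) * f1 q + (q - p) ^ 2 / 2 * f2 c.
Proof.
  intros Hpq H1 H2 Hp.
  destruct (taylor2_right (fun x => f (p + q - x))
              (fun x => - f1 (p + q - x)) (fun x => f2 (p + q - x)) p q Hpq)
    as [c [Hc E]].
  - intros x Hx. apply is_derive_reflect, H1; lra.
  - intros x Hx.
    apply (is_derive_eq _ _ (- (- f2 (p + q - x)))); [|ring].
    apply (is_derive_opp (fun x => f1 (p + q - x))).
    apply is_derive_reflect, H2; lra.
  - apply continuity_pt_reflect. now replace (p + q - q) with p by ring.
  - exists (p + q - c); split; [lra|].
    replace (p + q - q) with p in E by ring.
    replace (p + q - p) with q in E by ring.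
    rewrite E; ring.
Qed.

(* A weighted mean of second derivatives, so any bound on the latter passes to
   the second difference, even on a strongly nonuniform mesh. *)
Lemma delta2_near (X : nat -> R) (f f1 f2 : R -> R) (k L B : R) (i : nat) :
  X i < X (S i) < X (S (S i)) ->
  (forall x, X i < x < X (S (S i)) -> is_derive f x (f1 x)) ->
  (forall x, X i < x < X (S (S i)) -> is_derive f1 x (f2 x)) ->
  continuity_pt f (X i) -> continuity_pt f (X (S (S i))) ->
  (forall c, X i < c < X (S (S i)) -> Rabs (k * f2 c - L) <= B) ->
  Rabs (k * delta2 X (fun j => f (X j)) (S i) - L) <= B.
Proof.
  intros Hx H1 H2 Hp Hq HB.
  destruct (taylor2_right f f1 f2 (X (S i)) (X (S (S i)))) as [c [Hc Ec]];
    try (intros; (apply H1 || apply H2); lra); try lra; try exact Hq.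
  destruct (taylor2_left f f1 f2 (X i) (X (S i))) as [e [He Ee]];
    try (intros; (apply H1 || apply H2); lra); try lra; try exact Hp.
  unfold delta2, Dplus, Dminus. simpl pred.
  rewrite Ec, Ee.
  set (h := X (S i) - X i). set (h' := X (S (S i)) - X (S i)).
  replace (X (S (S i)) - X i) with (h + h') by (unfold h, h'; ring).
  assert (Hh : 0 < h) by (unfold h; lra).
  assert (Hh' : 0 < h') by (unfold h'; lra).
  replace (k * _ - L) with
    (h' / (h + h') * (k * f2 c - L) + h / (h + h') * (k * f2 e - L))
    by (field; lra).
  assert (B1 := HB c ltac:(lra)). assert (B2 := HB e ltac:(lra)).
  assert (W : h' / (h + h') + h / (h + h') = 1) by (field; lra).
  assert (W1 : 0 < h' / (h + h')) by (apply Rdiv_lt_0_compat; lra).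
  assert (W2 : 0 < h / (h + h')) by (apply Rdiv_lt_0_compat; lra).
  apply Rabs_le_between in B1. apply Rabs_le_between in B2.
  apply Rabs_le_between. nra.
Qed.

(** * Maximum principles *)

(** Near a point with [P < 0] and [P1 = 0] the reaction term outweighs the convection term, which
    forces [P2 < 0]. The slope therefore decreases to 0 at [x0], so it is positive just before, and
    [P] lies below [P x0] there. Nothing is assumed about the equation at [x0] itself. *)
Lemma negative_min_descends_left (eps mu gamma M eta x0 : R)
    (a b P P1 P2 : R -> R) :
  0 < eps -> 0 < mu -> 0 < gamma -> 0 < eta ->
  P1 x0 = 0 -> continuity_pt P x0 -> continuity_pt P1 x0 ->
  (forall x, x0 - eta < x < x0 -> is_derive P x (P1 x)) ->
  (forall x, x0 - eta < x < x0 -> is_derive P1 x (P2 x)) ->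
  (forall x, x0 - eta < x < x0 -> Rabs (a x) <= M /\ gamma <= b x) ->
  (forall x, x0 - eta < x < x0 -> eps * P2 x + mu * a x * P1 x - b x * P x <= 0) ->
  P x0 < 0 ->
  exists x, x0 - eta < x < x0 /\ P x < P x0.
Proof.
  intros He Hm Hg Heta H10 CP CP1 D1 D2 Hab HL Hneg.
  assert (HM : 0 <= M).
  { destruct (Hab (x0 - eta / 2)) as [HM _]; [lra|].
    generalize (Rabs_pos (a (x0 - eta / 2))); lra. }
  assert (Hgp : 0 < gamma * - P x0) by (apply Rmult_lt_0_compat; lra).
  assert (HmM : 0 <= mu * M) by (apply Rmult_le_pos; lra).
  (* While [P1] stays below [k], convection is at most a quarter of [gamma * - P x0], and reaction
     supplies at least half of it. The added 1 covers [M = 0]. *)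
  set (k := gamma * - P x0 / (4 * (mu * M + 1))).
  assert (Hk : 0 < k) by (unfold k; apply Rdiv_lt_0_compat; lra).
  destruct (CP (- P x0 / 2)) as [e1 [He1 C1]]; [lra|].
  destruct (CP1 k Hk) as [e2 [He2 C2]].
  simpl in C1, C2; unfold R_dist, D_x, no_cond in C1, C2.
  set (e := Rmin eta (Rmin e1 e2)).
  assert (Hepos : 0 < e) by (unfold e; repeat apply Rmin_pos; lra).
  assert (Hee : e <= eta /\ e <= e1 /\ e <= e2).
  { unfold e. generalize (Rmin_l eta (Rmin e1 e2)), (Rmin_r eta (Rmin e1 e2)),
      (Rmin_l e1 e2), (Rmin_r e1 e2); lra. }
  assert (HP2 : forall x, x0 - e < x < x0 -> P2 x < 0).
  { intros x Hx.
    assert (Hax : Rabs (x - x0) < e) by (apply Rabs_lt_between; lra).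
    assert (B1 : Rabs (P x - P x0) < - P x0 / 2).
    { apply C1. repeat split; lra. }
    assert (B2 : Rabs (P1 x - P1 x0) < k).
    { apply C2. repeat split; lra. }
    rewrite H10, Rminus_0_r in B2.
    apply Rabs_lt_between in B1.
    destruct (Hab x) as [Ha Hb]; [lra|].
    assert (HL' : eps * P2 x + mu * a x * P1 x - b x * P x <= 0) by (apply HL; lra).
    assert (Q : Rabs (mu * a x * P1 x) <= mu * M * k).
    { rewrite !Rabs_mult, (Rabs_pos_eq mu) by lra.
      apply Rmult_le_compat; try apply Rabs_pos; try lra.
      - apply Rmult_le_pos; [lra | apply Rabs_pos].
      - apply Rmult_le_compat_l; lra. }
    assert (Q' : mu * M * k <= gamma * - P x0 / 4).
    { assert (E : (mu * M + 1) * k = gamma * - P x0 / 4) by (unfold k; field; lra).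
      lra. }
    apply Rabs_le_between in Q.
    assert (Q2 : b x * P x <= gamma * P x0 / 2) by nra.
    assert (eps * P2 x < 0) by lra.
    nra. }
  set (x := x0 - e / 2).
  exists x; split; [unfold x; lra|].
  destruct (Rlt_dec (P x) (P x0)) as [|Hge]; [assumption|exfalso].
  destruct (mvt_open P P1 x x0) as [c [Hc Ec]].
  - unfold x; lra.
  - intros t Ht; apply D1; unfold x in Ht; lra.
  - intros t Ht. destruct (Req_dec t x0) as [->|]; [exact CP|].
    apply (is_derive_continuity_pt _ _ (P1 t)), D1; unfold x in Ht; lra.
  - destruct (mvt_open P1 P2 c x0) as [c' [Hc' Ec']].
    + lra.
    + intros t Ht; apply D2; unfold x in Hc; lra.
    + intros t Ht. destruct (Req_dec t x0) as [->|]; [exact CP1|].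
      apply (is_derive_continuity_pt _ _ (P2 t)), D2; unfold x in Hc; lra.
    + assert (N2 : P2 c' < 0) by (apply HP2; unfold x in Hc; lra).
      assert (0 < P1 c) by nra.
      unfold x in *. nra.
Qed.

Lemma negative_min_descends_right (eps mu gamma M eta x0 : R)
    (a b P P1 P2 : R -> R) :
  0 < eps -> 0 < mu -> 0 < gamma -> 0 < eta ->
  P1 x0 = 0 -> continuity_pt P x0 -> continuity_pt P1 x0 ->
  (forall x, x0 < x < x0 + eta -> is_derive P x (P1 x)) ->
  (forall x, x0 < x < x0 + eta -> is_derive P1 x (P2 x)) ->
  (forall x, x0 < x < x0 + eta -> Rabs (a x) <= M /\ gamma <= b x) ->
  (forall x, x0 < x < x0 + eta -> eps * P2 x + mu * a x * P1 x - b x * P x <= 0) ->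
  P x0 < 0 ->
  exists x, x0 < x < x0 + eta /\ P x < P x0.
Proof.
  intros He Hm Hg Heta H10 CP CP1 D1 D2 Hab HL Hneg.
  assert (E : 2 * x0 - x0 = x0) by ring.
  destruct (negative_min_descends_left eps mu gamma M eta x0
    (fun x => - a (2 * x0 - x)) (fun x => b (2 * x0 - x))
    (fun x => P (2 * x0 - x)) (fun x => - P1 (2 * x0 - x))
    (fun x => P2 (2 * x0 - x))) as [x [Hx Hlt]]; trivial.
  - rewrite E; lra.
  - apply continuity_pt_reflect; now rewrite E.
  - apply (continuity_pt_opp (fun x => P1 (2 * x0 - x))).
    apply continuity_pt_reflect; now rewrite E.
  - intros x Hx. apply is_derive_reflect, D1; lra.
  - intros x Hx.
    apply (is_derive_eq _ _ (- (- P2 (2 * x0 - x)))); [|ring].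
    apply (is_derive_opp (fun x => P1 (2 * x0 - x))).
    apply is_derive_reflect, D2; lra.
  - intros x Hx. rewrite Rabs_Ropp. apply Hab; lra.
  - intros x Hx. assert (H := HL (2 * x0 - x)).
    replace (mu * - a (2 * x0 - x) * - P1 (2 * x0 - x))
      with (mu * a (2 * x0 - x) * P1 (2 * x0 - x)) by ring.
    apply H; lra.
  - now rewrite E.
  - exists (2 * x0 - x). rewrite E in Hlt. split; [lra | exact Hlt].
Qed.

(* The equation may fail at the interface [d], where [P] is only [C^1]: at a
   negative minimum the argument is made on one side of it. *)
Lemma max_principle (eps mu gamma M p d q : R) (a b P P1 P2 : R -> R) :
  0 < eps -> 0 < mu -> 0 < gamma -> p < d < q ->
  (forall x, p <= x <= q -> continuity_pt P x) ->
  (forall x, p < x < q -> is_derive P x (P1 x)) ->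
  (forall x, p < x < q -> continuity_pt P1 x) ->
  (forall x, p < x < q -> x <> d -> is_derive P1 x (P2 x)) ->
  (forall x, p < x < q -> x <> d -> Rabs (a x) <= M /\ gamma <= b x) ->
  (forall x, p < x < q -> x <> d -> eps * P2 x + mu * a x * P1 x - b x * P x <= 0) ->
  0 <= P p -> 0 <= P q ->
  forall x, p <= x <= q -> 0 <= P x.
Proof.
  intros He Hm Hg Hd CP D1 CP1 D2 Hab HL Hp Hq x Hx.
  destruct (continuity_ab_min P p q) as [x0 [Hmin Hx0]]; [lra | exact CP |].
  destruct (Rle_dec 0 (P x0)) as [H0|H0].
  { apply Rle_trans with (1 := H0), Hmin, Hx. }
  exfalso.
  assert (Hne : x0 <> p /\ x0 <> q) by (split; intros ->; lra).
  assert (Hin : p < x0 < q) by lra.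
  assert (Z : P1 x0 = 0).
  { apply (is_derive_interior_min P p q x0); trivial.
    - intros t Ht; apply Hmin; lra.
    - now apply D1. }
  destruct (Rle_dec x0 d) as [Hxd|Hxd].
  - destruct (negative_min_descends_left eps mu gamma M (x0 - p) x0 a b P P1 P2)
      as [t [Ht Hlt]]; trivial; try lra; try (now apply CP1); try (apply CP; lra);
      try (intros t Ht; (apply D1 || apply D2 || apply Hab || apply HL); lra).
    assert (P x0 <= P t) by (apply Hmin; lra). lra.
  - destruct (negative_min_descends_right eps mu gamma M (q - x0) x0 a b P P1 P2)
      as [t [Ht Hlt]]; trivial; try lra; try (now apply CP1); try (apply CP; lra);
      try (intros t Ht; (apply D1 || apply D2 || apply Hab || apply HL); lra).
    assert (P x0 <= P t) by (apply Hmin; lra). lra.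
Qed.

(* If [P] were negative somewhere, the inequality would make it decrease, hence
   stay negative, all the way to the right end. *)
Lemma backward_comparison (p q : R) (r P P1 : R -> R) :
  p < q ->
  (forall x, p <= x <= q -> continuity_pt P x) ->
  (forall x, p <= x < q -> is_derive P x (P1 x)) ->
  (forall x, p <= x < q -> 0 < r x) ->
  (forall x, p <= x < q -> P1 x <= r x * P x) ->
  0 <= P q -> 0 <= P p.
Proof.
  intros Hpq CP D1 Hr HL Hq.
  destruct (continuity_ab_min P p q) as [x0 [Hmin Hx0]]; [lra | exact CP |].
  destruct (Rle_dec 0 (P x0)) as [H0|H0].
  { apply Rle_trans with (1 := H0), Hmin; lra. }
  exfalso.
  assert (Hne : x0 <> q) by (intros ->; lra).
  assert (Hin : p <= x0 < q) by lra.
  assert (N1 : P1 x0 < 0).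
  { assert (H1 := HL x0 Hin). assert (H2 := Hr x0 Hin). nra. }
  assert (D := D1 x0 Hin). apply is_derive_Reals in D.
  destruct (D (- P1 x0)) as [del Hdel]; [lra|].
  set (h := Rmin (del / 2) (q - x0)).
  assert (Hh : 0 < h) by (apply Rmin_pos; [destruct del; simpl; lra | lra]).
  assert (Hh1 : h <= del / 2) by apply Rmin_l.
  assert (Hh2 : h <= q - x0) by apply Rmin_r.
  assert (Q := Hdel h). rewrite (Rabs_pos_eq h) in Q by lra.
  assert (Hdp : 0 < del) by apply cond_pos.
  specialize (Q ltac:(lra) ltac:(lra)).
  apply Rabs_lt_between in Q.
  assert (P x0 <= P (x0 + h)) by (apply Hmin; lra).
  assert (0 <= (P (x0 + h) - P x0) / h).
  { apply Rmult_le_pos; [lra | left; now apply Rinv_0_lt_compat]. }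
  lra.
Qed.

(** * Solution bounds on the left part of the interval *)

Lemma exp_le (x y : R) : x <= y -> exp x <= exp y.
Proof.
  intros [H| ->]; [left; now apply exp_increasing | apply Rle_refl].
Qed.

Definition decay (th s : R) : R := exp (- (th * s)).

Lemma decay_pos (th s : R) : 0 < decay th s.
Proof. apply exp_pos. Qed.

Lemma decay_le_1 (th s : R) : 0 <= th -> 0 <= s -> decay th s <= 1.
Proof.
  intros Ht Hs. unfold decay. rewrite <- exp_0.
  apply exp_le. assert (0 <= th * s) by now apply Rmult_le_pos. lra.
Qed.

Lemma decay_antitone (th s t : R) : 0 <= th -> s <= t -> decay th t <= decay th s.
Proof. intros Ht Hs. apply exp_le. nra. Qed.

Lemma is_derive_decay (th x : R) :
  is_derive (decay th) x (- th * decay th x).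
Proof. unfold decay. auto_derive; [exact I | ring]. Qed.

Lemma is_derive_decay_reflect (th d x : R) :
  is_derive (fun t => decay th (d - t)) x (th * decay th (d - x)).
Proof. unfold decay. auto_derive; [exact I | unfold Rminus; ring]. Qed.

(** A shift by one layer width changes the exponential by a factor of at most e, here rounded up to
    3. *)
Lemma decay_within_width (th s t : R) :
  0 < th -> Rabs (s - t) <= / th -> decay th s <= 3 * decay th t.
Proof.
  intros Ht H. apply Rabs_le_between in H.
  replace (decay th s) with (exp (th * (t - s)) * decay th t)
    by (unfold decay; rewrite <- exp_plus; f_equal; ring).
  apply Rmult_le_compat_r; [left; apply decay_pos|].
  apply Rle_trans with (exp 1); [apply exp_le | apply exp_le_3].
  replace 1 with (th * / th) by (field; lra).
  scaled.
Qed.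

Lemma is_derive_Rmult (f g : R -> R) (x lf lg : R) :
  is_derive f x lf -> is_derive g x lg ->
  is_derive (fun t => f t * g t) x (lf * g x + f x * lg).
Proof.
  intros Hf Hg. apply is_derive_Reals, (derivable_pt_lim_mult f g);
  now apply is_derive_Reals.
Qed.

Set Implicit Arguments.

(* [A] is minus the convection coefficient, so that it is positive on the left of
   the interface; [v = - f / b] is the reduced solution and [v1, v2, v3] its
   derivatives. *)
Record half_data (d alpha rho gamma M : R)
    (A A1 b b1 v v1 v2 v3 : R -> R) : Prop := {
  hd_A : forall x, 0 <= x < d -> alpha <= A x;
  hd_rho : forall x, 0 <= x < d -> rho * A x <= b x;
  hd_gamma : forall x, 0 <= x <= d -> gamma <= b x;
  hd_cont : forall x, continuity_pt A x /\ continuity_pt b x /\ continuity_pt v x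
              /\ continuity_pt v1 x /\ continuity_pt v2 x;
  hd_dA : forall x, 0 < x < d -> is_derive A x (A1 x);
  hd_db : forall x, 0 < x < d -> is_derive b x (b1 x);
  hd_dv : forall x, 0 < x < d -> is_derive v x (v1 x);
  hd_dv1 : forall x, 0 < x < d -> is_derive v1 x (v2 x);
  hd_dv2 : forall x, 0 < x < d -> is_derive v2 x (v3 x);
  hd_bound : forall x, 0 <= x <= d ->
    (Rabs (A x) <= M /\ Rabs (A1 x) <= M) /\ (Rabs (b x) <= M /\ Rabs (b1 x) <= M) /\
    (Rabs (v x) <= M /\ Rabs (v1 x) <= M) /\ (Rabs (v2 x) <= M /\ Rabs (v3 x) <= M)
}.

(* [1 / th1] and [1 / th2] are the layer widths at the interface and at the outer
   boundary; these relations are all that is used of their definition. *)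
Record regime (alpha rho C eps mu th1 th2 : R) : Prop := {
  rg_eps : 0 < eps <= 1;
  rg_mu : 0 < mu <= 1;
  rg_th1 : 0 < th1;
  rg_th2 : 0 < th2;
  rg_slow : forall a b, alpha <= a -> rho * a <= b ->
    eps * th2 ^ 2 + mu * a * th2 <= b;
  rg_fast : forall a b, alpha <= a -> rho * a <= b ->
    eps * th1 ^ 2 - mu * a * th1 <= b;
  rg_eps_th2 : eps * th2 <= C;
  rg_mu_th2 : mu * th2 <= C;
  rg_th : th2 <= C * th1;
  rg_eps_th1 : 1 <= C * (eps * th1 ^ 2);
  rg_mu_th1 : mu <= C * (eps * th1);
  rg_eps_th : eps * th1 * th2 <= C;
  rg_cases : th1 = th2 \/ (2 * (eps * th1) = alpha * mu /\ 1 <= C * (mu * th2))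
}.

Record half_solution (d eps mu M : R) (A b v y y1 : R -> R) : Prop := {
  hs_cont : forall x, continuity_pt y x;
  hs_cont1 : forall x, 0 < x <= d -> continuity_pt y1 x;
  hs_dy : forall x, 0 < x < d -> is_derive y x (y1 x);
  hs_dy1 : forall x, 0 < x < d ->
    is_derive y1 x ((mu * A x * y1 x + b x * (y x - v x)) / eps);
  hs_bound : forall x, 0 <= x <= d -> Rabs (y x) <= M
}.

(** Here [z] stands for the distance to the reduced solution and [w] for [eps z''']. The weight
    [eps * th1 ^ 3] is the natural size of [mu z''] and of [w] at the interface, since [z''] is of
    size [th1 ^ 2] and [mu] is at most of order [eps * th1]. *)
Record residual_profile (d eps mu th1 th2 K : R)
    (A b z z1 z2 w : R -> R) : Prop := {
  rp_cont : forall x, continuity_pt z x;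
  rp_cont1 : continuity_pt z1 d;
  rp_dz : forall x, 0 < x < d -> is_derive z x (z1 x);
  rp_dz1 : forall x, 0 < x < d -> is_derive z1 x (z2 x);
  rp_dz2 : forall x, 0 < x < d -> is_derive (fun t => eps * z2 t) x (w x);
  rp_eq : forall x, 0 < x < d ->
    Rabs (eps * z2 x - mu * A x * z1 x - b x * z x) <= K * / th2;
  rp_z : forall x, 0 <= x <= d ->
    Rabs (z x) <= K * (decay th2 x + decay th1 (d - x) + / th2);
  rp_z1 : forall x, 0 < x < d ->
    Rabs (z1 x) <= K * (th2 * decay th2 x + 1 + th1 * decay th1 (d - x));
  rp_z2 : forall x, 0 < x < d -> Rabs (z2 x) <= K * th1 ^ 2;
  rp_mu : forall x, 0 < x < d ->
    mu * Rabs (z2 x) <= K * (th2 * decay th2 x + 1 + eps * th1 ^ 3 * decay th1 (d - x));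
  rp_w : forall x, 0 < x < d ->
    Rabs (w x) <= K * (th2 * decay th2 x + 1 + eps * th1 ^ 3 * decay th1 (d - x))
}.

Unset Implicit Arguments.

Section SolutionBounds.

Variables d alpha rho gamma M C eps mu th1 th2 : R.
Variables A A1 b b1 v v1 v2 v3 y y1 : R -> R.

Hypothesis d_pos : 0 < d.
Hypothesis alpha_pos : 0 < alpha.
Hypothesis gamma_pos : 0 < gamma.
Hypothesis M_ge_1 : 1 <= M.
Hypothesis C_ge_1 : 1 <= C.
Hypothesis data : half_data d alpha rho gamma M A A1 b b1 v v1 v2 v3.
Hypothesis reg : regime alpha rho C eps mu th1 th2.
Hypothesis sol : half_solution d eps mu M A b v y y1.
Hypothesis th1_large : 2 <= d * th1.
Hypothesis th2_large : 1 <= C * th2.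

Let e2 x := decay th2 x.
Let e1 x := decay th1 (d - x).
Let z x := y x - v x.
Let z1 x := y1 x - v1 x.
Let z2 x := (mu * A x * y1 x + b x * (y x - v x)) / eps - v2 x.
Let g x := mu * A x * v1 x - eps * v2 x.

Let eps_pos : 0 < eps. Proof. apply (rg_eps reg). Qed.
Let mu_pos : 0 < mu. Proof. apply (rg_mu reg). Qed.
Let th1_pos : 0 < th1. Proof. apply (rg_th1 reg). Qed.
Let th2_pos : 0 < th2. Proof. apply (rg_th2 reg). Qed.

#[local] Hint Resolve eps_pos mu_pos th1_pos th2_pos : core.

(** The zeroth-order term [b * v] cancels [f], so the defect [g] of the reduced solution carries a
    factor [mu] or [eps] in each term. *)
Lemma residual_equation (x : R) :
  eps * z2 x = mu * A x * z1 x + b x * z x + g x.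
Proof.
  unfold z2, z1, z, g. field. lra.
Qed.

Let inv_th2_pos : 0 < / th2.
Proof. apply Rinv_0_lt_compat; auto. Qed.

Let layers_pos (x : R) : 0 < e2 x /\ 0 < e1 x /\ 0 < th2 * e2 x /\ 0 < th1 * e1 x.
Proof.
  assert (E2 : 0 < e2 x) by apply decay_pos. assert (E1 : 0 < e1 x) by apply decay_pos.
  repeat split; trivial; now apply Rmult_lt_0_compat.
Qed.

Let inv_th2_le : / th2 <= C.
Proof.
  apply Rmult_le_reg_l with th2; [lra|].
  rewrite Rinv_r; lra.
Qed.

Let eps_le : eps <= C * / th2.
Proof.
  apply Rmult_le_reg_r with th2; [lra|].
  rewrite Rmult_assoc, Rinv_l by lra.
  generalize (rg_eps_th2 reg); lra.
Qed.

Let mu_le : mu <= C * / th2.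
Proof.
  apply Rmult_le_reg_r with th2; [lra|].
  rewrite Rmult_assoc, Rinv_l by lra.
  generalize (rg_mu_th2 reg); lra.
Qed.

Let one_le_th1 : 1 <= C ^ 2 * th1.
Proof.
  assert (H := rg_th reg).
  assert (C * th2 <= C * (C * th1)) by scaled.
  simpl. lra.
Qed.

Let inv_th1_le : / th1 <= C * (eps * th1).
Proof.
  apply Rmult_le_reg_r with th1; [lra|].
  rewrite Rinv_l by lra.
  generalize (rg_eps_th1 reg).
  simpl; lra.
Qed.

Let eps_abs : Rabs eps <= C * / th2 /\ Rabs eps <= 1.
Proof. rewrite Rabs_pos_eq by lra. split; [exact eps_le | apply (rg_eps reg)]. Qed.

Let mu_abs : Rabs mu <= C * / th2 /\ Rabs mu <= C * (eps * th1) /\ Rabs mu <= 1.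
Proof.
  rewrite Rabs_pos_eq by lra.
  split; [exact mu_le | split; [apply (rg_mu_th1 reg) | apply (rg_mu reg)]].
Qed.

Lemma residual_rhs_bound (x : R) : 0 <= x <= d -> Rabs (g x) <= 2 * M ^ 2 * C * / th2.
Proof.
  intros Hx. destruct (hd_bound data Hx) as [[HA _] [_ [[_ Hv1] [Hv2 _]]]].
  destruct mu_abs as [Hmu _]. destruct eps_abs as [Heps _].
  assert (Q1 : Rabs (mu * A x * v1 x) <= C * / th2 * M * M) by prod_bound.
  assert (Q2 : Rabs (eps * v2 x) <= C * / th2 * M) by prod_bound.
  assert (HMM : C * / th2 * M <= C * / th2 * M * M).
  { rewrite <- (Rmult_1_r (C * / th2 * M)) at 1.
    apply Rmult_le_compat_l; [nonneg | lra]. }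
  unfold g. replace (2 * M ^ 2 * C * / th2) with (2 * (C * / th2 * M * M)) by ring.
  abs_lra.
Qed.

Lemma is_derive_z (x : R) : 0 < x < d -> is_derive z x (z1 x).
Proof.
  intros Hx. apply (is_derive_minus y v).
  - now apply (hs_dy sol).
  - now apply (hd_dv data).
Qed.

Lemma is_derive_z1 (x : R) : 0 < x < d -> is_derive z1 x (z2 x).
Proof.
  intros Hx. apply (is_derive_minus y1 v1).
  - now apply (hs_dy1 sol).
  - now apply (hd_dv1 data).
Qed.

Lemma continuity_z (x : R) : continuity_pt z x.
Proof.
  apply (continuity_pt_minus y v).
  - apply (hs_cont sol).
  - apply (hd_cont data).
Qed.

Lemma continuity_z1 (x : R) : 0 < x <= d -> continuity_pt z1 x.
Proof.
  intros Hx. apply (continuity_pt_minus y1 v1).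
  - now apply (hs_cont1 sol).
  - apply (hd_cont data).
Qed.

Lemma z_crude (x : R) : 0 <= x <= d -> Rabs (z x) <= 2 * M.
Proof.
  intros Hx.
  assert (H1 := hs_bound sol Hx).
  destruct (hd_bound data Hx)
    as [_ [_ [[Hv _] _]]].
  unfold z. abs_lra.
Qed.

(** The first summand dominates [z] at the two end points, the second makes [b * z_const * / th2]
    dominate the defect [g]. *)
Definition z_const : R := 2 * M + 2 * M ^ 2 * C / gamma.

Let z_const_pos : 2 * M <= z_const.
Proof.
  assert (0 <= 2 * M ^ 2 * C / gamma) by nonneg.
  unfold z_const. lra.
Qed.

Lemma e1_at_interface : e1 d = 1.
Proof. unfold e1, decay. replace (- (th1 * (d - d))) with 0 by ring. apply exp_0. Qed.

(** Maximum principle with the barrier [e2 + e1 + / th2]: [rg_slow] and [rg_fast] say that the two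
    exponentials are supersolutions, and the constant absorbs [g] through the reaction term. *)
Lemma z_bound (x : R) : 0 <= x <= d ->
  Rabs (z x) <= z_const * (e2 x + e1 x + / th2).
Proof.
  intros Hx.
  assert (Main : forall s, s = 1 \/ s = -1 ->
            0 <= z_const * (e2 x + e1 x + / th2) + s * z x).
  { intros s Hs.
    assert (Ends : forall t, 0 <= t <= d -> 1 <= e2 t + e1 t ->
              0 <= z_const * (e2 t + e1 t + / th2) + s * z t).
    { intros t Ht He. assert (Z := z_crude t Ht).
      assert (z_const * 1 <= z_const * (e2 t + e1 t + / th2)) by scaled.
      destruct Hs; subst s; abs_lra. }
    assert (De : forall t, is_derive (fun t => e2 t + e1 t + / th2) t
                             (- th2 * e2 t + th1 * e1 t)).
    { intros t.
      apply (is_derive_shift (fun t => e2 t + e1 t)).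
      apply (is_derive_plus e2 e1);
        [apply is_derive_decay | apply is_derive_decay_reflect]. }
    assert (De' : forall t, is_derive (fun t => - th2 * e2 t + th1 * e1 t) t
                             (- th2 * (- th2 * e2 t) + th1 * (th1 * e1 t))).
    { intros t. apply (is_derive_lin2 e2 e1);
        [apply is_derive_decay | apply is_derive_decay_reflect]. }
    (* The equation holds on all of [(0, d)]; the exceptional point of the principle is put at
       [d / 2] arbitrarily. *)
    apply (max_principle eps mu gamma M 0 (d / 2) d (fun x => - A x) b
      (fun t => z_const * (e2 t + e1 t + / th2) + s * z t)
      (fun t => z_const * (- th2 * e2 t + th1 * e1 t) + s * z1 t)
      (fun t => z_const * (- th2 * (- th2 * e2 t) + th1 * (th1 * e1 t)) + s * z2 t));
      trivial; try lra.
    - intros t Ht. apply (continuity_pt_lin2 (fun t => e2 t + e1 t + / th2) z).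
      + apply (is_derive_continuity_pt _ _ _ (De t)).
      + apply continuity_z.
    - intros t Ht. apply (is_derive_lin2 (fun t => e2 t + e1 t + / th2) z); [apply De|].
      now apply is_derive_z.
    - intros t Ht.
      apply (continuity_pt_lin2 (fun t => - th2 * e2 t + th1 * e1 t) z1).
      + apply (is_derive_continuity_pt _ _ _ (De' t)).
      + apply continuity_z1; lra.
    - intros t Ht _.
      apply (is_derive_lin2 (fun t => - th2 * e2 t + th1 * e1 t) z1); [apply De'|].
      now apply is_derive_z1.
    - intros t Ht _. rewrite Rabs_Ropp. split.
      + apply (hd_bound data); lra.
      + apply (hd_gamma data); lra.
    - intros t Ht _.
      assert (HA : alpha <= A t) by (apply (hd_A data); lra).
      assert (Hr : rho * A t <= b t) by (apply (hd_rho data); lra).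
      assert (Hb : gamma <= b t) by (apply (hd_gamma data); lra).
      assert (S := rg_slow reg HA Hr).
      assert (F := rg_fast reg HA Hr).
      assert (E := residual_equation t).
      assert (G : Rabs (g t) <= 2 * M ^ 2 * C * / th2) by (apply residual_rhs_bound; lra).
      assert (Gs : s * g t <= 2 * M ^ 2 * C * / th2)
        by (destruct Hs; subst s; abs_lra).
      destruct (layers_pos t) as [E2 [E1 _]].
      assert (K : 2 * M ^ 2 * C * / th2 <= z_const * (b t * / th2)).
      { assert (z_const * gamma = 2 * M * gamma + 2 * M ^ 2 * C)
          by (unfold z_const; field; lra).
        assert (2 * M ^ 2 * C * / th2 <= z_const * (gamma * / th2)).
        { rewrite <- Rmult_assoc. apply Rmult_le_compat_r; [lra|].
          assert (0 <= M * gamma) by nonneg. lra. }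
        assert (z_const * (gamma * / th2) <= z_const * (b t * / th2)).
        { apply Rmult_le_compat_l; [lra|]. scaled. }
        lra. }
      assert (T2 : z_const * (e2 t * (eps * th2 ^ 2 + mu * A t * th2 - b t)) <= 0).
      { assert (e2 t * (eps * th2 ^ 2 + mu * A t * th2 - b t) <= 0) by nra. nra. }
      assert (T1 : z_const * (e1 t * (eps * th1 ^ 2 - mu * A t * th1 - b t)) <= 0).
      { assert (e1 t * (eps * th1 ^ 2 - mu * A t * th1 - b t) <= 0) by nra. nra. }
      replace (_ - _) with
        (z_const * (e2 t * (eps * th2 ^ 2 + mu * A t * th2 - b t)) +
         z_const * (e1 t * (eps * th1 ^ 2 - mu * A t * th1 - b t)) -
         z_const * (b t * / th2) +
         s * (eps * z2 t - mu * A t * z1 t - b t * z t)) by ring.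
      rewrite E.
      replace (s * _) with (s * g t) by ring. lra.
    - apply Ends; [lra|].
      assert (E : e2 0 = 1) by (unfold e2, decay; rewrite Rmult_0_r, Ropp_0; apply exp_0).
      assert (E' : 0 < e1 0) by apply decay_pos. lra.
    - apply Ends; [lra|]. rewrite e1_at_interface.
      assert (E' : 0 < e2 d) by apply decay_pos. lra. }
  assert (H1 := Main 1 (or_introl eq_refl)).
  assert (H2 := Main (-1) (or_intror eq_refl)).
  abs_lra.
Qed.

(* [w = eps z' - mu A z] has a derivative free of [z'], which replaces a Gronwall
   argument. *)
Definition local_const : R := 2 + 4 * C * M + 2 * M ^ 2 * C ^ 2.

Lemma local_gradient (p x B : R) :
  0 <= p -> p + / th1 <= d -> p <= x <= p + / th1 -> 0 < x ->
  (forall s, p <= s <= p + / th1 -> Rabs (z s) <= B) ->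
  Rabs (z1 x) <= local_const * th1 * (B + / th2).
Proof.
  intros Hp Hq Hx Hx0 HB. destruct mu_abs as [_ [Hmu Hmu1]].
  assert (Hl : 0 < / th1) by now apply Rinv_0_lt_compat.
  assert (B0 : 0 <= B) by (apply Rle_trans with (2 := HB x Hx); apply Rabs_pos).
  set (w := fun t => eps * z1 t + (- mu) * (A t * z t)).
  set (w1 := fun t => eps * z2 t + (- mu) * (A1 t * z t + A t * z1 t)).
  (* On a window of length [/ th1] the gradient is at most [2 * B * th1] at some point [c]. The
     bound is carried from [c] to [x] by the variation of [w], whose derivative is controlled by [B]
     and [g] alone. *)
  destruct (mvt_open z z1 p (p + / th1)) as [c [Hc Ec]]; [lra| |intros; apply continuity_z|].
  { intros t Ht'; apply is_derive_z; lra. }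
  assert (Zc : Rabs (z1 c) <= 2 * B * th1).
  { assert (E : z1 c = (z (p + / th1) - z p) * th1).
    { rewrite Ec. field. lra. }
    rewrite E, Rabs_mult, (Rabs_pos_eq th1) by lra.
    apply Rmult_le_compat_r; [lra|].
    assert (Q1 := HB p ltac:(lra)). assert (Q2 := HB (p + / th1) ltac:(lra)).
    abs_lra. }
  set (G := 2 * M ^ 2 * C * / th2).
  assert (Dw : forall t, p < t < p + / th1 -> is_derive w t (w1 t)).
  { intros t Ht'. apply (is_derive_lin2 z1 (fun t => A t * z t)).
    - apply is_derive_z1; lra.
    - apply is_derive_Rmult.
      + apply (hd_dA data); lra.
      + apply is_derive_z; lra. }
  assert (Cw : forall t, 0 < t <= d -> continuity_pt w t).
  { intros t Ht'. apply (continuity_pt_lin2 z1 (fun t => A t * z t)).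
    - now apply continuity_z1.
    - apply (continuity_pt_mult A z); [|apply continuity_z].
      apply (hd_cont data). }
  assert (Bw : forall t, p < t < p + / th1 -> Rabs (w1 t) <= 2 * M * B + G).
  { intros t Ht'.
    assert (E : w1 t = b t * z t + g t + (- mu) * (A1 t * z t)).
    { unfold w1. rewrite residual_equation. ring. }
    destruct (hd_bound data (x := t)) as [[_ HA1] [[Hb _] _]]; [lra|].
    assert (Hz : Rabs (z t) <= B) by (apply HB; lra).
    assert (Hg : Rabs (g t) <= G) by (apply residual_rhs_bound; lra).
    assert (Q1 : Rabs (b t * z t) <= M * B) by prod_bound.
    assert (Q2 : Rabs (mu * (A1 t * z t)) <= 1 * (M * B)) by prod_bound.
    rewrite E. abs_lra. }
  assert (S0 : 0 <= 2 * M * B + G) by (apply Rle_trans with (2 := Bw c Hc); apply Rabs_pos).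
  assert (Wxc : Rabs (w x - w c) <= / th1 * (2 * M * B + G)).
  { replace (/ th1) with (p + / th1 - p) by ring.
    apply (derivative_bound_lipschitz w w1); trivial; try lra; apply Cw; lra. }
  assert (AZ : forall t, p <= t <= p + / th1 ->
            Rabs (mu * (A t * z t)) <= C * (eps * th1) * (M * B)).
  { intros t Ht'. destruct (hd_bound data (x := t)) as [[HA _] _]; [lra|].
    assert (Hz := HB t Ht'). prod_bound. }
  assert (AZx := AZ x Hx). assert (AZc := AZ c ltac:(lra)).
  assert (W' : / th1 * (2 * M * B + G) <= C * (eps * th1) * (2 * M * B + G)).
  { apply Rmult_le_compat_r; [exact S0 | apply inv_th1_le]. }
  assert (EZc : Rabs (eps * z1 c) <= eps * (2 * B * th1)).
  { rewrite Rabs_mult, (Rabs_pos_eq eps) by lra. scaled. }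
  assert (Fin : Rabs (eps * z1 x) <= eps * (local_const * th1 * (B + / th2))).
  { assert (E : eps * z1 x = (w x - w c) + eps * z1 c + mu * (A x * z x) - mu * (A c * z c))
      by (unfold w; ring).
    assert (Bd : eps * (2 * B * th1) + 2 * (C * (eps * th1) * (M * B))
              + C * (eps * th1) * (2 * M * B + G)
              <= eps * (local_const * th1 * (B + / th2))).
    { apply Rle_trans with (eps * th1 * ((2 + 4 * C * M) * B + 2 * M ^ 2 * C ^ 2 * / th2)).
      { right. unfold G. ring. }
      replace (eps * (local_const * th1 * (B + / th2)))
        with (eps * th1 * (local_const * (B + / th2))) by ring.
      apply Rmult_le_compat_l; [nonneg|].
      unfold local_const.
      assert (0 <= 2 * M ^ 2 * C ^ 2 * B) by nonneg.
      assert (0 <= (2 + 4 * C * M) * / th2) by nonneg.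
      lra. }
    rewrite E.
    abs_lra. }
  rewrite Rabs_mult, (Rabs_pos_eq eps) in Fin by lra.
  now apply Rmult_le_reg_l in Fin.
Qed.

(** Homogeneous solutions of [eps p' = mu A p] decay to the left, so the value at [d] and the
    forcing control everything before it. The rate [th1] is half of the guaranteed rate
    [alpha * mu / eps]: after paying for the growth of [e1], half of the convection term is left to
    absorb the [e1] part of [F], hence the factor [2 / (alpha * mu)]. *)
Lemma first_order_bound (k2 k0 k1 Pd x : R) (p p1 F : R -> R) :
  2 * (eps * th1) = alpha * mu ->
  0 <= k2 -> 0 <= k0 -> 0 <= k1 -> 0 < x < d ->
  (forall t, 0 < t <= d -> continuity_pt p t) ->
  (forall t, 0 < t < d -> is_derive p t (p1 t)) ->
  (forall t, 0 < t < d -> eps * p1 t = mu * A t * p t + F t) ->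
  (forall t, 0 < t < d -> Rabs (F t) <= k2 * e2 t + k0 + k1 * e1 t) ->
  Rabs (p d) <= Pd ->
  Rabs (p x) <= 2 / (alpha * mu) * (k2 * e2 x + k0 + k1 * e1 x) + Pd * e1 x.
Proof.
  intros Hth K2 K0 K1 Hx Cp Dp Ep BF Bd.
  assert (Main : forall s, s = 1 \/ s = -1 ->
    0 <= 2 / (alpha * mu) * (k2 * e2 x + k0 + k1 * e1 x) + Pd * e1 x + s * p x).
  { intros s Hs.
    assert (Pd0 : 0 <= Pd) by (apply Rle_trans with (2 := Bd); apply Rabs_pos).
    assert (Ham : 0 < alpha * mu) by now apply Rmult_lt_0_compat.
    set (c := 2 / (alpha * mu)).
    assert (Hc2 : c * (alpha * mu) = 2) by (unfold c; field; lra).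
    set (be := fun t => (c * k2) * e2 t + (c * k1 + Pd) * e1 t).
    set (be1 := fun t => (c * k2) * (- th2 * e2 t) + (c * k1 + Pd) * (th1 * e1 t)).
    assert (Db : forall t, is_derive be t (be1 t)).
    { intros t. apply (is_derive_lin2 e2 e1);
        [apply is_derive_decay | apply is_derive_decay_reflect]. }
    set (Q := fun t => 1 * (be t + c * k0) + s * p t).
    set (Q1 := fun t => 1 * be1 t + s * p1 t).
    assert (DQ : forall t, 0 < t < d -> is_derive Q t (Q1 t)).
    { intros t Ht. apply (is_derive_lin2 (fun t => be t + c * k0) p); [|now apply Dp].
      apply (is_derive_shift be), Db. }
    replace (_ + s * p x) with (Q x) by (unfold Q, be, c; ring).
    apply (backward_comparison x d (fun t => mu * A t / eps) Q Q1); [lra| | | | |].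
    - intros t Ht. apply (continuity_pt_lin2 (fun t => be t + c * k0) p); [|apply Cp; lra].
      apply (continuity_pt_plus be (fun _ => c * k0));
        [apply (is_derive_continuity_pt _ _ _ (Db t)) |
         apply continuity_pt_const; now intros ? ?].
    - intros t Ht; apply DQ; lra.
    - intros t Ht.
      assert (HA : alpha <= A t) by (apply (hd_A data); lra).
      apply Rdiv_lt_0_compat; [|lra]. apply Rmult_lt_0_compat; lra.
    - intros t Ht.
      assert (HA : alpha <= A t) by (apply (hd_A data); lra).
      assert (BF' : Rabs (F t) <= k2 * e2 t + k0 + k1 * e1 t) by (apply BF; lra).
      assert (EP : eps * p1 t = mu * A t * p t + F t) by (apply Ep; lra).
      apply Rmult_le_reg_l with eps; [lra|].
      replace (eps * (mu * A t / eps * Q t)) with (mu * A t * Q t) by (field; lra).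
      replace (eps * Q1 t) with (eps * be1 t + s * (eps * p1 t)) by (unfold Q1; ring).
      rewrite EP.
      destruct (layers_pos t) as [E2 [E1 [T2 T1]]].
      assert (SF : s * F t <= k2 * e2 t + k0 + k1 * e1 t).
      { destruct Hs; subst s; abs_lra. }
      assert (muA : alpha * mu <= mu * A t) by nra.
      set (m := mu * A t) in *.
      assert (P3 : 0 <= Pd * e1 t) by nonneg.
      assert (Lift : forall r u, 0 <= u -> alpha * mu <= r -> 2 * u <= r * (c * u)).
      { intros r u Hu Hr.
        replace (2 * u) with (alpha * mu * (c * u)) by (rewrite <- Hc2; ring).
        apply Rmult_le_compat_r; [nonneg | exact Hr]. }
      assert (R2 : 2 * (k2 * e2 t) <= m * (c * (k2 * e2 t))).
      { apply Lift; [nonneg | exact muA]. }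
      assert (R0 : 2 * k0 <= m * (c * k0)) by now apply Lift.
      assert (R1 : 2 * (k1 * e1 t) <= 2 * (m - eps * th1) * (c * (k1 * e1 t))).
      { apply Lift; [nonneg | lra]. }
      assert (R3 : 0 <= (m - eps * th1) * (Pd * e1 t)) by nra.
      assert (R4 : 0 <= eps * th2 * (c * (k2 * e2 t))) by nonneg.
      assert (P2' : 0 <= k2 * e2 t) by nonneg.
      unfold Q, be1, be. lra.
    - assert (E : e1 d = 1).
      { unfold e1, decay. replace (- (th1 * (d - d))) with 0 by ring. apply exp_0. }
      unfold Q, be. rewrite E.
      assert (E2 : 0 < e2 d) by apply decay_pos.
      assert (P2 : 0 <= c * k2 * e2 d) by nonneg.
      assert (P0 : 0 <= c * k0) by nonneg.
      assert (P1 : 0 <= c * k1) by nonneg.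
      destruct Hs; subst s; abs_lra. }
  assert (H1 := Main 1 (or_introl eq_refl)).
  assert (H2 := Main (-1) (or_intror eq_refl)).
  abs_lra.
Qed.

Let local_const_pos : 2 <= local_const.
Proof. unfold local_const. assert (0 <= 4 * C * M + 2 * M ^ 2 * C ^ 2) by nonneg. lra. Qed.

Lemma z1_interface : Rabs (z1 d) <= local_const * (2 * M + C) * th1.
Proof.
  assert (Hl : 0 < / th1) by now apply Rinv_0_lt_compat.
  assert (Hd : / th1 <= d / 2).
  { apply Rmult_le_reg_r with th1; [lra|]. rewrite Rinv_l; lra. }
  apply Rle_trans with (local_const * th1 * (2 * M + / th2)).
  - apply (local_gradient (d - / th1)); try lra.
    intros s Hs; apply z_crude; lra.
  - replace (local_const * (2 * M + C) * th1) with (local_const * th1 * (2 * M + C)) by ring.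
    apply Rmult_le_compat_l; [nonneg | lra].
Qed.

Lemma inv_mu_le : 1 <= C * (mu * th2) -> 2 / (alpha * mu) <= 2 * C / alpha * th2.
Proof.
  intros H. apply Rmult_le_reg_r with (alpha * mu); [now apply Rmult_lt_0_compat|].
  replace (2 / (alpha * mu) * (alpha * mu)) with (2 * 1) by (field; lra).
  replace (2 * C / alpha * th2 * (alpha * mu)) with (2 * (C * (mu * th2)))
    by (field; lra).
  lra.
Qed.

(** The first two summands serve the convection-dominated case (forcing, then value at the
    interface), the last one the case [th1 = th2]. *)
Definition z1_const : R :=
  2 * C / alpha * (M * z_const + 2 * M ^ 2 * C) * C + local_const * (2 * M + C)
  + local_const * (3 * z_const + 1).

Lemma z1_const_parts :
  0 <= 2 * C / alpha * (M * z_const + 2 * M ^ 2 * C) * C /\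
  0 <= local_const * (2 * M + C) /\ 0 <= local_const * (3 * z_const + 1).
Proof. repeat split; nonneg. Qed.

(** If [th1 = th2], both exponentials are nearly constant on a window of length [/ th1], and the
    local gradient estimate preserves their shape. Otherwise that estimate is used at the interface
    only, and the equation for [z1] is integrated back from there; [1 <= C * (mu * th2)] turns the
    factor [/ mu] into [th2]. *)
Lemma z1_bound (x : R) : 0 < x <= d ->
  Rabs (z1 x) <= z1_const * (th2 * e2 x + 1 + th1 * e1 x).
Proof.
  intros Hx.
  assert (Hl : 0 < / th1) by now apply Rinv_0_lt_compat.
  assert (Hd : / th1 <= d / 2).
  { apply Rmult_le_reg_r with th1; [lra|]. rewrite Rinv_l; lra. }
  destruct z1_const_parts as [Pa [Pb Pc]].
  destruct (layers_pos x) as [E2 [E1 [T2 T1]]].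
  set (S := th2 * e2 x + 1 + th1 * e1 x).
  assert (HS : 1 <= S) by (unfold S; lra).
  destruct (rg_cases reg) as [Heq|[Hth Hmu]].
  - set (B := 3 * z_const * (e2 x + e1 x + / th2)).
    assert (HB : forall s, 0 <= s <= d -> Rabs (s - x) <= / th1 -> Rabs (z s) <= B).
    { intros s Hs Hsx. apply Rle_trans with (1 := z_bound s Hs).
      assert (D2 : e2 s <= 3 * e2 x).
      { apply decay_within_width; [auto|]. now rewrite <- Heq. }
      assert (D1 : e1 s <= 3 * e1 x).
      { apply decay_within_width; [auto|].
        replace (d - s - (d - x)) with (- (s - x)) by ring. now rewrite Rabs_Ropp. }
      unfold B.
      replace (3 * z_const * (e2 x + e1 x + / th2))
        with (z_const * (3 * e2 x + 3 * e1 x + 3 * / th2)) by ring.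
      scaled. }
    assert (L : Rabs (z1 x) <= local_const * th1 * (B + / th2)).
    { destruct (Rle_dec x (d / 2)) as [Hxd|Hxd].
      - apply (local_gradient x); try lra. intros s Hs. apply HB; [lra|].
        abs_lra.
      - apply (local_gradient (x - / th1)); try lra. intros s Hs. apply HB; [lra|].
        abs_lra. }
    apply Rle_trans with (1 := L).
    apply Rle_trans with (local_const * (3 * z_const + 1) * S).
    + replace (local_const * (3 * z_const + 1) * S) with
        (local_const * th1 * ((3 * z_const + 1) * (e2 x + e1 x + / th2)))
        by (unfold S; rewrite <- Heq; field; lra).
      apply Rmult_le_compat_l; [nonneg|]. unfold B. lra.
    + apply Rmult_le_compat_r; [lra|]. unfold z1_const. lra.
  - destruct (Req_dec x d) as [->|Hxd].
    { apply Rle_trans with (1 := z1_interface).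
      apply Rle_trans with (local_const * (2 * M + C) * S).
      - apply Rmult_le_compat_l; [lra|]. unfold S. rewrite e1_at_interface. lra.
      - apply Rmult_le_compat_r; [lra|]. unfold z1_const. lra. }
    set (k := M * z_const). set (k0 := (k + 2 * M ^ 2 * C) * / th2).
    assert (Hk : 0 <= k) by nonneg.
    assert (HM : 0 <= 2 * M ^ 2 * C) by nonneg.
    assert (F1 : Rabs (z1 x) <= 2 / (alpha * mu) * (k * e2 x + k0 + k * e1 x)
                                + local_const * (2 * M + C) * th1 * e1 x).
    { apply (first_order_bound k k0 k _ x z1 z2 (fun t => b t * z t + g t)); trivial; try lra.
      - nonneg.
      - exact continuity_z1.
      - exact is_derive_z1.
      - intros t Ht. rewrite residual_equation. ring.
      - intros t Ht.
        destruct (hd_bound data (x := t)) as [_ [[Hb _] _]]; [lra|].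
        assert (Z := z_bound t). assert (G := residual_rhs_bound t).
        assert (Q : Rabs (b t * z t) <= M * (z_const * (e2 t + e1 t + / th2))).
        { apply Rabs_mult_le; [lra|].
          apply Z; lra. }
        apply Rle_trans with (1 := Rabs_triang _ _).
        unfold k0, k. lra.
      - exact z1_interface. }
    apply Rle_trans with (1 := F1).
    assert (Hmu' := inv_mu_le Hmu).
    assert (W : 2 / (alpha * mu) * (k * e2 x + k0 + k * e1 x)
              <= 2 * C / alpha * (k + 2 * M ^ 2 * C) * C * S).
    { apply Rle_trans with (2 * C / alpha * th2 * (k * e2 x + k0 + k * e1 x)).
      - apply Rmult_le_compat_r; [|exact Hmu'].
        assert (0 <= k * e2 x) by nonneg.
        assert (0 <= k * e1 x) by nonneg.
        assert (0 <= k0) by nonneg. lra.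
      - replace (2 * C / alpha * (k + 2 * M ^ 2 * C) * C * S)
          with (2 * C / alpha * ((k + 2 * M ^ 2 * C) * (C * S))) by ring.
        rewrite Rmult_assoc. apply Rmult_le_compat_l.
        { nonneg. }
        replace (th2 * (k * e2 x + k0 + k * e1 x)) with
          (k * (th2 * e2 x) + (k + 2 * M ^ 2 * C) + k * (th2 * e1 x))
          by (unfold k0; field; lra).
        assert (X1 : k * (th2 * e2 x) <= (k + 2 * M ^ 2 * C) * (th2 * e2 x))
          by scaled.
        assert (X2 : k * (th2 * e1 x) <= (k + 2 * M ^ 2 * C) * (C * (th1 * e1 x))).
        { apply Rmult_le_compat; try lra.
          - nonneg.
          - rewrite <- Rmult_assoc. apply Rmult_le_compat_r; [lra|]. apply (rg_th reg). }
        assert (X3 : th2 * e2 x + 1 + C * (th1 * e1 x) <= C * S).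
        { unfold S. assert (th2 * e2 x + 1 <= C * (th2 * e2 x + 1)) by nra. lra. }
        apply Rle_trans with ((k + 2 * M ^ 2 * C) * (th2 * e2 x + 1 + C * (th1 * e1 x)));
          [lra|].
        scaled. }
    assert (W' : local_const * (2 * M + C) * th1 * e1 x <= local_const * (2 * M + C) * S).
    { rewrite Rmult_assoc. apply Rmult_le_compat_l; [lra|]. unfold S; lra. }
    assert (W'' : 0 <= local_const * (3 * z_const + 1) * S) by nonneg.
    unfold z1_const. fold k. lra.
Qed.

Let z1_const_pos : 0 <= z1_const.
Proof. unfold z1_const. destruct z1_const_parts. lra. Qed.

Lemma z1_crude (x : R) : 0 < x <= d -> Rabs (z1 x) <= 3 * z1_const * C ^ 2 * th1.
Proof.
  intros Hx. apply Rle_trans with (1 := z1_bound x Hx).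
  assert (E2 : e2 x <= 1) by (apply decay_le_1; lra).
  assert (E1 : e1 x <= 1) by (apply decay_le_1; lra).
  replace (3 * z1_const * C ^ 2 * th1) with (z1_const * (3 * (C ^ 2 * th1))) by ring.
  apply Rmult_le_compat_l; [lra|].
  assert (th2 * e2 x <= th2 * 1) by scaled.
  assert (th1 * e1 x <= th1 * 1) by scaled.
  assert (T := rg_th reg).
  assert (C * th1 <= C ^ 2 * th1).
  { apply Rmult_le_compat_r; [lra|]. simpl. nra. }
  assert (1 * th1 <= C * th1) by scaled.
  lra.
Qed.

Definition z2_const : R :=
  3 * M * z1_const * C ^ 3 + (2 * M ^ 2 + 2 * M ^ 2 * C ^ 2) * C.

Let z2_const_pos : 0 <= z2_const.
Proof. unfold z2_const. nonneg. Qed.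

Lemma z2_crude (x : R) : 0 < x <= d -> Rabs (z2 x) <= z2_const * th1 ^ 2.
Proof.
  intros Hx. destruct mu_abs as [_ [Hmu _]].
  apply Rmult_le_reg_l with eps; [lra|].
  rewrite <- (Rabs_pos_eq eps) at 1 by lra. rewrite <- Rabs_mult, residual_equation.
  destruct (hd_bound data (x := x)) as [[HA _] [[Hb _] _]]; [lra|].
  assert (G : Rabs (g x) <= 2 * M ^ 2 * C * / th2) by (apply residual_rhs_bound; lra).
  assert (Z : Rabs (z x) <= 2 * M) by (apply z_crude; lra).
  assert (Z1 := z1_crude x Hx).
  assert (One := rg_eps_th1 reg). assert (Mu := rg_mu_th1 reg).
  assert (Q1 : Rabs (mu * A x * z1 x) <= C * (eps * th1) * M * (3 * z1_const * C ^ 2 * th1))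
    by prod_bound.
  assert (Q2 : Rabs (b x * z x) <= M * (2 * M)) by prod_bound.
  assert (Q3 : 2 * M ^ 2 * C * / th2 <= 2 * M ^ 2 * C ^ 2).
  { replace (2 * M ^ 2 * C ^ 2) with (2 * M ^ 2 * C * C) by ring.
    scaled. }
  assert (Q4 : (2 * M ^ 2 + 2 * M ^ 2 * C ^ 2) * 1
               <= (2 * M ^ 2 + 2 * M ^ 2 * C ^ 2) * (C * (eps * th1 ^ 2)))
    by scaled.
  apply Rle_trans with (1 := Rabs_triang _ _).
  assert (Q5 := Rabs_triang (mu * A x * z1 x) (b x * z x)).
  unfold z2_const.
  replace (eps * _) with (C * (eps * th1) * M * (3 * z1_const * C ^ 2 * th1)
    + (2 * M ^ 2 + 2 * M ^ 2 * C ^ 2) * (C * (eps * th1 ^ 2))) by ring.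
  lra.
Qed.

Let flux1 x := mu * (A1 x * z1 x + A x * z2 x) + (b1 x * z x + b x * z1 x)
  + (mu * (A1 x * v1 x + A x * v2 x) - eps * v3 x).

Lemma is_derive_flux (x : R) : 0 < x < d -> is_derive (fun t => eps * z2 t) x (flux1 x).
Proof.
  intros Hx.
  apply is_derive_Rext with
    (fun t => 1 * (mu * (A t * z1 t) + 1 * (b t * z t))
              + 1 * (mu * (A t * v1 t) + - eps * v2 t)).
  { intros t. rewrite residual_equation. unfold g. ring. }
  apply (is_derive_eq _ _ (1 * (mu * (A1 x * z1 x + A x * z2 x) + 1 * (b1 x * z x + b x * z1 x))
    + 1 * (mu * (A1 x * v1 x + A x * v2 x) + - eps * v3 x))); [|unfold flux1; ring].
  assert (DA := hd_dA data Hx). assert (Db := hd_db data Hx).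
  apply (is_derive_lin2 (fun t => mu * (A t * z1 t) + 1 * (b t * z t))
    (fun t => mu * (A t * v1 t) + - eps * v2 t)).
  - apply (is_derive_lin2 (fun t => A t * z1 t) (fun t => b t * z t));
      apply is_derive_Rmult; trivial; (now apply is_derive_z1) || now apply is_derive_z.
  - apply (is_derive_lin2 (fun t => A t * v1 t) v2); [|now apply (hd_dv2 data)].
    apply is_derive_Rmult; [trivial | now apply (hd_dv1 data)].
Qed.

Definition flux_const : R := 2 * M * z1_const + M * z_const * C ^ 2 + 3 * M ^ 2.

Let flux_const_pos : 0 <= flux_const.
Proof. unfold flux_const. nonneg. Qed.

(** Separating [mu * A * z2] makes the differentiated residual equation a first-order equation for
    [z2]; what remains involves only [z], [z1] and the data, which are already bounded. *)
Lemma flux_lower_order (x : R) : 0 < x < d ->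
  Rabs (flux1 x - mu * A x * z2 x) <= flux_const * (th2 * e2 x + 1 + th1 * e1 x).
Proof.
  intros Hx.
  destruct mu_abs as [_ [_ Hmu]]. destruct eps_abs as [_ Heps].
  destruct (hd_bound data (x := x)) as [[HA HA1] [[Hb Hb1] [[_ Hv1] [Hv2 Hv3]]]]; [lra|].
  assert (Z : Rabs (z x) <= z_const * (e2 x + e1 x + / th2)) by (apply z_bound; lra).
  assert (Z1 : Rabs (z1 x) <= z1_const * (th2 * e2 x + 1 + th1 * e1 x))
    by (apply z1_bound; lra).
  set (S := th2 * e2 x + 1 + th1 * e1 x) in *.
  destruct (layers_pos x) as [E2 [E1 [T2 T1]]].
  assert (CC : C <= C ^ 2) by (simpl; nra).
  assert (ZS : Rabs (z x) <= z_const * (C ^ 2 * S)).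
  { apply Rle_trans with (1 := Z). apply Rmult_le_compat_l; [lra|].
    assert (X2 : 1 * e2 x <= C * th2 * e2 x) by scaled.
    assert (X1 : 1 * e1 x <= C ^ 2 * th1 * e1 x) by scaled.
    assert (X2' : C * (th2 * e2 x) <= C ^ 2 * (th2 * e2 x)) by scaled.
    unfold S. lra. }
  assert (B1 : Rabs (mu * (A1 x * z1 x)) <= 1 * (M * (z1_const * S))) by prod_bound.
  assert (B2 : Rabs (b1 x * z x) <= M * (z_const * (C ^ 2 * S))) by prod_bound.
  assert (B3 : Rabs (b x * z1 x) <= M * (z1_const * S)) by prod_bound.
  assert (B4 : Rabs (mu * (A1 x * v1 x)) <= 1 * (M * M)) by prod_bound.
  assert (B5 : Rabs (mu * (A x * v2 x)) <= 1 * (M * M)) by prod_bound.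
  assert (B6 : Rabs (eps * v3 x) <= 1 * M) by prod_bound.
  assert (MM : M <= M * M) by nra.
  assert (HS : 1 <= S) by (unfold S; lra).
  assert (MS : 3 * (M * M) * 1 <= 3 * (M * M) * S)
    by scaled.
  replace (flux1 x - mu * A x * z2 x) with
    (mu * (A1 x * z1 x) + b1 x * z x + b x * z1 x + mu * (A1 x * v1 x)
     + mu * (A x * v2 x) - eps * v3 x) by (unfold flux1; ring).
  replace (flux_const * S) with (2 * (M * (z1_const * S)) + M * (z_const * (C ^ 2 * S))
    + 3 * (M * M) * S) by (unfold flux_const; ring).
  abs_lra.
Qed.

Let th1_le_cube : th1 <= C * (eps * th1 ^ 3).
Proof.
  replace (C * (eps * th1 ^ 3)) with (C * (eps * th1 ^ 2) * th1) by ring.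
  rewrite <- (Rmult_1_l th1) at 1.
  apply Rmult_le_compat_r; [lra | apply (rg_eps_th1 reg)].
Qed.

Definition mu_z2_const : R :=
  C ^ 2 * (C * M * z1_const + M * z_const + 2 * M ^ 2 * C)
  + (2 / alpha * flux_const * C + z2_const * C).

Lemma mu_z2_const_parts :
  0 <= C ^ 2 * (C * M * z1_const + M * z_const + 2 * M ^ 2 * C) /\
  0 <= 2 / alpha * flux_const * C + z2_const * C.
Proof. split; nonneg. Qed.

(** If [th1 = th2], the residual equation bounds [eps * z2] and [mu] is at most [C * (eps * th1)].
    Otherwise the backward estimate is applied to [z2] itself, with the crude bound [th1 ^ 2] as its
    value at the interface, and the factor [mu] cancels [/ mu]. *)
Lemma mu_z2_bound (x : R) : 0 < x < d ->
  mu * Rabs (z2 x) <= mu_z2_const * (th2 * e2 x + 1 + eps * th1 ^ 3 * e1 x).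
Proof.
  intros Hx. destruct mu_abs as [Hmu0 _].
  destruct mu_z2_const_parts as [Pa Pb].
  destruct (layers_pos x) as [E2 [E1 [T2 T1]]].
  assert (TC : th1 * e1 x <= C * (eps * th1 ^ 3 * e1 x)).
  { rewrite <- Rmult_assoc. scaled. }
  assert (T3 : 0 <= eps * th1 ^ 3 * e1 x) by nonneg.
  set (G := th2 * e2 x + 1 + eps * th1 ^ 3 * e1 x).
  assert (HG : 1 <= G) by (unfold G; lra).
  set (S := th2 * e2 x + 1 + th1 * e1 x).
  assert (SG : S <= C * G).
  { unfold S, G. assert (th2 * e2 x + 1 <= C * (th2 * e2 x + 1)) by nra. lra. }
  destruct (rg_cases reg) as [Heq|[Hth Hmu]].
  - set (k := C * M * z1_const + M * z_const + 2 * M ^ 2 * C) in *.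
    assert (Z : Rabs (z x) <= z_const * (e2 x + e1 x + / th2)) by (apply z_bound; lra).
    assert (Z1 : Rabs (z1 x) <= z1_const * S) by (apply z1_bound; lra).
    assert (Gx : Rabs (g x) <= 2 * M ^ 2 * C * / th2) by (apply residual_rhs_bound; lra).
    destruct (hd_bound data (x := x)) as [[HA _] [[Hb _] _]]; [lra|].
    assert (SE : S = th2 * (e2 x + e1 x + / th2)).
    { unfold S. rewrite Heq. field. lra. }
    set (q := e2 x + e1 x + / th2) in *.
    assert (Hq : / th2 <= q) by (unfold q; lra).
    assert (W : eps * Rabs (z2 x) <= k * q).
    { rewrite <- (Rabs_pos_eq eps) at 1 by lra.
      rewrite <- Rabs_mult, residual_equation.
      assert (Q1 : Rabs (mu * A x * z1 x) <= C * M * z1_const * q).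
      { apply Rle_trans with (C * / th2 * M * (z1_const * S)); [prod_bound|].
        right. rewrite SE. field. lra. }
      assert (Q2 : Rabs (b x * z x) <= M * (z_const * q)) by prod_bound.
      assert (Q3 : 2 * M ^ 2 * C * / th2 <= 2 * M ^ 2 * C * q).
      { apply Rmult_le_compat_l; [|lra].
        assert (0 <= M ^ 2 * C) by nonneg. lra. }
      apply Rle_trans with (1 := Rabs_triang _ _).
      assert (Q5 := Rabs_triang (mu * A x * z1 x) (b x * z x)).
      unfold k. lra. }
    assert (Y : mu * Rabs (z2 x) <= C * th1 * (k * q)).
    { apply Rle_trans with (C * (eps * th1) * Rabs (z2 x)).
      - apply Rmult_le_compat_r; [apply Rabs_pos | apply (rg_mu_th1 reg)].
      - replace (C * (eps * th1) * Rabs (z2 x)) with (C * th1 * (eps * Rabs (z2 x))) by ring.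
        apply Rmult_le_compat_l; [nonneg | exact W]. }
    apply Rle_trans with (1 := Y).
    replace (C * th1 * (k * q)) with (C * k * S) by (rewrite SE, Heq; ring).
    apply Rle_trans with (C * k * (C * G)).
    + apply Rmult_le_compat_l; [nonneg | exact SG].
    + replace (C * k * (C * G)) with (C ^ 2 * k * G) by ring.
      apply Rmult_le_compat_r; [lra|]. unfold mu_z2_const. fold k. lra.
  - assert (F1 : Rabs (z2 x) <= 2 / (alpha * mu)
        * (flux_const * th2 * e2 x + flux_const + flux_const * th1 * e1 x)
        + z2_const * th1 ^ 2 * e1 x).
    { apply (first_order_bound (flux_const * th2) flux_const (flux_const * th1) _ x z2
        (fun t => flux1 t / eps) (fun t => flux1 t - mu * A t * z2 t)); trivial.
      - nonneg.
      - nonneg.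
      (* Continuity is required up to [d], where [z1] need not be differentiable. The formula
         defining [z2] supplies the limit from the left there. *)
      - intros t Ht.
        apply continuity_pt_ext with
          (fun t => / eps * (1 * (mu * (A t * z1 t) + 1 * (b t * z t))
              + 1 * (mu * (A t * v1 t) + - eps * v2 t))).
        { intros u. apply Rmult_eq_reg_l with eps; [|lra].
          rewrite residual_equation. unfold g. field. lra. }
        apply (continuity_pt_scal _ (/ eps)).
        destruct (hd_cont data t) as [CA [Cb [_ [Cv1 Cv2]]]].
        apply (continuity_pt_lin2 (fun t => mu * (A t * z1 t) + 1 * (b t * z t))
          (fun t => mu * (A t * v1 t) + - eps * v2 t)).
        + apply (continuity_pt_lin2 (fun t => A t * z1 t) (fun t => b t * z t)).
          * apply (continuity_pt_mult A z1); [trivial | now apply continuity_z1].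
          * apply (continuity_pt_mult b z); [trivial | apply continuity_z].
        + apply (continuity_pt_lin2 (fun t => A t * v1 t) v2); trivial.
          now apply (continuity_pt_mult A v1).
      - intros t Ht.
        apply is_derive_Rext with (fun t => / eps * (eps * z2 t)); [intros u; field; lra|].
        apply (is_derive_eq _ _ (/ eps * flux1 t)); [|unfold Rdiv; ring].
        apply (is_derive_scal (fun t => eps * z2 t)). now apply is_derive_flux.
      - intros t Ht. field. lra.
      - intros t Ht. apply Rle_trans with (1 := flux_lower_order t Ht).
        right; ring.
      - apply z2_crude; lra. }
    assert (F2 : mu * Rabs (z2 x) <= mu * (2 / (alpha * mu)
        * (flux_const * th2 * e2 x + flux_const + flux_const * th1 * e1 x)
        + z2_const * th1 ^ 2 * e1 x)) by scaled.
    apply Rle_trans with (1 := F2).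
    replace (mu * _) with (2 / alpha * flux_const * S + z2_const * (mu * th1 ^ 2 * e1 x))
      by (unfold S; field; lra).
    assert (X1 : 2 / alpha * flux_const * S <= 2 / alpha * flux_const * (C * G)).
    { apply Rmult_le_compat_l; [|exact SG].
      apply Rmult_le_pos; [|lra].
      nonneg. }
    assert (X2 : mu * th1 ^ 2 * e1 x <= C * G).
    { apply Rle_trans with (C * (eps * th1 ^ 3 * e1 x)).
      - replace (C * (eps * th1 ^ 3 * e1 x)) with (C * (eps * th1) * (th1 ^ 2 * e1 x)) by ring.
        rewrite Rmult_assoc. apply Rmult_le_compat_r; [|apply (rg_mu_th1 reg)].
        nonneg.
      - apply Rmult_le_compat_l; unfold G; lra. }
    assert (X3 : z2_const * (mu * th1 ^ 2 * e1 x) <= z2_const * (C * G))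
      by scaled.
    assert (X4 : (2 / alpha * flux_const * C + z2_const * C) * G <= mu_z2_const * G).
    { apply Rmult_le_compat_r; [lra|]. unfold mu_z2_const. lra. }
    lra.
Qed.

Lemma flux_bound (x : R) : 0 < x < d ->
  Rabs (flux1 x) <= (M * mu_z2_const + C * flux_const)
                      * (th2 * e2 x + 1 + eps * th1 ^ 3 * e1 x).
Proof.
  intros Hx.
  destruct (layers_pos x) as [E2 [E1 [T2 T1]]].
  assert (TC : th1 * e1 x <= C * (eps * th1 ^ 3 * e1 x)).
  { rewrite <- Rmult_assoc. apply Rmult_le_compat_r; [lra | apply th1_le_cube]. }
  assert (L := flux_lower_order x Hx). assert (Q := mu_z2_bound x Hx).
  destruct (hd_bound data (x := x)) as [[HA _] _]; [lra|].
  set (G := th2 * e2 x + 1 + eps * th1 ^ 3 * e1 x) in *.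
  set (S := th2 * e2 x + 1 + th1 * e1 x) in *.
  assert (SG : S <= C * G).
  { unfold S, G. assert (th2 * e2 x + 1 <= C * (th2 * e2 x + 1)) by nra. lra. }
  assert (Q' : Rabs (mu * A x * z2 x) <= M * (mu_z2_const * G)).
  { replace (mu * A x * z2 x) with (A x * (mu * z2 x)) by ring.
    apply Rabs_mult_le; trivial.
    rewrite Rabs_mult, (Rabs_pos_eq mu) by lra. exact Q. }
  assert (L' : flux_const * S <= flux_const * (C * G)) by scaled.
  replace (flux1 x) with ((flux1 x - mu * A x * z2 x) + mu * A x * z2 x) by ring.
  apply Rle_trans with (1 := Rabs_triang _ _). lra.
Qed.

Definition profile_const : R :=
  Rmax 1 (z_const + z1_const + z2_const + mu_z2_const
          + (M * mu_z2_const + C * flux_const) + 2 * M ^ 2 * C).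

Lemma residual_profile_holds :
  residual_profile d eps mu th1 th2 profile_const A b z z1 z2 flux1.
Proof.
  destruct mu_z2_const_parts as [Pa Pb].
  assert (P3 : 0 <= mu_z2_const) by nonneg.
  assert (P4 : 0 <= M * mu_z2_const) by nonneg.
  assert (P5 : 0 <= C * flux_const) by nonneg.
  assert (P6 : 0 <= 2 * M ^ 2 * C) by nonneg.
  assert (L := Rmax_r 1 (z_const + z1_const + z2_const + mu_z2_const
          + (M * mu_z2_const + C * flux_const) + 2 * M ^ 2 * C)).
  fold profile_const in L.
  assert (T3 : forall x, 0 <= eps * th1 ^ 3 * e1 x).
  { intros x. destruct (layers_pos x) as [_ [E1 _]]. nonneg. }
  assert (Up : forall k q r, q <= k * r -> 0 <= r -> k <= profile_const ->
            q <= profile_const * r).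
  { intros k q r Hq Hr Hk. apply Rle_trans with (1 := Hq). scaled. }
  constructor;
    [exact continuity_z | apply continuity_z1; lra | exact is_derive_z | exact is_derive_z1
    | exact is_derive_flux | ..];
    intros x Hx; destruct (layers_pos x) as [E2 [E1 [T2 T1]]]; assert (E3 := T3 x);
    unfold e1, e2 in E2, E1, T2, T1, E3.
  - rewrite residual_equation. replace (_ - _) with (g x) by ring.
    apply (Up (2 * M ^ 2 * C)); try lra. apply residual_rhs_bound; lra.
  - apply (Up z_const); try lra. now apply z_bound.
  - apply (Up z1_const); try lra. apply z1_bound; lra.
  - apply (Up z2_const); try nonneg. apply z2_crude; lra.
  - apply (Up mu_z2_const); try lra. now apply mu_z2_bound.
  - apply (Up (M * mu_z2_const + C * flux_const)); try lra. now apply flux_bound.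
Qed.

End SolutionBounds.

(** * The mesh *)

Lemma exp_mul_INR (n : nat) (x : R) : exp (INR n * x) = exp x ^ n.
Proof.
  induction n as [|n IH]; [simpl; rewrite Rmult_0_l; apply exp_0|].
  rewrite S_INR, Rmult_plus_distr_r, exp_plus, IH, Rmult_1_l. simpl; ring.
Qed.

(* [layer_ratio] is linear in the index and equals [exp (- th x / 8)] at the
   [j]-th layer node [x]; this is what makes the layer part graded. *)
Definition layer_ratio (m j : nat) : R :=
  1 - INR j / INR m * (1 - 1 / sqrt (INR (8 * m))).

Definition layer (m : nat) (th : R) (j : nat) : R :=
  - (8 / th) * ln (layer_ratio m j).

(** One half of the mesh for [N = 8 * m], with indices from 0 to [4 * m]. The interface layer is
    counted backward from [d], so that both layers use the same grading function, and the other half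
    is the same function with [1 - d] in place of [d]. *)
Definition half_mesh (th1 th2 d : R) (m i : nat) : R :=
  let s1 := 4 / th2 * ln (INR (8 * m)) in
  let s2 := 4 / th1 * ln (INR (8 * m)) in
  if (i <=? m)%nat then layer m th2 i
  else if (i <=? 3 * m)%nat then
    s1 + (d - s1 - s2) * ((INR i - INR m) / (2 * INR m))
  else d - layer m th1 (4 * m - i).

Section Layer.

Variable m : nat.
Hypothesis m_pos : (1 <= m)%nat.

Let n := INR (8 * m).
Let r := sqrt n.
Let s := layer_ratio m.

Lemma INR_m_ge_1 : 1 <= INR m.
Proof. change 1 with (INR 1). now apply le_INR. Qed.

Lemma mesh_size : n = 8 * INR m.
Proof. unfold n. rewrite mult_INR. simpl; ring. Qed.

Lemma mesh_size_ge_8 : 8 <= n.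
Proof. rewrite mesh_size. generalize INR_m_ge_1; lra. Qed.

Lemma sqrt_size_sqr : r * r = n.
Proof. apply sqrt_sqrt. generalize mesh_size_ge_8; lra. Qed.

(** The value 16/7 is exactly what makes the ratio step [8 / n] at most [7 / 2] times the smallest
    ratio [/ r]. *)
Lemma sqrt_size_bound : 16 / 7 <= r.
Proof.
  assert (H := sqrt_size_sqr). assert (H' := mesh_size_ge_8).
  assert (0 <= r) by apply sqrt_pos. nra.
Qed.

Lemma layer_ratio_0 : s 0%nat = 1.
Proof. unfold s, layer_ratio. simpl. unfold Rdiv. ring. Qed.

Lemma layer_ratio_last : s m = / r.
Proof.
  unfold s, layer_ratio. fold n r.
  assert (H := INR_m_ge_1). assert (H' := sqrt_size_bound). field. lra.
Qed.

Lemma layer_ratio_step (j : nat) : s j - s (S j) <= 8 / n /\ 0 < s j - s (S j).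
Proof.
  unfold s, layer_ratio. fold n r. rewrite S_INR.
  assert (H := INR_m_ge_1). assert (H' := sqrt_size_bound).
  assert (Hr : 0 < 1 / r < 1).
  { split; [apply Rdiv_lt_0_compat; lra|].
    apply Rmult_lt_reg_r with r; [lra|].
    unfold Rdiv. rewrite Rmult_assoc, Rinv_l; lra. }
  assert (Hm : 0 < / INR m) by (apply Rinv_0_lt_compat; lra).
  replace (8 / n) with (/ INR m) by (rewrite mesh_size; field; lra).
  replace (_ - _) with (/ INR m * (1 - 1 / r)) by (field; lra).
  nra.
Qed.

Lemma layer_ratio_lower (j : nat) : (j <= m)%nat -> / r <= s j.
Proof.
  intros Hj. assert (H := INR_m_ge_1). assert (H' := sqrt_size_bound).
  unfold s, layer_ratio. fold n r.
  assert (Hr : 0 < / r < 1).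
  { split; [apply Rinv_0_lt_compat; lra|].
    rewrite <- Rinv_1. apply Rinv_1_lt_contravar; lra. }
  assert (Q : INR j / INR m <= 1).
  { apply Rmult_le_reg_r with (INR m); [lra|].
    unfold Rdiv. rewrite Rmult_assoc, Rinv_l, Rmult_1_l by lra.
    rewrite Rmult_1_r. now apply le_INR. }
  unfold Rdiv at 2. rewrite Rmult_1_l. nra.
Qed.

Lemma inv_sqrt_size_pos : 0 < / r.
Proof. apply Rinv_0_lt_compat. generalize sqrt_size_bound; lra. Qed.

Lemma layer_ratio_pos (j : nat) : (j <= m)%nat -> 0 < s j.
Proof.
  intros Hj. assert (H := layer_ratio_lower j Hj).
  generalize inv_sqrt_size_pos; lra.
Qed.

Lemma layer_ratio_le_1 (j : nat) : s j <= 1.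
Proof.
  induction j as [|j IH]; [rewrite layer_ratio_0; lra|].
  generalize (layer_ratio_step j); lra.
Qed.

Lemma step_le_ratio (j : nat) : (j <= m)%nat -> 8 / n <= 7 / 2 * s j.
Proof.
  intros Hj. assert (H := layer_ratio_lower j Hj).
  assert (H' := sqrt_size_bound).
  apply Rle_trans with (7 / 2 * / r); [|lra].
  replace (8 / n) with (8 / (r * r)) by (rewrite sqrt_size_sqr; reflexivity).
  replace (8 / (r * r)) with (8 * / r * / r) by (field; lra).
  apply Rmult_le_compat_r; [left; apply inv_sqrt_size_pos|].
  assert (/ r <= 7 / 16).
  { apply Rmult_le_reg_r with r; [lra|]. rewrite Rinv_l; lra. }
  lra.
Qed.

Lemma layer_ratio_mult (j : nat) : (S j <= m)%nat -> s j <= 9 / 2 * s (S j).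
Proof.
  intros Hj. assert (H := layer_ratio_step j). assert (H' := step_le_ratio _ Hj). lra.
Qed.

(** The factor is 1 plus two steps of [7 / 2]. It is matched to the barrier: with decay rate
    [th1 / 8], a variation by 8 over a pair of cells leaves diffusion with [8 / 64 = 1 / 8], half of
    what convection offers. *)
Lemma layer_ratio_mult2 (j : nat) : (S (S j) <= m)%nat -> s j <= 8 * s (S (S j)).
Proof.
  intros Hj. assert (H := layer_ratio_step j). assert (H1 := layer_ratio_step (S j)).
  assert (H' := step_le_ratio _ Hj). lra.
Qed.

Section Width.

Variable th : R.
Hypothesis th_pos : 0 < th.

Lemma decay_eighth_layer (j : nat) : (j <= m)%nat -> decay (th / 8) (layer m th j) = s j.
Proof.
  intros Hj. unfold decay, layer. fold s.
  replace (- (th / 8 * (- (8 / th) * ln (s j)))) with (ln (s j)) by (field; lra).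
  apply exp_ln. now apply layer_ratio_pos.
Qed.

Lemma decay_layer (j : nat) : (j <= m)%nat -> decay th (layer m th j) = s j ^ 8.
Proof.
  intros Hj. rewrite <- (decay_eighth_layer j Hj). unfold decay.
  rewrite <- exp_mul_INR. f_equal. simpl INR. field.
Qed.

Lemma layer_0 : layer m th 0 = 0.
Proof. unfold layer. fold s. rewrite layer_ratio_0, ln_1. ring. Qed.

Lemma layer_last : layer m th m = 4 / th * ln n.
Proof.
  unfold layer. fold s. rewrite layer_ratio_last, ln_Rinv.
  - rewrite <- sqrt_size_sqr, ln_mult; [field; lra| |];
      generalize sqrt_size_bound; lra.
  - generalize sqrt_size_bound; lra.
Qed.

Lemma layer_step (j : nat) : (S j <= m)%nat ->
  0 < layer m th (S j) - layer m th j <= 8 / th * (8 / n * / s (S j)).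
Proof.
  intros Hj. destruct (layer_ratio_step j) as [D1 D2].
  assert (P : 0 < s (S j)) by now apply layer_ratio_pos.
  assert (P' : 0 < s j) by lra.
  assert (Hth : 0 < 8 / th) by (apply Rdiv_lt_0_compat; lra).
  unfold layer. fold s.
  replace (_ - _) with (8 / th * (ln (s j) - ln (s (S j)))) by ring.
  split.
  - apply Rmult_lt_0_compat; [exact Hth|].
    assert (ln (s (S j)) < ln (s j)) by (apply ln_increasing; lra). lra.
  - apply Rmult_le_compat_l; [lra|].
    rewrite <- ln_div by assumption.
    set (q := s j / s (S j)).
    assert (Hq : 0 < q) by (unfold q; apply Rdiv_lt_0_compat; lra).
    assert (ln q <= q - 1).
    { assert (E := exp_ineq1_le (ln q)). rewrite exp_ln in E by exact Hq. lra. }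
    apply Rle_trans with (q - 1); [assumption|].
    replace (q - 1) with ((s j - s (S j)) * / s (S j)) by (unfold q; field; lra).
    apply Rmult_le_compat_r; [left; now apply Rinv_0_lt_compat | exact D1].
Qed.

Lemma layer_cell (j : nat) : (S (S j) <= m)%nat ->
  layer m th (S (S j)) - layer m th j <= 8 / th * (16 / n * / s (S (S j))).
Proof.
  intros Hj. assert (H1 := layer_step (S j) Hj). assert (H0 := layer_step j ltac:(lia)).
  assert (P : 0 < s (S (S j))) by now apply layer_ratio_pos.
  assert (D := layer_ratio_step (S j)).
  assert (I : / s (S j) <= / s (S (S j))) by (apply Rinv_le_contravar; lra).
  assert (Hth : 0 < 8 / th) by (apply Rdiv_lt_0_compat; lra).
  assert (Hn : 0 < 8 / n) by nonneg.
  assert (Q : 8 / th * (8 / n * / s (S j)) <= 8 / th * (8 / n * / s (S (S j)))).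
  { repeat apply Rmult_le_compat_l; lra. }
  replace (8 / th * (16 / n * / s (S (S j))))
    with (8 / th * (8 / n * / s (S (S j))) + 8 / th * (8 / n * / s (S (S j))))
    by (unfold Rdiv; ring).
  lra.
Qed.

(** Even the largest pair of cells spans a fixed number of layer widths, so bounded parts of the
    truncation error cost only [/ th], which is of order 1/N. *)
Lemma layer_cell_length (j : nat) : (S (S j) <= m)%nat ->
  layer m th (S (S j)) - layer m th j <= 56 / th.
Proof.
  intros Hj. apply Rle_trans with (1 := layer_cell j Hj).
  assert (P : 0 < s (S (S j))) by now apply layer_ratio_pos.
  assert (H := step_le_ratio _ Hj).
  replace (56 / th) with (8 / th * 7) by (field; lra).
  apply Rmult_le_compat_l; [left; apply Rdiv_lt_0_compat; lra|].
  apply Rmult_le_reg_r with (s (S (S j))); [exact P|].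
  rewrite Rmult_assoc, Rinv_l by lra. lra.
Qed.

(* The decay of the layer pays for the growth of the mesh width. *)
Lemma layer_cell_decay (j : nat) : (S (S j) <= m)%nat ->
  (layer m th (S (S j)) - layer m th j) * (th * decay th (layer m th j))
    <= 8192 / n * s (S (S j)).
Proof.
  intros Hj. rewrite decay_layer by lia.
  assert (P : 0 < s (S (S j))) by now apply layer_ratio_pos.
  assert (Q := layer_ratio_mult2 j Hj).
  assert (L := layer_cell j Hj).
  assert (P0 : 0 < s j) by (apply layer_ratio_pos; lia).
  assert (P1 : s j <= 1) by apply layer_ratio_le_1.
  assert (Hn := mesh_size_ge_8).
  (* Of the eight powers two are kept: one cancels the reciprocal ratio in the cell length, the
     other remains in the result. The constant is [8192 = 8 * 16 * 64]. *)
  assert (S7 : s j ^ 8 <= 64 * s (S (S j)) ^ 2).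
  { replace (s j ^ 8) with (s j ^ 2 * s j ^ 6) by ring.
    assert (s j ^ 6 <= 1 ^ 6) by (apply pow_incr; lra).
    rewrite pow1 in H.
    assert (s j ^ 2 <= (8 * s (S (S j))) ^ 2) by (apply pow_incr; lra).
    replace (64 * s (S (S j)) ^ 2) with ((8 * s (S (S j))) ^ 2 * 1) by ring.
    apply Rmult_le_compat; try (nonneg); assumption. }
  apply Rle_trans with (8 / th * (16 / n * / s (S (S j))) * (th * (64 * s (S (S j)) ^ 2))).
  - apply Rmult_le_compat.
    + assert (H1 := layer_step (S j) Hj). assert (H0 := layer_step j ltac:(lia)). lra.
    + apply Rmult_le_pos; [lra | nonneg].
    + exact L.
    + scaled.
  - right. field. lra.
Qed.

(** The ratio at the end of the layer is [/ r] and at most [9 / 2] times that one node earlier; its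
    eighth power is of order [n ^ -4], of which two powers are retained. Starting at [pred m]
    includes the mean value points of the last layer cell. *)
Lemma layer_last_cell_decay (x : R) : layer m th (pred m) <= x ->
  decay th x <= (9 / 2) ^ 8 * (/ n * / n).
Proof.
  intros Hx.
  assert (Hn := mesh_size_ge_8).
  apply Rle_trans with (decay th (layer m th (pred m))); [apply decay_antitone; lra|].
  rewrite decay_layer by lia.
  assert (Q := layer_ratio_mult (pred m) ltac:(lia)).
  replace (S (pred m)) with m in Q by lia. rewrite layer_ratio_last in Q.
  assert (P : 0 < s (pred m)) by (apply layer_ratio_pos; lia).
  apply Rle_trans with ((9 / 2 * / r) ^ 8); [apply pow_incr; lra|].
  rewrite Rpow_mult_distr. apply Rmult_le_compat_l; [nonneg|].
  replace ((/ r) ^ 8) with (/ n * / n * (/ n * / n)).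
  - assert (0 < / n <= 1).
    { split; [apply Rinv_0_lt_compat; lra|]. rewrite <- Rinv_1. apply Rinv_le_contravar; lra. }
    assert (0 <= / n * / n <= 1) by nra. nra.
  - rewrite <- sqrt_size_sqr. generalize sqrt_size_bound; intros. field. lra.
Qed.

Lemma layer_mono (i j : nat) : (i <= j <= m)%nat -> layer m th i <= layer m th j.
Proof.
  intros [H1 H2]. induction H1 as [|j H1 IH]; [lra|].
  generalize (layer_step j H2), (IH ltac:(lia)); lra.
Qed.

(** The logarithm is bounded crudely by [ln r <= r]; since [th] will be at least of order [n], the
    layer still shrinks like [/ r]. *)
Lemma layer_last_small : layer m th m <= 8 / th * r.
Proof.
  rewrite layer_last. rewrite <- sqrt_size_sqr.
  assert (H := sqrt_size_bound).
  rewrite ln_mult by lra.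
  assert (ln r <= r).
  { assert (E := exp_ineq1_le (ln r)). rewrite exp_ln in E by lra. lra. }
  replace (4 / th * (ln r + ln r)) with (8 / th * ln r) by (field; lra).
  apply Rmult_le_compat_l; [left; apply Rdiv_lt_0_compat|]; lra.
Qed.

End Width.

Section HalfMesh.

Variables th1 th2 d : R.
Hypothesis th1_pos : 0 < th1.
Hypothesis th2_pos : 0 < th2.
Hypothesis fits : layer m th2 m + layer m th1 m < d.

Let X := half_mesh th1 th2 d m.
Let H := (d - layer m th2 m - layer m th1 m) / (2 * INR m).

Lemma half_mesh_outer (i : nat) : (i <= m)%nat -> X i = layer m th2 i.
Proof.
  intros Hi. unfold X, half_mesh. now replace (i <=? m)%nat with true
    by (symmetry; now apply Nat.leb_le).
Qed.

Lemma half_mesh_coarse (i : nat) : (m <= i <= 3 * m)%nat ->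
  X i = layer m th2 m + H * (INR i - INR m).
Proof.
  intros Hi. assert (Hm := INR_m_ge_1).
  destruct (Nat.eq_dec i m) as [->|Hne].
  { rewrite half_mesh_outer by lia. ring. }
  unfold X, half_mesh. replace (i <=? m)%nat with false
    by (symmetry; apply Nat.leb_gt; lia).
  replace (i <=? 3 * m)%nat with true by (symmetry; apply Nat.leb_le; lia).
  unfold H. rewrite !layer_last by assumption. fold n. field. lra.
Qed.

Lemma half_mesh_inner (j : nat) : (j <= m)%nat -> X (4 * m - j)%nat = d - layer m th1 j.
Proof.
  intros Hj. assert (Hm := INR_m_ge_1).
  destruct (Nat.eq_dec j m) as [->|Hne].
  - rewrite half_mesh_coarse by lia. unfold H.
    replace (4 * m - m)%nat with (3 * m)%nat by lia.
    rewrite mult_INR. simpl INR. field. lra.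
  - unfold X, half_mesh. replace (4 * m - j <=? m)%nat with false
      by (symmetry; apply Nat.leb_gt; lia).
    replace (4 * m - j <=? 3 * m)%nat with false by (symmetry; apply Nat.leb_gt; lia).
    f_equal. f_equal. lia.
Qed.

Lemma coarse_width_pos : 0 < H.
Proof.
  apply Rdiv_lt_0_compat; [lra|]. generalize INR_m_ge_1; lra.
Qed.

Lemma half_mesh_coarse_step (i : nat) : (m <= i < 3 * m)%nat -> X (S i) - X i = H.
Proof.
  intros Hi. rewrite !half_mesh_coarse by lia. rewrite S_INR. ring.
Qed.

Lemma half_mesh_increasing (i : nat) : (i < 4 * m)%nat -> X i < X (S i).
Proof.
  intros Hi. destruct (le_lt_dec m i) as [H1|H1].
  - destruct (le_lt_dec (3 * m) i) as [H2|H2].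
    + set (j := (4 * m - S i)%nat).
      replace i with (4 * m - S j)%nat by (unfold j; lia).
      replace (S (4 * m - S j))%nat with (4 * m - j)%nat by (unfold j; lia).
      rewrite !half_mesh_inner by (unfold j; lia).
      assert (Hj : (S j <= m)%nat) by (unfold j; lia).
      generalize (layer_step th1 th1_pos j Hj); lra.
    + generalize (half_mesh_coarse_step i ltac:(lia)), coarse_width_pos; lra.
  - rewrite !half_mesh_outer by lia.
    generalize (layer_step th2 th2_pos i H1); lra.
Qed.

Lemma half_mesh_0 : X 0%nat = 0.
Proof. rewrite half_mesh_outer by lia. now apply layer_0. Qed.

Lemma half_mesh_last : X (4 * m)%nat = d.
Proof.
  replace (4 * m)%nat with (4 * m - 0)%nat by lia.
  rewrite half_mesh_inner, layer_0 by (assumption || lia). ring.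
Qed.

Lemma half_mesh_mono (i j : nat) : (i <= j <= 4 * m)%nat -> X i <= X j.
Proof.
  intros [H1 H2]. induction H1 as [|j H1 IH]; [lra|].
  generalize (half_mesh_increasing j H2), (IH ltac:(lia)); lra.
Qed.

Lemma half_mesh_range (i : nat) : (i <= 4 * m)%nat -> 0 <= X i <= d.
Proof.
  intros Hi. rewrite <- half_mesh_0 at 1. rewrite <- half_mesh_last.
  split; apply half_mesh_mono; lia.
Qed.

Lemma half_mesh_interior (i : nat) : (0 < i < 4 * m)%nat -> 0 < X i < d.
Proof.
  intros Hi. split.
  - rewrite <- half_mesh_0. destruct i as [|i]; [lia|].
    apply Rle_lt_trans with (X i); [apply half_mesh_mono; lia|].
    apply half_mesh_increasing; lia.
  - rewrite <- half_mesh_last.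
    apply Rlt_le_trans with (X (S i)); [apply half_mesh_increasing; lia|].
    apply half_mesh_mono; lia.
Qed.

End HalfMesh.

End Layer.

(** * Consistency on the left part of the interval *)

Lemma decay_linear_bound (th s : R) : 0 < s -> th * decay th s <= / s.
Proof.
  intros Hs.
  assert (E := exp_ineq1_le (th * s)).
  assert (P := decay_pos th s).
  assert (I : exp (th * s) * decay th s = 1).
  { unfold decay. rewrite <- exp_plus, Rplus_opp_r. apply exp_0. }
  apply Rmult_le_reg_r with s; [exact Hs|]. rewrite Rinv_l by lra.
  replace (th * decay th s * s) with (th * s * decay th s) by ring.
  rewrite <- I. scaled.
Qed.

(** The exponential is split into [k] equal factors, and each of them absorbs one factor [th]. *)
Lemma decay_power_bound (k : nat) (th s : R) : 0 < th -> 0 < s -> (1 <= k)%nat ->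
  th ^ k * decay th s <= (INR k / s) ^ k.
Proof.
  intros Ht Hs Hk.
  assert (Hk' : 0 < INR k) by (apply lt_0_INR; lia).
  replace (th ^ k * decay th s) with ((INR k * (th / INR k * decay (th / INR k) s)) ^ k).
  - apply pow_incr. split.
    + apply Rmult_le_pos; [lra|]. apply Rmult_le_pos; [|left; apply decay_pos].
      left. apply Rdiv_lt_0_compat; lra.
    + apply Rmult_le_compat_l; [lra|]. now apply decay_linear_bound.
  - replace (INR k * (th / INR k * decay (th / INR k) s)) with (th * decay (th / INR k) s)
      by (field; lra).
    rewrite Rpow_mult_distr. f_equal. unfold decay. rewrite <- exp_mul_INR.
    f_equal. field. lra.
Qed.

(** The convection coefficient is [- A] with [A] positive, so the backward quotient is the upwind
    one. Reflection brings the forward quotient of the right half to this same form. *)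
Definition half_scheme (eps mu : R) (A b : R -> R) (X W : nat -> R) (i : nat) : R :=
  eps * delta2 X W i - mu * A (X i) * Dminus X W i - b (X i) * W i.

Lemma Dminus_mean_value (X : nat -> R) (f f' : R -> R) (i : nat) :
  X i < X (S i) ->
  (forall x, X i < x < X (S i) -> is_derive f x (f' x)) ->
  (forall x, X i <= x <= X (S i) -> continuity_pt f x) ->
  exists c, X i < c < X (S i) /\ Dminus X (fun j => f (X j)) (S i) = f' c.
Proof.
  intros HX Hd Hc.
  destruct (mvt_open f f' _ _ HX Hd Hc) as [c [Hc' E]].
  exists c; split; [exact Hc'|]. unfold Dminus. simpl pred. rewrite E. field. lra.
Qed.

Lemma Rabs_scaled_le (k x B : R) : 0 <= k -> Rabs x <= B -> Rabs (k * x) <= k * B.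
Proof.
  intros Hk Hx. rewrite Rabs_mult, (Rabs_pos_eq k Hk). now apply Rmult_le_compat_l.
Qed.

(* The part of the error analysis that each half contributes: [T] is the size of
   the truncation error, relative to [1/N], that the barrier has to absorb. *)
Definition half_consistent (d eps mu th1 th2 K : R) (m : nat)
    (A b v u : R -> R) (u1 : R) : Prop :=
  let X := half_mesh th1 th2 d m in
  let Phi := fun j => decay (th1 / 8) (d - X j) in
  let U := fun j => u (X j) in
  (forall i, (0 < i < 4 * m)%nat -> exists T, 0 <= T /\
     Rabs (half_scheme eps mu A b X U i + b (X i) * v (X i))
       <= K * / INR (8 * m) * (1 + T) /\
     half_scheme eps mu A b X Phi i <= K - T / 8) /\
  Rabs (Dminus X U (4 * m) - u1) <= K * (th1 * / INR (8 * m)) /\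
  th1 / 36 <= Dminus X Phi (4 * m).

Section Consistency.

Variables d alpha rho gamma M C K eps mu th1 th2 : R.
Variables A A1 b b1 v v1 v2 v3 z z1 z2 w : R -> R.
Variable m : nat.

Hypothesis d_pos : 0 < d.
Hypothesis alpha_pos : 0 < alpha.
Hypothesis gamma_pos : 0 < gamma.
Hypothesis M_ge_1 : 1 <= M.
Hypothesis C_ge_1 : 1 <= C.
Hypothesis K_ge_1 : 1 <= K.
Hypothesis m_pos : (1 <= m)%nat.
Hypothesis data : half_data d alpha rho gamma M A A1 b b1 v v1 v2 v3.
Hypothesis reg : regime alpha rho C eps mu th1 th2.
Hypothesis prof : residual_profile d eps mu th1 th2 K A b z z1 z2 w.

Let n := INR (8 * m).

Hypothesis size_th1 : n <= C * th1.
Hypothesis size_th2 : n <= C * th2.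
Hypothesis size_large : 32 * C / d <= sqrt n.

Let X := half_mesh th1 th2 d m.
Let s := layer_ratio m.
Let phi x := decay (th1 / 8) (d - x).
Let Z j := z (X j).
Let Phi j := phi (X j).

Let eps_range : 0 < eps <= 1. Proof. apply (rg_eps reg). Qed.
Let mu_range : 0 < mu <= 1. Proof. apply (rg_mu reg). Qed.
Let th1_gt_0 : 0 < th1. Proof. apply (rg_th1 reg). Qed.
Let th2_gt_0 : 0 < th2. Proof. apply (rg_th2 reg). Qed.
Let n_ge_8 : 8 <= n. Proof. now apply mesh_size_ge_8. Qed.
Let inv_n_pos : 0 < / n. Proof. apply Rinv_0_lt_compat; lra. Qed.

(** The layer length is at most [8 / th * sqrt n], hence at most [8 * C / sqrt n]; the 32 in
    [size_large] turns this into a quarter of [d]. *)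
Lemma layer_quarter (th : R) : 0 < th -> n <= C * th -> layer m th m <= d / 4.
Proof.
  intros Ht Hn. apply Rle_trans with (1 := layer_last_small m m_pos th Ht).
  fold n. set (r := sqrt n) in *.
  assert (Hr : r * r = n) by (apply sqrt_sqrt; lra).
  assert (Hr0 : 16 / 7 <= r) by now apply sqrt_size_bound.
  assert (Q : 32 * C <= d * r).
  { apply Rmult_le_compat_l with (r := d) in size_large; [|lra].
    replace (d * (32 * C / d)) with (32 * C) in size_large by (field; lra). exact size_large. }
  apply Rmult_le_reg_r with th; [exact Ht|].
  replace (8 / th * r * th) with (8 * r) by (field; lra).
  assert (Q2 : 32 * C * r <= d * (C * th)).
  { apply Rle_trans with (d * r * r); [scaled|].
    rewrite Rmult_assoc, Hr. scaled. }
  apply Rmult_le_reg_l with C; [lra|]. lra.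
Qed.

Let inner_small : layer m th1 m <= d / 4. Proof. now apply layer_quarter. Qed.
Let outer_small : layer m th2 m <= d / 4. Proof. now apply layer_quarter. Qed.

Lemma layers_fit : layer m th2 m + layer m th1 m < d.
Proof. lra. Qed.

#[local] Hint Resolve layers_fit : core.

Lemma inv_width (th : R) : 0 < th -> n <= C * th -> / th <= C * / n.
Proof.
  intros Ht Hn. apply Rmult_le_reg_r with (th * n); [apply Rmult_lt_0_compat; lra|].
  replace (/ th * (th * n)) with n by (field; lra).
  replace (C * / n * (th * n)) with (C * th) by (field; lra). exact Hn.
Qed.

Let width1 : / th1 <= C * / n. Proof. now apply inv_width. Qed.
Let width2 : / th2 <= C * / n. Proof. now apply inv_width. Qed.

Let mu_small : mu <= C ^ 2 * / n.
Proof.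
  assert (H := rg_mu_th2 reg).
  replace mu with (mu * th2 * / th2) by (field; lra).
  replace (C ^ 2 * / n) with (C * (C * / n)) by ring.
  apply Rmult_le_compat; try lra.
  - nonneg.
  - left; now apply Rinv_0_lt_compat.
Qed.

Let eps_small : eps * n <= C ^ 3 * / n.
Proof.
  assert (H := rg_eps_th reg).
  apply Rmult_le_reg_r with n; [lra|].
  replace (C ^ 3 * / n * n) with (C ^ 2 * C) by (field; lra).
  apply Rle_trans with (C ^ 2 * (eps * th1 * th2)).
  - replace (C ^ 2 * (eps * th1 * th2)) with (eps * ((C * th1) * (C * th2))) by ring.
    rewrite Rmult_assoc. apply Rmult_le_compat_l; [lra|].
    apply Rmult_le_compat; lra.
  - apply Rmult_le_compat_l; [apply pow_le|]; lra.
Qed.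

Lemma X_range (i : nat) : (i <= 4 * m)%nat -> 0 <= X i <= d.
Proof. now apply half_mesh_range. Qed.

Lemma X_interior (i : nat) : (0 < i < 4 * m)%nat -> 0 < X i < d.
Proof. now apply half_mesh_interior. Qed.

Lemma X_outer (i : nat) : (i <= m)%nat -> X i = layer m th2 i.
Proof. now apply half_mesh_outer. Qed.

Lemma X_inner (j : nat) : (j <= m)%nat -> X (4 * m - j)%nat = d - layer m th1 j.
Proof. now apply half_mesh_inner. Qed.

Lemma X_step (i : nat) : (i < 4 * m)%nat -> X i < X (S i).
Proof. now apply half_mesh_increasing. Qed.

Definition reduced_const : R := C ^ 3 * M + C ^ 2 * M * M.

(** The derivatives of [v] are bounded independently of the parameters, so the difference quotients
    are bounded on any mesh and the factors [eps] and [mu] alone give the order 1/N. *)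
Lemma reduced_consistency (i : nat) : (S (S i) <= 4 * m)%nat ->
  Rabs (eps * delta2 X (fun j => v (X j)) (S i)
        - mu * A (X (S i)) * Dminus X (fun j => v (X j)) (S i)) <= reduced_const * / n.
Proof.
  intros Hi.
  assert (S0 := X_step i ltac:(lia)). assert (S1 := X_step (S i) ltac:(lia)).
  assert (R0 := X_range i ltac:(lia)). assert (R2 := X_range (S (S i)) Hi).
  assert (Cv : forall x, continuity_pt v x) by apply (hd_cont data).
  assert (B1 : Rabs (eps * delta2 X (fun j => v (X j)) (S i) - 0) <= eps * M).
  { apply (delta2_near X v v1 v2); trivial; [lra| | |].
    - intros x Hx; apply (hd_dv data); lra.
    - intros x Hx; apply (hd_dv1 data); lra.
    - intros c Hc. rewrite Rminus_0_r. apply Rabs_scaled_le; [lra|].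
      apply (hd_bound data); lra. }
  rewrite Rminus_0_r in B1.
  destruct (Dminus_mean_value X v v1 i S0) as [c [Hc E]]; auto.
  { intros x Hx; apply (hd_dv data); lra. }
  rewrite E.
  destruct (hd_bound data (x := X (S i))) as [[HA _] _]; [lra|].
  destruct (hd_bound data (x := c)) as [_ [_ [[_ Hv1] _]]]; [lra|].
  assert (B2 : Rabs (mu * (A (X (S i)) * v1 c)) <= mu * (M * M)).
  { apply Rabs_scaled_le; [lra|]. apply Rabs_mult_le; trivial. }
  assert (E1 : eps * M <= C ^ 3 * / n * M).
  { apply Rmult_le_compat_r; [lra|]. nra. }
  assert (E2 : mu * (M * M) <= C ^ 2 * / n * (M * M)).
  { apply Rmult_le_compat_r; [nra | apply mu_small]. }
  rewrite Rmult_assoc. unfold Rminus.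
  apply Rle_trans with (1 := Rabs_triang _ _). rewrite Rabs_Ropp.
  unfold reduced_const. lra.
Qed.

(** Both truncation errors are the length of the two cells times a derivative: that of [eps * z2]
    for the second difference, [mu * z2] for the upwind quotient. They share the majorant [G]; the
    last term is the residual of [z] at the node. *)
Lemma fine_consistency (i : nat) (G : R) : (S (S i) <= 4 * m)%nat ->
  (forall c, X i < c < X (S (S i)) ->
     th2 * decay th2 c + 1 + eps * th1 ^ 3 * decay th1 (d - c) <= G) ->
  Rabs (half_scheme eps mu A b X Z (S i))
    <= (1 + M) * K * ((X (S (S i)) - X i) * G) + K * / th2.
Proof.
  intros Hi HG.
  assert (S0 := X_step i ltac:(lia)). assert (S1 := X_step (S i) ltac:(lia)).
  assert (R0 := X_range i ltac:(lia)). assert (R2 := X_range (S (S i)) Hi).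
  set (x1 := X (S i)) in *.
  set (len := X (S (S i)) - X i).
  assert (G0 : 0 <= K * G).
  { apply Rle_trans with (1 := Rabs_pos (w x1)).
    apply Rle_trans with (1 := rp_w prof (x := x1) ltac:(lra)).
    apply Rmult_le_compat_l; [lra|]. apply HG; lra. }
  assert (Bw : forall c, X i < c < X (S (S i)) -> Rabs (w c) <= K * G).
  { intros c Hc. apply Rle_trans with (1 := rp_w prof (x := c) ltac:(lra)).
    apply Rmult_le_compat_l; [lra|]. now apply HG. }
  assert (Bm : forall c, X i < c < X (S (S i)) -> mu * Rabs (z2 c) <= K * G).
  { intros c Hc. apply Rle_trans with (1 := rp_mu prof (x := c) ltac:(lra)).
    apply Rmult_le_compat_l; [lra|]. now apply HG. }
  assert (T1 : Rabs (eps * delta2 X Z (S i) - eps * z2 x1) <= len * (K * G)).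
  { apply (delta2_near X z z1 z2); try apply (rp_cont prof).
    - fold x1; lra.
    - intros x Hx; apply (rp_dz prof); lra.
    - intros x Hx; apply (rp_dz1 prof); lra.
    - intros c Hc. unfold len.
      apply (derivative_bound_lipschitz (fun t => eps * z2 t) w); trivial; try lra.
      + intros t Ht; apply (rp_dz2 prof); lra.
      + apply (is_derive_continuity_pt _ _ (w c)), (rp_dz2 prof); lra.
      + apply (is_derive_continuity_pt _ _ (w x1)), (rp_dz2 prof); lra. }
  destruct (Dminus_mean_value X z z1 i S0) as [c [Hc E]].
  { intros x Hx; apply (rp_dz prof); fold x1 in Hx; lra. }
  { intros x Hx; apply (rp_cont prof). }
  fold x1 in Hc. fold Z in E.
  assert (T2 : mu * Rabs (z1 c - z1 x1) <= len * (K * G)).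
  { destruct (mvt_open z1 z2 c x1) as [e [He Ee]]; [lra| | |].
    - intros t Ht; apply (rp_dz1 prof); lra.
    - intros t Ht. apply (is_derive_continuity_pt _ _ (z2 t)), (rp_dz1 prof); lra.
    - rewrite Rabs_minus_sym, Ee, Rabs_mult, <- Rmult_assoc, Rmult_comm.
      apply Rmult_le_compat; try nonneg.
      + rewrite Rabs_pos_eq; unfold len; lra.
      + apply Bm; lra. }
  assert (T3 := rp_eq prof (x := x1) ltac:(lra)).
  destruct (hd_bound data (x := x1)) as [[HA _] _]; [lra|].
  unfold half_scheme. change (Z (S i)) with (z x1). fold x1. rewrite E.
  replace (_ - _) with
    ((eps * delta2 X Z (S i) - eps * z2 x1)
     - A x1 * (mu * (z1 c - z1 x1))
     + (eps * z2 x1 - mu * A x1 * z1 x1 - b x1 * z x1)) by ring.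
  assert (T2' : Rabs (A x1 * (mu * (z1 c - z1 x1))) <= M * (len * (K * G))).
  { apply Rabs_mult_le; trivial.
    rewrite Rabs_mult, (Rabs_pos_eq mu); lra. }
  abs_lra.
Qed.

(** The 8192 comes from the layer being resolved and the 56 from the length of two cells. The terms
    [2 / d] and [216 / d ^ 3] bound the tail of the opposite layer, at distance at least [d / 2],
    and [K * C] is the residual. *)
Definition fine_const : R :=
  (1 + M) * K * (8192 + 56 * C * (1 + 2 / d + 216 / d ^ 3)) + K * C.

Let d_inv_pos : 0 < / d. Proof. now apply Rinv_0_lt_compat. Qed.

Lemma inv_d_bounds : 0 <= 2 / d /\ 0 <= 216 / d ^ 3.
Proof. split; nonneg. Qed.

Lemma far_decay_linear (th x : R) : 0 < th -> d / 2 <= x -> th * decay th x <= 2 / d.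
Proof.
  intros Ht Hx. apply Rle_trans with (th * decay th (d / 2)).
  - apply Rmult_le_compat_l; [lra|]. apply decay_antitone; lra.
  - replace (2 / d) with (/ (d / 2)) by (field; lra). apply decay_linear_bound; lra.
Qed.

Lemma far_decay_power (k : nat) (th x : R) : 0 < th -> d / 2 <= x -> (1 <= k)%nat ->
  th ^ k * decay th x <= (2 * INR k / d) ^ k.
Proof.
  intros Ht Hx Hk. apply Rle_trans with (th ^ k * decay th (d / 2)).
  - apply Rmult_le_compat_l; [nonneg|]. apply decay_antitone; lra.
  - replace (2 * INR k / d) with (INR k / (d / 2)) by (field; lra).
    apply decay_power_bound; trivial; lra.
Qed.

Lemma outer_consistency (i : nat) : (S (S i) <= m)%nat ->
  Rabs (half_scheme eps mu A b X Z (S i)) <= fine_const * / n.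
Proof.
  intros Hi. destruct inv_d_bounds as [D1 D3].
  assert (Xi : X i = layer m th2 i) by (apply X_outer; lia).
  assert (Xi2 : X (S (S i)) = layer m th2 (S (S i)))
    by (apply X_outer; lia).
  set (G := th2 * decay th2 (X i) + 1 + 216 / d ^ 3).
  assert (Hlast : X (S (S i)) <= d / 4).
  { rewrite Xi2. apply Rle_trans with (layer m th2 m).
    - apply layer_mono; trivial; lia.
    - exact outer_small. }
  assert (HG : forall c, X i < c < X (S (S i)) ->
     th2 * decay th2 c + 1 + eps * th1 ^ 3 * decay th1 (d - c) <= G).
  { intros c Hc. unfold G.
    assert (Q := far_decay_power 3 th1 (d - c) th1_gt_0 ltac:(lra) ltac:(lia)).
    assert (Q' := decay_antitone th2 (X i) c ltac:(lra) ltac:(lra)).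
    assert (Q2 := Rmult_le_compat_l th2 _ _ ltac:(lra) Q').
    assert (Q3 : eps * (th1 ^ 3 * decay th1 (d - c)) <= 1 * (2 * INR 3 / d) ^ 3).
    { apply Rmult_le_compat; trivial; try lra.
      apply Rmult_le_pos; [nonneg | left; apply decay_pos]. }
    replace (1 * (2 * INR 3 / d) ^ 3) with (216 / d ^ 3) in Q3
      by (simpl INR; field; lra).
    lra. }
  apply Rle_trans with (1 := fine_consistency i G ltac:(lia) HG).
  assert (L1 : (X (S (S i)) - X i) * (th2 * decay th2 (X i)) <= 8192 / n).
  { rewrite Xi2, Xi. apply Rle_trans with (1 := layer_cell_decay m m_pos th2 th2_gt_0 i Hi).
    rewrite <- (Rmult_1_r (8192 / n)). fold n.
    apply Rmult_le_compat_l; [nonneg|]. now apply layer_ratio_le_1. }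
  assert (L2 : X (S (S i)) - X i <= 56 * (C * / n)).
  { rewrite Xi2, Xi. apply Rle_trans with (1 := layer_cell_length m m_pos th2 th2_gt_0 i Hi).
    unfold Rdiv. lra. }
  assert (L3 : (X (S (S i)) - X i) * (1 + 216 / d ^ 3)
               <= 56 * (C * / n) * (1 + 2 / d + 216 / d ^ 3)).
  { apply Rmult_le_compat; try lra.
    assert (S0 := X_step i ltac:(lia)). assert (S1 := X_step (S i) ltac:(lia)). lra. }
  assert (L4 : (X (S (S i)) - X i) * G <=
               (8192 + 56 * C * (1 + 2 / d + 216 / d ^ 3)) * / n).
  { unfold G. unfold Rdiv in L1. lra. }
  assert (L5 := Rmult_le_compat_l ((1 + M) * K) _ _
    ltac:(nonneg) L4).
  assert (L6 : K * / th2 <= K * (C * / n)) by scaled.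
  unfold fine_const. lra.
Qed.

(** The weight of the interface exponential is [eps * th1 ^ 2] times that of the outer one and may
    be large. The power of the ratio saved by [layer_cell_decay] multiplies it, and this ratio is
    the barrier value at the far end of the two cells. *)
Lemma inner_consistency (j : nat) : (S (S j) <= m)%nat ->
  Rabs (half_scheme eps mu A b X Z (4 * m - S j))
    <= fine_const * / n * (1 + eps * th1 ^ 2 * s (S (S j))).
Proof.
  intros Hj. destruct inv_d_bounds as [D1 D3].
  set (i := (4 * m - S (S j))%nat).
  replace (4 * m - S j)%nat with (S i) by (unfold i; lia).
  assert (Xi : X i = d - layer m th1 (S (S j)))
    by (apply X_inner; lia).
  assert (Xi2 : X (S (S i)) = d - layer m th1 j).
  { replace (S (S i)) with (4 * m - j)%nat by (unfold i; lia).
    apply X_inner; lia. }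
  set (T := eps * th1 ^ 2 * s (S (S j))).
  assert (Hs : 0 < s (S (S j))) by now apply layer_ratio_pos.
  assert (E2 : 0 < eps * th1 ^ 2) by (apply Rmult_lt_0_compat; [lra | apply pow_lt; lra]).
  set (G := 2 / d + 1 + eps * th1 ^ 2 * (th1 * decay th1 (layer m th1 j))).
  assert (Hfirst : d / 2 <= X i).
  { rewrite Xi. assert (L := layer_mono m m_pos th1 th1_gt_0 (S (S j)) m ltac:(lia)). lra. }
  assert (HG : forall c, X i < c < X (S (S i)) ->
     th2 * decay th2 c + 1 + eps * th1 ^ 3 * decay th1 (d - c) <= G).
  { intros c Hc. unfold G.
    assert (Q := far_decay_linear th2 c th2_gt_0 ltac:(lra)).
    assert (Q' := decay_antitone th1 (layer m th1 j) (d - c) ltac:(lra) ltac:(lra)).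
    assert (Q2 := Rmult_le_compat_l (eps * th1 ^ 2 * th1) _ _
      ltac:(nonneg) Q'). lra. }
  apply Rle_trans with (1 := fine_consistency i G ltac:(unfold i; lia) HG).
  assert (L1 : (X (S (S i)) - X i) * (th1 * decay th1 (layer m th1 j))
                <= 8192 / n * s (S (S j))).
  { rewrite Xi2, Xi.
    apply Rle_trans with (2 := layer_cell_decay m m_pos th1 th1_gt_0 j Hj).
    right; ring. }
  assert (L2 : X (S (S i)) - X i <= 56 * (C * / n)).
  { rewrite Xi2, Xi.
    assert (L := layer_cell_length m m_pos th1 th1_gt_0 j Hj).
    unfold Rdiv in L. lra. }
  assert (L3 : (X (S (S i)) - X i) * (1 + 2 / d)
               <= 56 * (C * / n) * (1 + 2 / d + 216 / d ^ 3)).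
  { apply Rmult_le_compat; try lra.
    assert (S0 := X_step i ltac:(unfold i; lia)).
    assert (S1 := X_step (S i) ltac:(unfold i; lia)). lra. }
  assert (L1' := Rmult_le_compat_l (eps * th1 ^ 2) _ _ ltac:(lra) L1).
  set (k := 56 * C * (1 + 2 / d + 216 / d ^ 3)) in *.
  assert (L4 : (X (S (S i)) - X i) * G <= (8192 + k) * / n * (1 + T)).
  { apply Rle_trans with (k * / n + 8192 * / n * T).
    - unfold G, T, k. unfold Rdiv in L1' at 1. lra.
    - assert (0 <= k * / n * T) by nonneg. lra. }
  assert (L5 := Rmult_le_compat_l ((1 + M) * K) _ _
    ltac:(nonneg) L4).
  assert (L6 : K * / th2 <= K * (C * / n)) by scaled.
  assert (L7 : 0 <= K * C * / n * T) by nonneg.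
  unfold fine_const. fold k. lra.
Qed.

(** * Consistency on the coarse part *)

Let B8 := (9 / 2) ^ 8.
Let B8_pos : 0 < B8. Proof. apply pow_lt; lra. Qed.

Lemma coarse_value (x : R) : layer m th2 m <= x <= d - layer m th1 m ->
  Rabs (z x) <= K * (2 * B8 + C) * / n.
Proof.
  intros Hx.
  assert (L0 : forall th, 0 < th -> 0 <= layer m th m /\ layer m th (pred m) <= layer m th m).
  { intros th Ht. split.
    - rewrite <- (layer_0 m th). apply layer_mono; trivial; lia.
    - apply layer_mono; trivial; lia. }
  destruct (L0 th1 th1_gt_0) as [P1 Q1]. destruct (L0 th2 th2_gt_0) as [P2 Q2].
  apply Rle_trans with (1 := rp_z prof (x := x) ltac:(lra)).
  rewrite Rmult_assoc. apply Rmult_le_compat_l; [lra|].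
  assert (D2 := layer_last_cell_decay m m_pos th2 th2_gt_0 x ltac:(lra)).
  assert (D1 := layer_last_cell_decay m m_pos th1 th1_gt_0 (d - x) ltac:(lra)).
  fold n in D1, D2. fold B8 in D1, D2.
  assert (In : / n <= 1) by (rewrite <- Rinv_1; apply Rinv_le_contravar; lra).
  assert (Q : B8 * (/ n * / n) <= B8 * / n).
  { apply Rmult_le_compat_l; [lra|]. nra. }
  lra.
Qed.

Definition slope_const : R := K * (2 * B8 + C) / d + K * (1 + 2 / d).

Let H := (d - layer m th2 m - layer m th1 m) / (2 * INR m).

Let coarse_width_lower : 2 * d * / n <= H.
Proof.
  assert (Hm := INR_m_ge_1 m m_pos).
  unfold H, n. rewrite mesh_size.
  replace (2 * d * / (8 * INR m)) with (d / 2 * / (2 * INR m)) by (field; lra).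
  apply Rmult_le_compat_r; [left; apply Rinv_0_lt_compat|]; lra.
Qed.

Lemma slope_const_parts :
  0 <= K * (2 * B8 + C) / d /\ 0 <= K * (1 + 2 / d).
Proof. destruct inv_d_bounds. split; nonneg. Qed.

Lemma coarse_slope (k : nat) : (m <= k < 3 * m)%nat ->
  Rabs (Dminus X Z (S k)) <= slope_const.
Proof.
  intros Hk. destruct slope_const_parts as [S1 S2].
  assert (Hn : 0 < d * / n) by (apply Rmult_lt_0_compat; lra).
  assert (Hm := INR_m_ge_1 m m_pos).
  assert (V : forall i, (m <= i <= 3 * m)%nat -> Rabs (z (X i)) <= K * (2 * B8 + C) * / n).
  { intros i Hi. apply coarse_value.
    unfold X. rewrite half_mesh_coarse by assumption.
    fold H. assert (I1 : INR m <= INR i) by (apply le_INR; lia).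
    assert (I3 : INR i <= INR (3 * m)) by (apply le_INR; lia).
    rewrite mult_INR in I3. simpl INR in I3.
    assert (H0 : 0 <= H * (INR i - INR m)) by nonneg.
    assert (H1 : H * (INR i - INR m) <= H * (2 * INR m)) by scaled.
    replace (H * (2 * INR m)) with (d - layer m th2 m - layer m th1 m) in H1
      by (unfold H; field; lra).
    lra. }
  assert (E := half_mesh_coarse_step m m_pos th1 th2 d th1_gt_0 th2_gt_0 k Hk).
  fold X in E. fold H in E.
  unfold Dminus, Z. simpl pred. rewrite E. unfold Rdiv. rewrite Rabs_mult.
  rewrite (Rabs_pos_eq (/ H)) by (left; apply Rinv_0_lt_compat; lra).
  apply Rmult_le_reg_r with H; [lra|].
  rewrite Rmult_assoc, Rinv_l, Rmult_1_r by lra.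
  assert (V1 := V k ltac:(lia)). assert (V2 := V (S k) ltac:(lia)).
  apply Rle_trans with (2 * (K * (2 * B8 + C) * / n)).
  - unfold Rminus. apply Rle_trans with (1 := Rabs_triang _ _).
    rewrite Rabs_Ropp. lra.
  - apply Rle_trans with (K * (2 * B8 + C) / d * (2 * d * / n)).
    + right. field. lra.
    + unfold slope_const. apply Rmult_le_compat; trivial; lra.
Qed.

(** The backward cell of node [m] is still a layer cell. The outer exponential has decayed to
    [n ^ -2] there, and the remaining factor [th2] is compensated later by [eps] or [mu]. *)
Lemma outer_edge_slope :
  Rabs (Dminus X Z m) <= slope_const + K * B8 * (th2 * (/ n * / n)).
Proof.
  destruct slope_const_parts as [S1 S2].
  replace m with (S (pred m)) at 1 by lia.
  assert (Hi : (pred m < 4 * m)%nat) by lia.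
  assert (S0 := X_step _ Hi).
  assert (Em : S (pred m) = m) by lia.
  destruct (Dminus_mean_value X z z1 (pred m) S0) as [c [Hc E]].
  { assert (R0 := X_range (pred m) ltac:(lia)). assert (R1 := X_range m ltac:(lia)).
    rewrite Em. intros x Hx; apply (rp_dz prof); lra. }
  { intros; apply (rp_cont prof). }
  fold Z in E. rewrite E. rewrite Em in Hc.
  assert (X0 : X (pred m) = layer m th2 (pred m)) by (apply X_outer; lia).
  assert (X1 : X m = layer m th2 m) by (apply X_outer; lia).
  assert (R0 := X_range (pred m) ltac:(lia)).
  apply Rle_trans with (1 := rp_z1 prof (x := c) ltac:(lra)).
  assert (D2 := layer_last_cell_decay m m_pos th2 th2_gt_0 c ltac:(lra)).
  assert (D1 := far_decay_linear th1 (d - c) th1_gt_0 ltac:(lra)).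
  fold n in D2. fold B8 in D2.
  assert (D2' := Rmult_le_compat_l th2 _ _ ltac:(lra) D2).
  assert (T : K * (th2 * decay th2 c + 1 + th1 * decay th1 (d - c)) <=
              K * (th2 * (B8 * (/ n * / n)) + 1 + 2 / d))
    by scaled.
  unfold slope_const. lra.
Qed.

Lemma inner_edge_slope :
  Rabs (Dminus X Z (S (3 * m))) <=
    slope_const + K * B8 * (th1 * (/ n * / n)).
Proof.
  destruct slope_const_parts as [S1 S2].
  assert (S0 := X_step (3 * m) ltac:(lia)).
  assert (R0 := X_range (3 * m) ltac:(lia)). assert (R1 := X_range (S (3 * m)) ltac:(lia)).
  destruct (Dminus_mean_value X z z1 (3 * m) S0) as [c [Hc E]].
  { intros x Hx; apply (rp_dz prof); lra. }
  { intros; apply (rp_cont prof). }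
  fold Z in E. rewrite E.
  assert (X0 : X (3 * m)%nat = d - layer m th1 m).
  { replace (3 * m)%nat with (4 * m - m)%nat by lia.
    apply X_inner; lia. }
  assert (X1 : X (S (3 * m)) = d - layer m th1 (pred m)).
  { replace (S (3 * m)) with (4 * m - pred m)%nat by lia.
    apply X_inner; lia. }
  apply Rle_trans with (1 := rp_z1 prof (x := c) ltac:(lra)).
  assert (D1 := layer_last_cell_decay m m_pos th1 th1_gt_0 (d - c) ltac:(lra)).
  assert (D2 := far_decay_linear th2 c th2_gt_0 ltac:(lra)).
  fold n in D1. fold B8 in D1.
  assert (D1' := Rmult_le_compat_l th1 _ _ ltac:(lra) D1).
  assert (T : K * (th2 * decay th2 c + 1 + th1 * decay th1 (d - c)) <=
              K * (2 / d + 1 + th1 * (B8 * (/ n * / n))))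
    by scaled.
  unfold slope_const. lra.
Qed.

Lemma eps_th_small : eps * th1 <= C ^ 3 /\ eps * th2 <= C ^ 3 /\ mu * th2 <= C ^ 3.
Proof.
  assert (H1 := rg_eps_th reg). assert (H2 := rg_eps_th2 reg). assert (H3 := rg_mu_th2 reg).
  assert (C1 : C <= C ^ 2) by (simpl; nra).
  assert (C2 : C ^ 2 <= C ^ 3).
  { replace (C ^ 3) with (C * C ^ 2) by ring.
    rewrite <- (Rmult_1_l (C ^ 2)) at 1. scaled. }
  repeat split; try lra.
  apply Rle_trans with (C * (eps * th1 * th2)).
  - replace (C * (eps * th1 * th2)) with (eps * th1 * (C * th2)) by ring.
    rewrite <- (Rmult_1_r (eps * th1)) at 1.
    apply Rmult_le_compat_l; [nonneg | lra].
  - apply Rle_trans with (C * C); [scaled|].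
    simpl in C2. lra.
Qed.

(** Even at the two transition nodes one of the adjacent cells is coarse, so the denominator is at
    least [2 * d / n]. *)
Lemma coarse_second_difference (W : nat -> R) (i : nat) (B : R) : (m <= S i <= 3 * m)%nat ->
  0 <= B -> Rabs (Dminus X W (S (S i)) - Dminus X W (S i)) <= B ->
  Rabs (eps * delta2 X W (S i)) <= eps * (B * (n * / d)).
Proof.
  intros Hi HB0 HB.
  assert (S0 := X_step i ltac:(lia)). assert (S1 := X_step (S i) ltac:(lia)).
  set (len := X (S (S i)) - X i).
  assert (Hdn : 0 < 2 * d * / n) by (apply Rmult_lt_0_compat; lra).
  assert (Hlen : 2 * d * / n <= len).
  { assert (Hw := coarse_width_lower). fold H in Hw.
    assert (Es : X (S i) - X i = H \/ X (S (S i)) - X (S i) = H).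
    { destruct (Nat.eq_dec (S i) (3 * m)); [left | right];
        apply half_mesh_coarse_step; trivial; lia. }
    unfold len. lra. }
  replace (eps * delta2 X W (S i)) with
    (eps * ((Dminus X W (S (S i)) - Dminus X W (S i)) * (2 * / len)))
    by (unfold delta2, len, Dplus, Dminus; simpl pred; unfold Rdiv; ring).
  apply Rabs_scaled_le; [lra|]. apply Rabs_mult_le; [exact HB|].
  assert (0 < / len) by (apply Rinv_0_lt_compat; lra).
  rewrite Rabs_pos_eq by lra.
  replace (n * / d) with (2 * / (2 * d * / n)) by (field; lra).
  apply Rmult_le_compat_l; [lra|]. apply Rinv_le_contravar; lra.
Qed.

Definition coarse_slope_const : R := C ^ 3 * (slope_const + K * B8).

Definition coarse_const : R :=
  2 * coarse_slope_const / d + M * coarse_slope_const + M * (K * (2 * B8 + C)).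

(* On the coarse part [eps n] and [mu] are of order [1/n] and no cancellation is
   needed: the difference operator itself is small there. *)
Lemma coarse_consistency (i : nat) : (m <= S i <= 3 * m)%nat ->
  Rabs (half_scheme eps mu A b X Z (S i)) <= coarse_const * / n.
Proof.
  intros Hi. destruct slope_const_parts as [P1 P2].
  assert (Q0 : 0 <= slope_const) by nonneg.
  set (qm := Rabs (Dminus X Z (S i))).
  set (qp := Rabs (Dminus X Z (S (S i)))).
  assert (Bm : qm <= slope_const + K * B8 * (th2 * (/ n * / n))).
  { destruct (Nat.eq_dec (S i) m) as [E|E].
    - unfold qm. rewrite E. apply outer_edge_slope.
    - apply Rle_trans with slope_const; [apply coarse_slope; lia|].
      assert (0 <= K * B8 * (th2 * (/ n * / n))); [|lra].
      nonneg. }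
  assert (Bp : qp <= slope_const + K * B8 * (th1 * (/ n * / n))).
  { destruct (Nat.eq_dec (S i) (3 * m)) as [E|E].
    - unfold qp. rewrite E. apply inner_edge_slope.
    - apply Rle_trans with slope_const; [apply coarse_slope; lia|].
      assert (0 <= K * B8 * (th1 * (/ n * / n))); [|lra].
      nonneg. }
  destruct eps_th_small as [Et1 [Et2 Mt2]].
  (* One estimate for all products of a small coefficient [e], which is [eps * n] or [mu], with a
     slope [q] carrying the rate [t] of the layer next to it. *)
  assert (W : forall e t q, 0 <= e -> e <= C ^ 3 * / n -> e * t <= C ^ 3 * n ->
      q <= slope_const + K * B8 * (t * (/ n * / n)) -> e * q <= coarse_slope_const * / n).
  { intros e t q He H1 H2 H3.
    apply Rle_trans with (e * (slope_const + K * B8 * (t * (/ n * / n)))); [scaled|].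
    replace (e * (slope_const + K * B8 * (t * (/ n * / n))))
      with (e * slope_const + e * t * (K * B8 * (/ n * / n))) by ring.
    assert (H1' := Rmult_le_compat_r slope_const _ _ Q0 H1).
    assert (H2' : e * t * (K * B8 * (/ n * / n)) <= C ^ 3 * n * (K * B8 * (/ n * / n)))
      by scaled.
    replace (C ^ 3 * n * (K * B8 * (/ n * / n))) with (C ^ 3 * (K * B8 * / n)) in H2'
      by (field; lra).
    unfold coarse_slope_const. lra. }
  assert (Qm0 : 0 <= qm) by apply Rabs_pos. assert (Qp0 : 0 <= qp) by apply Rabs_pos.
  assert (En : 0 <= eps * n) by nonneg.
  assert (Et : forall t, eps * t <= C ^ 3 -> eps * n * t <= C ^ 3 * n).
  { intros t Ht. replace (eps * n * t) with (eps * t * n) by ring. scaled. }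
  assert (Wm := W (eps * n) th2 qm En eps_small (Et _ Et2) Bm).
  assert (Wp := W (eps * n) th1 qp En eps_small (Et _ Et1) Bp).
  assert (Wu : mu * qm <= coarse_slope_const * / n).
  { apply (W mu th2); trivial; [lra| |].
    - apply Rle_trans with (1 := mu_small). apply Rmult_le_compat_r; [lra|].
      replace (C ^ 3) with (C * C ^ 2) by ring.
      rewrite <- (Rmult_1_l (C ^ 2)) at 1. scaled.
    - apply Rle_trans with (1 := Mt2). rewrite <- (Rmult_1_r (C ^ 3)) at 1. scaled. }
  assert (B1 : Rabs (eps * delta2 X Z (S i))
               <= 2 * coarse_slope_const / d * / n).
  { apply Rle_trans with (eps * ((qp + qm) * (n * / d))).
    - apply coarse_second_difference; [exact Hi | lra|].
      unfold Rminus. apply Rle_trans with (1 := Rabs_triang _ _).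
      rewrite Rabs_Ropp. unfold qp, qm; lra.
    - replace (eps * ((qp + qm) * (n * / d))) with ((eps * n * qp + eps * n * qm) * / d) by ring.
      replace (2 * coarse_slope_const / d * / n)
        with ((coarse_slope_const * / n + coarse_slope_const * / n) * / d) by (field; lra).
      scaled. }
  destruct (hd_bound data (x := X (S i))) as [[HA _] [[Hb _] _]]; [apply X_range; lia|].
  assert (B2 : Rabs (A (X (S i)) * (mu * Dminus X Z (S i)))
               <= M * (coarse_slope_const * / n)).
  { apply Rabs_mult_le; trivial.
    rewrite Rabs_mult, (Rabs_pos_eq mu) by lra. exact Wu. }
  assert (B3 : Rabs (b (X (S i)) * z (X (S i))) <= M * (K * (2 * B8 + C) * / n)).
  { apply Rabs_mult_le; trivial.
    apply coarse_value. split.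
    - replace (layer m th2 m) with (X m) by (apply X_outer; lia).
      apply half_mesh_mono; trivial; lia.
    - replace (d - layer m th1 m) with (X (4 * m - m)%nat)
        by (apply X_inner; lia).
      apply half_mesh_mono; trivial; lia. }
  unfold half_scheme, coarse_const. change (Z (S i)) with (z (X (S i))).
  abs_lra.
Qed.

Lemma coarse_const_pos : 0 <= coarse_const.
Proof. destruct slope_const_parts.
  unfold coarse_const, coarse_slope_const, slope_const. nonneg. Qed.

Lemma fine_const_pos : 0 <= fine_const.
Proof. destruct inv_d_bounds. unfold fine_const. nonneg. Qed.

(** * The interface barrier under the scheme *)

Lemma is_derive_phi (x : R) : is_derive phi x (th1 / 8 * phi x).
Proof. apply is_derive_decay_reflect. Qed.

Lemma is_derive_phi1 (x : R) :
  is_derive (fun t => th1 / 8 * phi t) x (th1 / 8 * (th1 / 8 * phi x)).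
Proof. apply (is_derive_scal phi x (th1 / 8)), is_derive_phi. Qed.

Lemma phi_mono (p q : R) : p <= q -> phi p <= phi q.
Proof. intros Hpq. apply decay_antitone; lra. Qed.

Lemma phi_le_1 (p : R) : p <= d -> phi p <= 1.
Proof. intros Hp. apply decay_le_1; lra. Qed.

Lemma phi_slope (i : nat) : (i < 4 * m)%nat ->
  exists c, X i < c < X (S i) /\ Dminus X Phi (S i) = th1 / 8 * phi c.
Proof.
  intros Hi. apply (Dminus_mean_value X phi (fun x => th1 / 8 * phi x)).
  - now apply X_step.
  - intros; apply is_derive_phi.
  - intros x _. exact (is_derive_continuity_pt _ _ _ (is_derive_phi x)).
Qed.

Lemma phi_delta2 (i : nat) (B : R) : (S (S i) <= 4 * m)%nat ->
  (forall c, X i < c < X (S (S i)) -> eps * (th1 / 8 * (th1 / 8 * phi c)) <= B) ->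
  eps * delta2 X Phi (S i) <= B.
Proof.
  intros Hi HB.
  assert (S0 := X_step i ltac:(lia)). assert (S1 := X_step (S i) ltac:(lia)).
  assert (Q : Rabs (eps * delta2 X Phi (S i) - 0) <= B).
  { apply (delta2_near X phi (fun x => th1 / 8 * phi x)
      (fun x => th1 / 8 * (th1 / 8 * phi x))); try (intros; apply is_derive_phi);
      try (intros; apply is_derive_phi1);
      try exact (is_derive_continuity_pt _ _ _ (is_derive_phi _)); [lra|].
    intros c Hc. rewrite Rminus_0_r, Rabs_pos_eq; [now apply HB|].
    assert (P : 0 < phi c) by apply decay_pos.
    repeat nonneg. }
  rewrite Rminus_0_r in Q. apply Rle_trans with (2 := Q). apply Rle_abs.
Qed.

Lemma half_scheme_phi_le (i : nat) (B D : R) : (S (S i) <= 4 * m)%nat ->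
  eps * delta2 X Phi (S i) <= B ->
  D <= Dminus X Phi (S i) -> 0 <= D ->
  half_scheme eps mu A b X Phi (S i) <= B - mu * alpha * D.
Proof.
  intros Hi HB HD D0.
  assert (Rg := X_interior (S i) ltac:(lia)).
  assert (HA := hd_A data (x := X (S i)) ltac:(lra)).
  assert (Hb := hd_gamma data (x := X (S i)) ltac:(lra)).
  assert (P : 0 < phi (X (S i))) by apply decay_pos.
  assert (Q1 : 0 <= b (X (S i)) * phi (X (S i))) by nonneg.
  assert (Q2 : mu * alpha * D <= mu * A (X (S i)) * Dminus X Phi (S i)).
  { apply Rmult_le_compat; trivial; [nonneg|].
    scaled. }
  unfold half_scheme. change (Phi (S i)) with (phi (X (S i))). lra.
Qed.

(** The summands belong to the outer layer, to the coarse part, and to the inner layer when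
    [th1 = th2]. *)
Definition barrier_const : R := 16 / d ^ 2 + C ^ 2 / d + C.

Lemma barrier_const_parts : 0 <= 16 / d ^ 2 /\ 0 <= C ^ 2 / d.
Proof. split; nonneg. Qed.

Lemma outer_barrier (i : nat) : (S (S i) <= m)%nat ->
  half_scheme eps mu A b X Phi (S i) <= barrier_const.
Proof.
  intros Hi. destruct barrier_const_parts as [B1 B2].
  assert (Xi2 : X (S (S i)) = layer m th2 (S (S i)))
    by (apply X_outer; lia).
  assert (Hlast : X (S (S i)) <= d / 4).
  { rewrite Xi2. apply Rle_trans with (layer m th2 m).
    - apply layer_mono; trivial; lia.
    - exact outer_small. }
  assert (Hd : eps * delta2 X Phi (S i) <= 16 / d ^ 2).
  { apply phi_delta2; [lia|]. intros c Hc.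
    assert (Q := far_decay_power 2 (th1 / 8) (d - c) ltac:(lra) ltac:(lra) ltac:(lia)).
    fold (phi c) in Q.
    replace ((2 * INR 2 / d) ^ 2) with (16 / d ^ 2) in Q by (simpl INR; field; lra).
    replace (th1 / 8 * (th1 / 8 * phi c)) with ((th1 / 8) ^ 2 * phi c) by ring.
    assert (0 <= (th1 / 8) ^ 2 * phi c).
    { apply Rmult_le_pos; [apply pow_le; lra | left; apply decay_pos]. }
    nra. }
  destruct (phi_slope i ltac:(lia)) as [c [Hc E]].
  assert (P : 0 < phi c) by apply decay_pos.
  assert (L := half_scheme_phi_le i _ 0 ltac:(lia) Hd
    ltac:(rewrite E; nonneg) ltac:(lra)).
  unfold barrier_const. lra.
Qed.

(** The slopes of the barrier on adjacent cells differ by at most [th1]; the second difference then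
    costs [eps * th1 * n / d], which is bounded because [eps * th1 * th2] is. *)
Lemma coarse_barrier (i : nat) : (m <= S i <= 3 * m)%nat ->
  half_scheme eps mu A b X Phi (S i) <= barrier_const.
Proof.
  intros Hi. destruct barrier_const_parts as [B1 B2].
  destruct (phi_slope i ltac:(lia)) as [c [Hc E]].
  destruct (phi_slope (S i) ltac:(lia)) as [c' [Hc' E']].
  assert (P : 0 < phi c) by apply decay_pos.
  assert (P' : phi c' <= 1).
  { apply phi_le_1. assert (Rg := X_range (S (S i)) ltac:(lia)). lra. }
  assert (P0 : 0 < phi c') by apply decay_pos.
  assert (Qs : Rabs (th1 / 8 * phi c' - th1 / 8 * phi c) <= th1).
  { assert (P1 : phi c <= 1).
    { apply phi_le_1. assert (Rg := X_range (S i) ltac:(lia)). lra. }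
    assert (th1 / 8 * phi c' <= th1 / 8 * 1) by scaled.
    assert (th1 / 8 * phi c <= th1 / 8 * 1) by scaled.
    assert (0 <= th1 / 8 * phi c) by nonneg.
    assert (0 <= th1 / 8 * phi c') by nonneg.
    abs_lra. }
  rewrite <- E, <- E' in Qs.
  assert (Hd : eps * delta2 X Phi (S i) <= C ^ 2 / d).
  { apply Rle_trans with (eps * (th1 * (n * / d))).
    - apply Rle_trans with (1 := Rle_abs _).
      apply coarse_second_difference; trivial; lra.
    - replace (eps * (th1 * (n * / d))) with (eps * th1 * n * / d) by ring.
      apply Rmult_le_compat_r; [lra|].
      apply Rle_trans with (eps * th1 * (C * th2)).
      + apply Rmult_le_compat_l; [nonneg | lra].
      + assert (Q := Rmult_le_compat_l C _ _ ltac:(lra) (rg_eps_th reg)). simpl; lra. }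
  assert (L := half_scheme_phi_le i _ 0 ltac:(lia) Hd
    ltac:(rewrite E; nonneg) ltac:(lra)).
  unfold barrier_const. lra.
Qed.

(** With [T = eps * th1 ^ 2 * s (S (S j))], diffusion gives at most [8 * T / 64] by the ratio bound.
    If [2 * (eps * th1) = alpha * mu], convection subtracts at least [2 * T / 8], leaving [- T / 8].
    If [th1 = th2], [T] is at most [C] and the constant covers it. *)
Lemma inner_barrier (j : nat) : (S (S j) <= m)%nat ->
  half_scheme eps mu A b X Phi (4 * m - S j)
    <= barrier_const - eps * th1 ^ 2 * s (S (S j)) / 8.
Proof.
  intros Hj. destruct barrier_const_parts as [B1 B2].
  set (i := (4 * m - S (S j))%nat).
  replace (4 * m - S j)%nat with (S i) by (unfold i; lia).
  assert (Xi : X i = d - layer m th1 (S (S j)))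
    by (apply X_inner; lia).
  assert (Xi2 : X (S (S i)) = d - layer m th1 j).
  { replace (S (S i)) with (4 * m - j)%nat by (unfold i; lia).
    apply X_inner; lia. }
  assert (Pi : phi (X i) = s (S (S j))).
  { unfold phi. rewrite Xi.
    replace (d - (d - layer m th1 (S (S j)))) with (layer m th1 (S (S j))) by ring.
    now apply decay_eighth_layer. }
  assert (Pi2 : phi (X (S (S i))) = s j).
  { unfold phi. rewrite Xi2.
    replace (d - (d - layer m th1 j)) with (layer m th1 j) by ring.
    apply decay_eighth_layer; trivial; lia. }
  assert (Hs : 0 < s (S (S j))) by now apply layer_ratio_pos.
  assert (Hs8 := layer_ratio_mult2 m m_pos j Hj). fold s in Hs8.
  assert (E0 : 0 < eps * th1 ^ 2) by (apply Rmult_lt_0_compat; [lra | apply pow_lt; lra]).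
  assert (Hd : eps * delta2 X Phi (S i) <= eps * th1 ^ 2 * (s j / 64)).
  { apply phi_delta2; [lia|]. intros c Hc.
    replace (eps * (th1 / 8 * (th1 / 8 * phi c))) with (eps * th1 ^ 2 * (phi c / 64)) by field.
    apply Rmult_le_compat_l; [lra|].
    assert (Q := phi_mono c (X (S (S i))) ltac:(lra)). lra. }
  destruct (phi_slope i ltac:(lia)) as [c [Hc E]].
  assert (Pc := phi_mono (X i) c ltac:(lra)).
  assert (L := half_scheme_phi_le i _ (th1 / 8 * s (S (S j))) ltac:(lia) Hd
    ltac:(rewrite E; scaled) ltac:(nonneg)).
  assert (T1 : eps * th1 ^ 2 * (s j / 64) <= eps * th1 ^ 2 * (8 * s (S (S j)) / 64))
    by scaled.
  destruct (rg_cases reg) as [Heq|[Hth _]].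
  - assert (Ec : eps * th1 ^ 2 <= C).
    { replace (eps * th1 ^ 2) with (eps * th1 * th2) by (rewrite <- Heq; ring).
      apply (rg_eps_th reg). }
    assert (T2 : eps * th1 ^ 2 * s (S (S j)) <= C * 1).
    { apply Rmult_le_compat; try lra. now apply layer_ratio_le_1. }
    assert (T3 : 0 <= mu * alpha * (th1 / 8 * s (S (S j)))) by nonneg.
    unfold barrier_const. lra.
  - replace (mu * alpha * (th1 / 8 * s (S (S j))))
      with (2 * (eps * th1 ^ 2 * s (S (S j))) / 8) in L.
    + unfold barrier_const. lra.
    + replace (mu * alpha) with (alpha * mu) by ring. rewrite <- Hth. field.
Qed.

(** * The flux at the interface *)

Lemma first_inner_width : d - X (pred (4 * m)) <= 288 * (/ n * / th1).
Proof.
  replace (pred (4 * m)) with (4 * m - 1)%nat by lia.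
  rewrite X_inner by lia.
  assert (L := layer_step m m_pos th1 th1_gt_0 0 ltac:(lia)).
  rewrite layer_0 in L. fold n in L.
  assert (Q := layer_ratio_mult m m_pos 0 ltac:(lia)).
  rewrite layer_ratio_0 in Q.
  assert (I : / layer_ratio m 1 <= 9 / 2).
  { replace (9 / 2) with (/ (2 / 9)) by field. apply Rinv_le_contravar; lra. }
  assert (T : 8 / th1 * (8 / n * / layer_ratio m 1) <= 8 / th1 * (8 / n * (9 / 2))).
  { assert (0 < / th1) by (apply Rinv_0_lt_compat; lra).
    apply Rmult_le_compat_l; [unfold Rdiv; lra|]. apply Rmult_le_compat_l; [unfold Rdiv; lra|].
    exact I. }
  replace (288 * (/ n * / th1)) with (8 / th1 * (8 / n * (9 / 2))) by (field; lra).
  lra.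
Qed.

(* The solution itself, as opposed to its distance [z] to the reduced solution. *)
Variable u : R -> R.
Hypothesis u_split : forall x, u x = z x + v x.

Definition interface_const : R := 288 * (K + C ^ 4 * M).

(** The quotient is the derivative at a point of the last cell, of width at most [288 / (n * th1)],
    and the second derivative is of size [th1 ^ 2]. The defect [th1 / n] is not of order 1/N by
    itself; the slope of the barrier has to absorb it. *)
Lemma interface_consistency (u1 : R) : u1 = z1 d + v1 d ->
  Rabs (Dminus X (fun j => u (X j)) (4 * m) - u1) <= interface_const * (th1 * / n).
Proof.
  intros ->.
  set (i := pred (4 * m)).
  assert (Ei : (4 * m = S i)%nat) by (unfold i; lia).
  assert (Xl : X (S i) = d).
  { rewrite <- Ei. now apply half_mesh_last. }
  assert (S0 := X_step i ltac:(lia)). rewrite Xl in S0.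
  assert (R0 := X_range i ltac:(lia)).
  assert (W := first_inner_width). fold i in W.
  destruct (hd_cont data d) as [_ [_ [_ [Cv1 _]]]].
  rewrite Ei.
  replace (Dminus X (fun j => u (X j)) (S i))
    with (Dminus X (fun j => z (X j) + v (X j)) (S i))
    by (unfold Dminus; now rewrite !u_split).
  destruct (Dminus_mean_value X (fun x => z x + v x) (fun x => z1 x + v1 x) i) as [c [Hc E]].
  - lra.
  - intros x Hx. apply (is_derive_plus z v); [apply (rp_dz prof) | apply (hd_dv data)]; lra.
  - intros x Hx. apply (continuity_pt_plus z v); [apply (rp_cont prof)|].
    apply (hd_cont data).
  - rewrite E. rewrite Xl in Hc.
    destruct (mvt_open (fun x => z1 x + v1 x) (fun x => z2 x + v2 x) c d) as [e [He Ee]].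
    + lra.
    + intros x Hx. apply (is_derive_plus z1 v1); [apply (rp_dz1 prof) | apply (hd_dv1 data)]; lra.
    + intros x Hx. destruct (Req_dec x d) as [->|Hne].
      * apply (continuity_pt_plus z1 v1); [apply (rp_cont1 prof) | exact Cv1].
      * apply (is_derive_continuity_pt _ _ (z2 x + v2 x)).
        apply (is_derive_plus z1 v1); [apply (rp_dz1 prof) | apply (hd_dv1 data)]; lra.
    + rewrite Rabs_minus_sym, Ee, Rabs_mult, (Rabs_pos_eq (d - c)) by lra.
      assert (Z2 := rp_z2 prof (x := e) ltac:(lra)).
      destruct (hd_bound data (x := e)) as [_ [_ [_ [Hv2 _]]]]; [lra|].
      assert (One : 1 <= C ^ 4 * th1 ^ 2).
      { assert (H1 := rg_th reg).
        assert (H2 : 1 <= C * (C * th1)).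
        { apply Rle_trans with (C * th2); [lra|]. scaled. }
        replace (C ^ 4 * th1 ^ 2) with ((C * (C * th1)) ^ 2) by ring.
        rewrite <- (pow1 2). apply pow_incr. lra. }
      assert (V2 : Rabs (z2 e + v2 e) <= (K + C ^ 4 * M) * th1 ^ 2).
      { apply Rle_trans with (1 := Rabs_triang _ _).
        assert (M * 1 <= M * (C ^ 4 * th1 ^ 2)) by scaled. lra. }
      apply Rle_trans with ((K + C ^ 4 * M) * th1 ^ 2 * (288 * (/ n * / th1))).
      * apply Rmult_le_compat; try apply Rabs_pos; trivial; lra.
      * right. unfold interface_const. field. lra.
Qed.

(** The slope is [th1 / 8] times a value of [phi] in the last cell, and one step from the interface
    [phi] is still at least [2 / 9]. *)
Lemma phi_interface_slope : th1 / 36 <= Dminus X Phi (4 * m).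
Proof.
  destruct (phi_slope (pred (4 * m)) ltac:(lia)) as [c [Hc E]].
  replace (S (pred (4 * m))) with (4 * m)%nat in E by lia. rewrite E.
  assert (P : phi (X (pred (4 * m))) <= phi c) by (apply phi_mono; lra).
  assert (Q : phi (X (pred (4 * m))) = s 1%nat).
  { replace (pred (4 * m)) with (4 * m - 1)%nat by lia.
    unfold phi. rewrite X_inner by lia.
    replace (d - (d - layer m th1 1)) with (layer m th1 1) by ring.
    apply decay_eighth_layer; assumption. }
  assert (S1 := layer_ratio_mult m m_pos 0 ltac:(lia)).
  rewrite layer_ratio_0 in S1. fold s in S1.
  replace (th1 / 36) with (th1 / 8 * (2 / 9)) by field.
  scaled.
Qed.

Definition consistency_const : R := fine_const + coarse_const + reduced_const.

Lemma half_consistency (i : nat) : (0 < i < 4 * m)%nat ->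
  exists T, 0 <= T /\
    Rabs (half_scheme eps mu A b X (fun j => u (X j)) i + b (X i) * v (X i))
      <= consistency_const * / n * (1 + T) /\
    half_scheme eps mu A b X Phi i <= barrier_const - T / 8.
Proof.
  intros Hi. destruct i as [|i]; [lia|].
  assert (F := fine_const_pos). assert (Co := coarse_const_pos).
  assert (Re := reduced_consistency i ltac:(lia)).
  set (Rv := eps * delta2 X (fun j => v (X j)) (S i)
        - mu * A (X (S i)) * Dminus X (fun j => v (X j)) (S i)) in Re.
  assert (Sp : half_scheme eps mu A b X (fun j => u (X j)) (S i)
                + b (X (S i)) * v (X (S i))
               = half_scheme eps mu A b X Z (S i) + Rv).
  { unfold half_scheme, Z, Rv, delta2, Dplus, Dminus, Rdiv. rewrite !u_split. ring. }
  assert (Tr : forall B T, 0 <= T ->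
      Rabs (half_scheme eps mu A b X Z (S i)) <= B * / n * (1 + T) ->
      B <= fine_const + coarse_const ->
      Rabs (half_scheme eps mu A b X Z (S i) + Rv)
        <= consistency_const * / n * (1 + T)).
  { intros B T HT HB HBc. apply Rle_trans with (1 := Rabs_triang _ _).
    assert (Q1 : B * / n * (1 + T) <= (fine_const + coarse_const) * / n * (1 + T)).
    { apply Rmult_le_compat_r; [lra|]. scaled. }
    assert (Q2 : 0 <= reduced_const * / n * T) by nonneg.
    unfold consistency_const. lra. }
  rewrite Sp.
  destruct (le_lt_dec (S (S i)) m) as [H1|H1].
  { exists 0. split; [lra|]. split.
    - apply (Tr fine_const); try lra. rewrite Rplus_0_r, Rmult_1_r.
      now apply outer_consistency.
    - assert (L := outer_barrier i H1). lra. }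
  destruct (le_lt_dec (S i) (3 * m)) as [H2|H2].
  { exists 0. split; [lra|]. split.
    - apply (Tr coarse_const); try lra. rewrite Rplus_0_r, Rmult_1_r.
      apply coarse_consistency; lia.
    - assert (L := coarse_barrier i ltac:(lia)). lra. }
  set (j := (4 * m - S (S i))%nat).
  assert (Hj : (S (S j) <= m)%nat) by (unfold j; lia).
  assert (Eij : (S i = 4 * m - S j)%nat) by (unfold j; lia).
  (* The barrier value at the far end of the two cells, times the possibly large factor. In the
     other two regions [T = 0] suffices. *)
  exists (eps * th1 ^ 2 * s (S (S j))).
  assert (T0 : 0 <= eps * th1 ^ 2 * s (S (S j))).
  { apply Rmult_le_pos; [apply Rmult_le_pos; [lra | apply pow_le; lra]|].
    left. now apply layer_ratio_pos. }
  split; [exact T0|]. split.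
  - apply (Tr fine_const); try lra. rewrite Eij. now apply inner_consistency.
  - rewrite Eij. now apply inner_barrier.
Qed.

Lemma half_consistent_holds (K' u1 : R) :
  consistency_const <= K' -> barrier_const <= K' -> interface_const <= K' ->
  u1 = z1 d + v1 d -> half_consistent d eps mu th1 th2 K' m A b v u u1.
Proof.
  intros L1 L2 L3 Hu. fold n. split; [|split].
  - intros i Hi. destruct (half_consistency i Hi) as [T [T0 [Ta Tb]]].
    exists T. split; [exact T0|]. split.
    + apply Rle_trans with (1 := Ta). fold n.
      apply Rmult_le_compat_r; [lra|]. scaled.
    + apply Rle_trans with (1 := Tb). lra.
  - apply Rle_trans with (1 := interface_consistency u1 Hu). fold n.
    apply Rmult_le_compat_r; [nonneg | exact L3].
  - exact phi_interface_slope.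
Qed.

End Consistency.

Lemma half_consistent_exists (d alpha rho gamma M C : R) :
  0 < d -> 0 < alpha -> 0 < gamma -> 1 <= M -> 1 <= C ->
  exists K, forall K' eps mu th1 th2 A A1 b b1 v v1 v2 v3 u u1 m,
    K <= K' ->
    half_data d alpha rho gamma M A A1 b b1 v v1 v2 v3 ->
    regime alpha rho C eps mu th1 th2 ->
    half_solution d eps mu M A b v u u1 ->
    (1 <= m)%nat -> INR (8 * m) <= C * th1 -> INR (8 * m) <= C * th2 ->
    32 * C / d <= sqrt (INR (8 * m)) ->
    half_consistent d eps mu th1 th2 K' m A b v u (u1 d).
Proof.
  intros Hd Ha Hg HM HC.
  set (K0 := profile_const alpha gamma M C).
  assert (HK0 : 1 <= K0) by apply Rmax_l.
  set (Ka := consistency_const d M C K0). set (Kb := barrier_const d C).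
  set (Kc := interface_const M C K0).
  exists (Rmax Ka (Rmax Kb Kc)).
  intros K' eps mu th1 th2 A A1 b b1 v v1 v2 v3 u u1 m HK data reg sol Hm N1 N2 Hr.
  assert (L1 := Rmax_l Ka (Rmax Kb Kc)). assert (L2 := Rmax_r Ka (Rmax Kb Kc)).
  assert (L3 := Rmax_l Kb Kc). assert (L4 := Rmax_r Kb Kc).
  assert (Hn := mesh_size_ge_8 m Hm). set (n := INR (8 * m)) in *.
  assert (T1 : 2 <= d * th1).
  { assert (Q : 32 * C <= d * sqrt n).
    { apply Rmult_le_compat_l with (r := d) in Hr; [|lra].
      replace (d * (32 * C / d)) with (32 * C) in Hr by (field; lra). exact Hr. }
    assert (Q2 : sqrt n <= n).
    { assert (Q0 : sqrt n * sqrt n = n) by (apply sqrt_sqrt; lra).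
      assert (0 <= sqrt n) by apply sqrt_pos. nra. }
    assert (Q3 : d * sqrt n <= d * (C * th1)) by scaled.
    apply Rmult_le_reg_l with C; lra. }
  assert (prof := residual_profile_holds d alpha rho gamma M C eps mu th1 th2
    A A1 b b1 v v1 v2 v3 u u1 Hd Ha Hg HM HC data reg sol T1 ltac:(lra)).
  eapply (half_consistent_holds d alpha rho gamma M C K0 eps mu th1 th2 A A1 b b1
    v v1 v2 v3 _ _ _ _ m Hd Ha Hg HM HC HK0 Hm data reg prof N1 N2 Hr u);
    fold Ka; fold Kb; fold Kc; try lra; intros; ring.
Qed.

(** * Extracting pointwise data from the hypotheses *)

(* The constant extension of a function beyond an interval turns one-sided
   continuity at the end points into two-sided continuity. *)
Definition clamp (p q x : R) : R := Rmax p (Rmin q x).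

Lemma clamp_range (p q x : R) : p <= q -> p <= clamp p q x <= q.
Proof.
  intros H. unfold clamp. split; [apply Rmax_l|].
  apply Rmax_lub; [exact H | apply Rmin_l].
Qed.

Lemma clamp_id (p q x : R) : p <= x <= q -> clamp p q x = x.
Proof.
  intros H. unfold clamp. rewrite Rmin_right by lra. apply Rmax_right; lra.
Qed.

Lemma clamp_contracts (p q x t : R) :
  Rabs (clamp p q t - clamp p q x) <= Rabs (t - x).
Proof.
  unfold clamp, Rmax, Rmin.
  repeat destruct Rle_dec; unfold Rabs; repeat destruct Rcase_abs; lra.
Qed.

Lemma continuity_clamp (p q : R) (g : R -> R) :
  p <= q -> (forall x, p <= x <= q -> continue_in g (fun x => p <= x <= q) x) ->
  forall x, continuity_pt (fun t => g (clamp p q t)) x.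
Proof.
  intros Hpq Hg x e He.
  destruct (Hg (clamp p q x) (clamp_range p q x Hpq) e He) as [r [Hr Q]].
  exists r. split; [exact Hr|]. intros t [_ Ht]. simpl in *. unfold R_dist in *.
  destruct (Req_dec (clamp p q x) (clamp p q t)) as [E|E].
  - rewrite E, Rminus_diag, Rabs_R0. exact He.
  - apply Q. split; [split; [now apply clamp_range | exact E]|].
    apply Rle_lt_trans with (2 := Ht). apply clamp_contracts.
Qed.

Lemma D_in_interior (D : R -> Prop) (f f' g : R -> R) (x r : R) :
  0 < r -> (forall t, Rabs (t - x) < r -> D t /\ g t = f t) ->
  D_in f f' D x -> is_derive g x (f' x).
Proof.
  intros Hr HD Hf. apply is_derive_Reals. intros e He.
  destruct (Hf e He) as [r' [Hr' Q]].
  assert (Hm : 0 < Rmin r r') by now apply Rmin_pos.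
  exists (mkposreal _ Hm). simpl. intros h Hh Hlt.
  assert (L1 := Rmin_l r r'). assert (L2 := Rmin_r r r').
  simpl in Q. unfold R_dist in Q.
  assert (E : x + h - x = h) by ring.
  assert (Q' := Q (x + h)). rewrite E in Q'.
  destruct (HD (x + h)) as [D1 E1]; [rewrite E; lra|].
  destruct (HD x) as [_ E0]; [rewrite Rminus_diag, Rabs_R0; lra|].
  rewrite E1, E0. apply Q'.
  split; [split; [exact D1 | lra] | lra].
Qed.

Lemma continue_in_interior (D : R -> Prop) (f g : R -> R) (x r : R) :
  0 < r -> (forall t, Rabs (t - x) < r -> D t /\ g t = f t) ->
  continue_in f D x -> continuity_pt g x.
Proof.
  intros Hr HD Hf e He.
  destruct (Hf e He) as [r' [Hr' Q]].
  exists (Rmin r r'). split; [now apply Rmin_pos|].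
  intros t [[_ Hne] Ht]. simpl in *. unfold R_dist in *.
  assert (L1 := Rmin_l r r'). assert (L2 := Rmin_r r r').
  destruct (HD t) as [D1 E1]; [lra|].
  destruct (HD x) as [_ E0]; [rewrite Rminus_diag, Rabs_R0; lra|].
  rewrite E1, E0. apply Q. split; [split; assumption | lra].
Qed.

(** Two-sided continuity on the whole line, derivatives in the open interval only. This is what
    survives the constant extension, which may have corners at [p] and [q], and it is closed under
    the operations that build [- f / b]. *)
Fixpoint smooth (k : nat) (p q : R) (g : R -> R) : Prop :=
  (forall x, continuity_pt g x) /\
  match k with
  | O => True
  | S k' => exists g', (forall x, p < x < q -> is_derive g x (g' x)) /\ smooth k' p q g'
  end.

Lemma smooth_continuity (k : nat) (p q : R) (g : R -> R) :
  smooth k p q g -> forall x, continuity_pt g x.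
Proof. now destruct k; intros [H _]. Qed.

Lemma interior_radius (p q x : R) : p < x < q ->
  exists r, 0 < r /\ forall t, Rabs (t - x) < r -> p < t < q.
Proof.
  intros Hx. exists (Rmin (x - p) (q - x)). split; [apply Rmin_pos; lra|].
  intros t Ht. assert (L1 := Rmin_l (x - p) (q - x)). assert (L2 := Rmin_r (x - p) (q - x)).
  apply Rabs_lt_between in Ht. lra.
Qed.

Lemma Ck_smooth (k : nat) (p q : R) (g : R -> R) :
  p < q -> Ck k (fun x => p <= x <= q) g -> smooth k p q (fun x => g (clamp p q x)).
Proof.
  intros Hpq. revert g. induction k as [|k IH]; intros g Hg.
  - split; [|exact I]. now apply continuity_clamp; [lra|].
  - destruct Hg as [g' [D1 D2]]. split.
    + apply continuity_clamp; [lra|]. intros x Hx.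
      now apply (cont_deriv g g'), D1.
    + exists (fun x => g' (clamp p q x)). split; [|now apply IH].
      intros x Hx. rewrite (clamp_id p q x) by lra.
      destruct (interior_radius p q x Hx) as [r [Hr Q]].
      apply (D_in_interior (fun x => p <= x <= q) g g' _ x r Hr); [|apply D1; lra].
      intros t Ht. specialize (Q t Ht). rewrite clamp_id by lra. split; [lra | reflexivity].
Qed.

Lemma smooth_sub (k : nat) (p q p' q' : R) (g : R -> R) :
  p <= p' -> q' <= q -> smooth k p q g -> smooth k p' q' g.
Proof.
  intros Hp Hq. revert g. induction k as [|k IH]; intros g; [trivial|].
  intros [H [g' [D1 D2]]]. split; [exact H|]. exists g'. split; [|now apply IH].
  intros x Hx; apply D1; lra.
Qed.

Lemma smooth_lower (k : nat) (p q : R) (g : R -> R) : smooth (S k) p q g -> smooth k p q g.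
Proof.
  revert g. induction k as [|k IH]; intros g [H [g' [D1 D2]]].
  - split; [exact H | exact I].
  - split; [exact H|]. exists g'. split; [exact D1 | now apply IH].
Qed.

Lemma smooth_le (k k' : nat) (p q : R) (g : R -> R) :
  (k' <= k)%nat -> smooth k p q g -> smooth k' p q g.
Proof. induction 1; [trivial|]. intros Hs. now apply IHle, smooth_lower. Qed.

Lemma smooth_plus (k : nat) (p q : R) (f g : R -> R) :
  smooth k p q f -> smooth k p q g -> smooth k p q (fun x => f x + g x).
Proof.
  revert f g. induction k as [|k IH]; intros f g [Cf Hf] [Cg Hg].
  - split; [|exact I]. intros x. now apply (continuity_pt_plus f g).
  - destruct Hf as [f' [Df Hf]]. destruct Hg as [g' [Dg Hg]]. split.
    + intros x. now apply (continuity_pt_plus f g).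
    + exists (fun x => f' x + g' x). split; [|now apply IH].
      intros x Hx. apply (is_derive_plus f g); [now apply Df | now apply Dg].
Qed.

Lemma smooth_mult (k : nat) (p q : R) (f g : R -> R) :
  smooth k p q f -> smooth k p q g -> smooth k p q (fun x => f x * g x).
Proof.
  revert f g. induction k as [|k IH]; intros f g Hf Hg.
  - destruct Hf as [Cf _], Hg as [Cg _].
    split; [|exact I]. intros x. now apply (continuity_pt_mult f g).
  - assert (Hf0 := smooth_lower _ _ _ _ Hf). assert (Hg0 := smooth_lower _ _ _ _ Hg).
    destruct Hf as [Cf [f' [Df Hf]]]. destruct Hg as [Cg [g' [Dg Hg]]]. split.
    + intros x. now apply (continuity_pt_mult f g).
    + exists (fun x => f' x * g x + f x * g' x). split.
      * intros x Hx. apply is_derive_Rmult; [now apply Df | now apply Dg].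
      * apply smooth_plus; now apply IH.
Qed.

Lemma smooth_opp (k : nat) (p q : R) (g : R -> R) :
  smooth k p q g -> smooth k p q (fun x => - g x).
Proof.
  revert g. induction k as [|k IH]; intros g [Cg Hg].
  - split; [|exact I]. intros x. now apply (continuity_pt_opp g).
  - destruct Hg as [g' [Dg Hg]]. split.
    + intros x. now apply (continuity_pt_opp g).
    + exists (fun x => - g' x). split; [|now apply IH].
      intros x Hx. now apply (is_derive_opp g), Dg.
Qed.

Lemma smooth_inv (k : nat) (p q : R) (g : R -> R) :
  (forall x, g x <> 0) -> smooth k p q g -> smooth k p q (fun x => / g x).
Proof.
  intros Hne. induction k as [|k IH]; intros Hg.
  - destruct Hg as [Cg _].
    split; [|exact I]. intros x. now apply (continuity_pt_inv g).
  - assert (Hi := IH (smooth_lower _ _ _ _ Hg)).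
    destruct Hg as [Cg [g' [Dg Hg]]]. split.
    + intros x. now apply (continuity_pt_inv g).
    + exists (fun x => - (g' x * (/ g x * / g x))). split.
      * intros x Hx.
        apply (is_derive_eq _ _ (- g' x / g x ^ 2)); [|field; apply Hne].
        now apply (is_derive_inv g); [apply Dg|].
      * apply smooth_opp, smooth_mult; [exact Hg | now apply smooth_mult].
Qed.

Lemma smooth_reflect (k : nat) (p q s : R) (g : R -> R) :
  smooth k p q g -> smooth k (s - q) (s - p) (fun x => g (s - x)).
Proof.
  revert g. induction k as [|k IH]; intros g [Cg Hg].
  - split; [|exact I]. intros x. now apply continuity_pt_reflect.
  - destruct Hg as [g' [Dg Hg]]. split.
    + intros x. now apply continuity_pt_reflect.
    + exists (fun x => - g' (s - x)). split.
      * intros x Hx. apply is_derive_reflect, Dg; lra.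
      * apply smooth_opp. now apply IH.
Qed.

Lemma continuity_bounded (p q : R) (g : R -> R) :
  p <= q -> (forall x, continuity_pt g x) ->
  exists B, 0 <= B /\ forall x, p <= x <= q -> Rabs (g x) <= B.
Proof.
  intros Hpq Cg.
  destruct (continuity_ab_maj (fun x => Rabs (g x)) p q Hpq) as [x0 [H _]].
  - intros x _. apply (continuity_pt_comp g Rabs); [apply Cg | apply Rcontinuity_abs].
  - exists (Rabs (g x0)). split; [apply Rabs_pos | exact H].
Qed.

Lemma half_data_exists (d alpha rho gamma : R) (A b v : R -> R) :
  0 < d -> smooth 2 0 d A -> smooth 2 0 d b -> smooth 4 0 d v ->
  (forall x, 0 <= x < d -> alpha <= A x) ->
  (forall x, 0 <= x < d -> rho * A x <= b x) ->
  (forall x, 0 <= x <= d -> gamma <= b x) ->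
  exists A1 b1 v1 v2 v3 M0, 0 <= M0 /\
    forall M, M0 <= M -> half_data d alpha rho gamma M A A1 b b1 v v1 v2 v3.
Proof.
  intros Hd [CA [A1 [DA [CA1 _]]]] [Cb [b1 [Db [Cb1 _]]]]
    [Cv [v1 [Dv [Cv1 [v2 [Dv1 [Cv2 [v3 [Dv2 [Cv3 _]]]]]]]]]] HA Hr Hg.
  exists A1, b1, v1, v2, v3.
  assert (Hd' : 0 <= d) by lra.
  destruct (continuity_bounded 0 d A Hd' CA) as [B1 [P1 Q1]].
  destruct (continuity_bounded 0 d A1 Hd' CA1) as [B2 [P2 Q2]].
  destruct (continuity_bounded 0 d b Hd' Cb) as [B3 [P3 Q3]].
  destruct (continuity_bounded 0 d b1 Hd' Cb1) as [B4 [P4 Q4]].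
  destruct (continuity_bounded 0 d v Hd' Cv) as [B5 [P5 Q5]].
  destruct (continuity_bounded 0 d v1 Hd' Cv1) as [B6 [P6 Q6]].
  destruct (continuity_bounded 0 d v2 Hd' Cv2) as [B7 [P7 Q7]].
  destruct (continuity_bounded 0 d v3 Hd' Cv3) as [B8 [P8 Q8]].
  exists (B1 + B2 + B3 + B4 + B5 + B6 + B7 + B8). split; [lra|].
  intros M HM. constructor; trivial.
  - intros x. auto.
  - intros x Hx.
    specialize (Q1 x Hx). specialize (Q2 x Hx). specialize (Q3 x Hx). specialize (Q4 x Hx).
    specialize (Q5 x Hx). specialize (Q6 x Hx). specialize (Q7 x Hx). specialize (Q8 x Hx).
    repeat split; lra.
Qed.

(** Boundedness of [a] keeps the quotients above [gamma / B], so the infimum is positive; the point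
    0, which differs from [d], shows that it is finite. *)
Lemma rho_of_spec (d gamma B : R) (a b : R -> R) :
  0 < d < 1 -> 0 < gamma -> 0 < B ->
  (forall x, 0 <= x <= 1 -> gamma <= b x) ->
  (forall x, 0 <= x <= 1 -> x <> d -> 0 < Rabs (a x) <= B) ->
  0 < rho_of d a b /\
  forall x, 0 <= x <= 1 -> x <> d -> rho_of d a b * Rabs (a x) <= b x.
Proof.
  intros Hd Hg HB Hb Ha. unfold rho_of.
  set (E := fun z => exists x, 0 <= x <= 1 /\ x <> d /\ z = Rabs (b x / a x)).
  destruct (Glb_Rbar_correct E) as [Lb Gr].
  assert (Eabs : forall x, 0 <= x <= 1 -> x <> d -> Rabs (b x / a x) = b x / Rabs (a x)).
  { intros x Hx Hne. specialize (Hb x Hx). specialize (Ha x Hx Hne).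
    assert (a x <> 0) by (intros E0; rewrite E0, Rabs_R0 in Ha; lra).
    unfold Rdiv. rewrite Rabs_mult, Rabs_inv, (Rabs_pos_eq (b x)) by lra. reflexivity. }
  assert (Low : Rbar_le (gamma / B) (Glb_Rbar E)).
  { apply Gr. intros z [x [Hx [Hne ->]]]. simpl. rewrite Eabs by assumption.
    specialize (Hb x Hx). specialize (Ha x Hx Hne).
    apply Rmult_le_compat; try lra.
    - left; apply Rinv_0_lt_compat; lra.
    - apply Rinv_le_contravar; lra. }
  assert (Mem : E (Rabs (b 0 / a 0))) by (exists 0; repeat split; lra).
  assert (Up := Lb _ Mem).
  destruct (Glb_Rbar E) as [g| |]; simpl in Low, Up; try contradiction.
  assert (Hgb : 0 < gamma / B) by (apply Rdiv_lt_0_compat; lra).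
  simpl. split; [lra|].
  intros x Hx Hne.
  assert (Mx : E (Rabs (b x / a x))) by (exists x; auto).
  assert (U := Lb _ Mx). simpl in U. rewrite Eabs in U by assumption.
  specialize (Ha x Hx Hne).
  apply Rmult_le_compat_r with (r := Rabs (a x)) in U; [|lra].
  replace (b x / Rabs (a x) * Rabs (a x)) with (b x) in U by (field; lra).
  exact U.
Qed.

(** The hypotheses supply independent representatives of the derivative on [(0, 1)] and off [d];
    uniqueness of derivatives identifies them. The function [u] extends [y] by constants, so that it
    is continuous on the whole line, and [u1] is continuous across [d]. *)
Lemma bvp_facts (d eps mu y0 y1 : R) (a b f y : R -> R) :
  0 < d < 1 -> 0 < eps ->
  bvp_solution d a b f eps mu y0 y1 y ->
  exists u u1 : R -> R,
    (forall x, 0 <= x <= 1 -> u x = y x) /\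
    (forall x, continuity_pt u x) /\
    (forall x, 0 < x < 1 -> is_derive u x (u1 x)) /\
    (forall x, 0 < x < 1 -> continuity_pt u1 x) /\
    (forall x, 0 < x < d \/ d < x < 1 ->
       is_derive u1 x ((f x + b x * u x - mu * a x * u1 x) / eps)) /\
    u 0 = y0 /\ u 1 = y1.
Proof.
  intros Hd He [C0 [[g1 [D1 C1]] [[h1 [Dh1 [h2 [Dh2 _]]]] [ODE [E0 E1]]]]].
  set (Dp := fun x => 0 < x < d \/ d < x < 1).
  assert (Rad : forall x, Dp x -> exists r, 0 < r /\
            forall t, Rabs (t - x) < r -> Dp t /\ 0 < t < 1).
  { intros x [Hx|Hx]; destruct (interior_radius _ _ x Hx) as [r [Hr Q]];
      exists r; (split; [exact Hr|]); intros t Ht; specialize (Q t Ht);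
      unfold Dp; split; lra. }
  assert (Dy : forall x, 0 < x < 1 -> is_derive y x (g1 x)).
  { intros x Hx. destruct (interior_radius _ _ x Hx) as [r [Hr Q]].
    apply (D_in_interior (fun x => 0 < x < 1) y g1 y x r Hr); [|now apply D1].
    intros t Ht. split; [now apply Q | reflexivity]. }
  assert (Dg : forall x, Dp x -> is_derive g1 x (h2 x)).
  { intros x Hx. destruct (Rad x Hx) as [r [Hr Q]].
    apply (D_in_interior Dp h1 h2 g1 x r Hr); [|now apply Dh2].
    intros t Ht. destruct (Q t Ht) as [Qa Qb]. split; [exact Qa|].
    rewrite <- (is_derive_unique y t (g1 t)) by now apply Dy.
    apply is_derive_unique.
    destruct (Rad t Qa) as [r' [Hr' Q']].
    apply (D_in_interior Dp y h1 y t r' Hr'); [|now apply Dh1].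
    intros t' Ht'. split; [now apply Q' | reflexivity]. }
  exists (fun x => y (clamp 0 1 x)), g1.
  split; [|split; [|split; [|split; [|split; [|split]]]]].
  - intros x Hx. now rewrite clamp_id.
  - apply continuity_clamp; [lra | exact C0].
  - intros x Hx. destruct (interior_radius _ _ x Hx) as [r [Hr Q]].
    apply (D_in_interior (fun x => 0 < x < 1) y g1 _ x r Hr); [|now apply D1].
    intros t Ht. specialize (Q t Ht). split; [exact Q|]. rewrite clamp_id; lra.
  - intros x Hx. destruct (interior_radius _ _ x Hx) as [r [Hr Q]].
    apply (continue_in_interior (fun x => 0 < x < 1) g1 g1 x r Hr); [|now apply C1].
    intros t Ht. split; [now apply Q | reflexivity].
  - intros x Hx. assert (Dd := Dg x Hx). apply (is_derive_eq _ _ _ _ Dd).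
    destruct (Rad x Hx) as [r [Hr Q]].
    destruct (Q x) as [_ Hx1]; [rewrite Rminus_diag, Rabs_R0; exact Hr|].
    rewrite clamp_id by lra.
    assert (O := ODE x Hx).
    rewrite (is_derive_unique y x (g1 x)) in O by (apply Dy; lra).
    replace (Derive_n y 2 x) with (h2 x) in O.
    + rewrite <- O. field. lra.
    + symmetry. simpl. apply is_derive_unique.
      apply is_derive_ext_loc with g1; [|exact Dd].
      exists (mkposreal r Hr). intros t Ht.
      symmetry. apply is_derive_unique, Dy, (Q t Ht).
  - rewrite clamp_id; [exact E0 | lra].
  - rewrite clamp_id; [exact E1 | lra].
Qed.

(** In both cases [eps * th2 ^ 2 <= rho * alpha / 4] and [mu * th2 <= rho / 2], so the slow barrier
    uses at most three quarters of [rho * a]. At the fast rate [th1 = th2] gives the same quarter,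
    and otherwise [eps * th1] is half of [alpha * mu] and convection dominates. *)
Lemma regime_of_mesh (alpha rho : R) :
  0 < alpha -> 0 < rho ->
  exists C, 1 <= C /\ forall eps mu, 0 < eps <= 1 -> 0 < mu <= 1 ->
    regime alpha rho C eps mu (theta1 alpha rho eps mu) (theta2 alpha rho eps mu) /\
    forall n, 0 < n ->
      (sqrt alpha * mu <= sqrt (rho * eps) -> sqrt eps < / n) ->
      (sqrt alpha * mu > sqrt (rho * eps) -> Rmax (eps / mu) mu < / n) ->
      n <= C * theta1 alpha rho eps mu /\ n <= C * theta2 alpha rho eps mu.
Proof.
  intros Ha Hr.
  set (sa := sqrt alpha). set (sr := sqrt rho).
  assert (Hsa : 0 < sa) by now apply sqrt_lt_R0.
  assert (Hsr : 0 < sr) by now apply sqrt_lt_R0.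
  assert (Ea : sa * sa = alpha) by (apply sqrt_sqrt; lra).
  assert (Er : sr * sr = rho) by (apply sqrt_sqrt; lra).
  assert (Hra : 0 < rho * alpha) by now apply Rmult_lt_0_compat.
  assert (Hq : 0 < sr * sa) by now apply Rmult_lt_0_compat.
  (* The sum of all bounds met below, each of which is then at most [C]. *)
  set (C := 1 + alpha + rho + rho * alpha + sr * sa + 2 / alpha + 2 / rho
            + 4 / (rho * alpha) + 2 / (sr * sa)).
  assert (I1 : 0 < 2 / alpha) by (apply Rdiv_lt_0_compat; lra).
  assert (I2 : 0 < 2 / rho) by (apply Rdiv_lt_0_compat; lra).
  assert (I3 : 0 < 4 / (rho * alpha)) by (apply Rdiv_lt_0_compat; lra).
  assert (I4 : 0 < 2 / (sr * sa)) by (apply Rdiv_lt_0_compat; lra).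
  assert (B : 1 <= C /\ alpha <= C /\ rho <= C /\ rho * alpha <= C /\ sr * sa <= C /\
    2 / alpha <= C /\ 2 / rho <= C /\ 4 / (rho * alpha) <= C /\ 2 / (sr * sa) <= C)
    by (unfold C; lra).
  clearbody C. destruct B as [C1 [C2 [C3 [C4 [C5 [C6 [C7 [C8 C9]]]]]]]].
  assert (Lift : forall p x, 0 < p -> 2 / p <= C -> 0 <= x -> x <= C * (p / 2 * x)).
  { intros p x Hp Hc Hx. replace x with (2 / p * (p / 2 * x)) at 1 by (field; lra).
    apply Rmult_le_compat_r; [|exact Hc]. apply Rmult_le_pos; [|exact Hx].
    unfold Rdiv; lra. }
  assert (L4 : 1 <= C * (rho * alpha / 4)).
  { replace 1 with (4 / (rho * alpha) * (rho * alpha / 4)) by (field; lra).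
    apply Rmult_le_compat_r; [unfold Rdiv; lra | exact C8]. }
  assert (InvLe : forall n w, 0 < n -> 0 < w -> w < / n -> n <= / w).
  { intros n w Hn Hw Hlt. rewrite <- (Rinv_inv n). apply Rinv_le_contravar; lra. }
  exists C. split; [exact C1|]. intros eps mu He Hm.
  unfold theta1, theta2.
  destruct (Rle_dec (sqrt alpha * mu) (sqrt (rho * eps))) as [Hc|Hc].
  - rewrite !sqrt_mult in * by lra. fold sa sr in Hc |- *.
    set (e := sqrt eps) in *.
    assert (Hep : 0 < e) by (apply sqrt_lt_R0; lra).
    assert (Ee : e * e = eps) by (apply sqrt_sqrt; lra).
    assert (He1 : e <= 1) by nra.
    set (th := sr * sa / (2 * e)).
    assert (Hth : 0 < th) by (unfold th; apply Rdiv_lt_0_compat; lra).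
    assert (E1 : eps * th = sr * sa / 2 * e) by (unfold th; rewrite <- Ee; field; lra).
    assert (E2 : eps * th ^ 2 = rho * alpha / 4).
    { replace (eps * th ^ 2) with (eps * th * th) by ring. rewrite E1.
      unfold th. rewrite <- Er, <- Ea. field. lra. }
    assert (E3 : mu * th <= rho / 2).
    { unfold th. apply Rmult_le_reg_r with (2 * e); [lra|].
      replace (mu * (sr * sa / (2 * e)) * (2 * e)) with (sr * (sa * mu)) by (field; lra).
      replace (rho / 2 * (2 * e)) with (sr * (sr * e)) by (rewrite <- Er; field).
      scaled. }
    split.
    + constructor; trivial.
      * intros a b HA HB. rewrite E2.
        assert (a * (mu * th) <= a * (rho / 2)) by scaled.
        assert (rho * alpha <= rho * a) by scaled. lra.
      * intros a b HA HB. rewrite E2.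
        assert (0 <= mu * a * th) by nonneg.
        assert (rho * alpha <= rho * a) by scaled. lra.
      * rewrite E1. nra.
      * lra.
      * nra.
      * rewrite E2. exact L4.
      * rewrite E1. apply Rmult_le_reg_l with sa; [exact Hsa|].
        apply Rle_trans with (1 := Hc).
        replace (sa * (C * (sr * sa / 2 * e))) with (C * (alpha / 2 * (sr * e)))
          by (rewrite <- Ea; field).
        apply Lift; trivial. nonneg.
      * replace (eps * th * th) with (eps * th ^ 2) by ring. rewrite E2. lra.
      * now left.
    + intros n Hn HN _. specialize (HN Hc).
      assert (Q : n <= C * th); [|now split].
      assert (Q1 : n <= / e) by (apply InvLe; lra).
      apply Rle_trans with (1 := Q1).
      replace (C * th) with (C * (sr * sa / 2 * / e)) by (unfold th; field; lra).
      apply Lift; trivial. left; now apply Rinv_0_lt_compat.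
  - assert (Hc' : sqrt alpha * mu > sqrt (rho * eps)) by lra.
    (* The case distinction, squared; it yields [th2 <= th1] and the bounds on [eps * th2]. *)
    assert (Sq : rho * eps <= alpha * mu ^ 2).
    { assert (P0 : 0 <= sqrt (rho * eps)) by apply sqrt_pos.
      assert (P1 : sqrt (rho * eps) * sqrt (rho * eps) = rho * eps).
      { apply sqrt_sqrt. nonneg. }
      fold sa in Hc'. rewrite <- P1, <- Ea.
      replace (sa * sa * mu ^ 2) with ((sa * mu) * (sa * mu)) by ring.
      apply Rmult_le_compat; lra. }
    set (th1 := alpha * mu / (2 * eps)). set (th2 := rho / (2 * mu)).
    assert (Ham : 0 < alpha * mu) by (apply Rmult_lt_0_compat; lra).
    assert (H1 : 0 < th1) by (unfold th1; apply Rdiv_lt_0_compat; lra).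
    assert (H2 : 0 < th2) by (unfold th2; apply Rdiv_lt_0_compat; lra).
    assert (E1 : eps * th1 = alpha * mu / 2) by (unfold th1; field; lra).
    assert (E2 : mu * th2 = rho / 2) by (unfold th2; field; lra).
    assert (E3 : eps * th2 <= alpha / 2 * mu).
    { unfold th2. apply Rmult_le_reg_r with (2 * mu); [lra|].
      replace (eps * (rho / (2 * mu)) * (2 * mu)) with (rho * eps) by (field; lra).
      lra. }
    assert (E4 : th2 <= th1).
    { unfold th1, th2. apply Rmult_le_reg_r with (2 * mu * eps).
      - apply Rmult_lt_0_compat; lra.
      - replace (rho / (2 * mu) * (2 * mu * eps)) with (rho * eps) by (field; lra).
        replace (alpha * mu / (2 * eps) * (2 * mu * eps)) with (alpha * mu ^ 2) by (field; lra).
        exact Sq. }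
    assert (E5 : eps * th1 * th2 = rho * alpha / 4).
    { rewrite E1. unfold th2. field. lra. }
    assert (E6 : rho * alpha / 4 <= eps * th1 ^ 2).
    { rewrite <- E5. replace (eps * th1 ^ 2) with (eps * th1 * th1) by ring.
      scaled. }
    assert (E7 : eps * th2 ^ 2 <= rho * alpha / 4).
    { rewrite <- E5. replace (eps * th2 ^ 2) with (eps * th2 * th2) by ring.
      apply Rmult_le_compat_r; [lra|]. scaled. }
    split.
    + constructor; trivial.
      * intros a b HA HB.
        replace (mu * a * th2) with (mu * th2 * a) by ring. rewrite E2.
        assert (rho * alpha <= rho * a) by scaled. lra.
      * intros a b HA HB.
        replace (eps * th1 ^ 2 - mu * a * th1) with ((eps * th1 - mu * a) * th1) by ring.
        rewrite E1.
        assert (mu * alpha <= mu * a) by scaled.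
        assert (rho * alpha <= rho * a) by scaled.
        assert ((alpha * mu / 2 - mu * a) * th1 <= 0) by nra.
        lra.
      * assert (alpha / 2 * mu <= alpha / 2 * 1) by scaled. lra.
      * lra.
      * nra.
      * apply Rle_trans with (1 := L4). scaled.
      * rewrite E1. replace (alpha * mu / 2) with (alpha / 2 * mu) by field.
        apply Lift; trivial; lra.
      * rewrite E5. lra.
      * right. split; [rewrite E1; field|]. rewrite E2.
        replace (rho / 2) with (rho / 2 * 1) by ring. apply Lift; trivial; lra.
    + intros n Hn _ HN. specialize (HN Hc').
      assert (M1 := Rmax_l (eps / mu) mu). assert (M2 := Rmax_r (eps / mu) mu).
      assert (Hem : 0 < eps / mu) by (apply Rdiv_lt_0_compat; lra).
      split.
      * assert (Q1 : n <= / (eps / mu)) by (apply InvLe; lra).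
        apply Rle_trans with (1 := Q1).
        replace (C * th1) with (C * (alpha / 2 * / (eps / mu))) by (unfold th1; field; lra).
        apply Lift; trivial. left; now apply Rinv_0_lt_compat.
      * assert (Q1 : n <= / mu) by (apply InvLe; lra).
        apply Rle_trans with (1 := Q1).
        replace (C * th2) with (C * (rho / 2 * / mu)) by (unfold th2; field; lra).
        apply Lift; trivial. left; apply Rinv_0_lt_compat; lra.
Qed.

(** * The scheme on the whole interval *)

Section WholeMesh.

Variables alpha rho eps mu d : R.
Variable m : nat.
Hypothesis m_pos : (1 <= m)%nat.

Let th1 := theta1 alpha rho eps mu.
Let th2 := theta2 alpha rho eps mu.

Hypothesis th1_pos : 0 < th1.
Hypothesis th2_pos : 0 < th2.

Let x := mesh alpha rho eps mu d (8 * m).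
Let r := sqrt (INR (8 * m)).

Let m_real : 1 <= INR m. Proof. now apply INR_m_ge_1. Qed.
Let n_real : INR (8 * m) = 8 * INR m. Proof. apply mesh_size. Qed.
Let r_pos : 16 / 7 <= r. Proof. now apply sqrt_size_bound. Qed.

Ltac decide_branches :=
  repeat match goal with
  | |- context [(?p <=? ?q)%nat] =>
      destruct (Nat.leb_spec p q); try lia
  end.

Lemma mesh_left (i : nat) : (i <= 4 * m)%nat -> x i = half_mesh th1 th2 d m i.
Proof.
  intros Hi. unfold x, mesh, half_mesh, sigma1, sigma2, layer, layer_ratio.
  fold th1 th2 r. decide_branches.
  - rewrite n_real. do 2 f_equal. field. lra.
  - fold th1 th2. rewrite n_real. field. lra.
  - assert (I4 : INR (4 * m - i) = 4 * INR m - INR i).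
    { rewrite minus_INR, mult_INR by lia. simpl. ring. }
    rewrite I4, n_real.
    replace (8 * (INR i / (8 * INR m)) * (1 - 1 / r) + 4 / r - 3)
      with (1 - (4 * INR m - INR i) / INR m * (1 - 1 / r)) by (field; lra).
    ring.
Qed.

Lemma mesh_right (j : nat) : (j <= 4 * m)%nat ->
  x (8 * m - j)%nat = 1 - half_mesh th1 th2 (1 - d) m j.
Proof.
  intros Hj.
  (* At the middle index the tests of [mesh] select the formula of the left half, so this node is
     treated apart. *)
  destruct (Nat.eq_dec j (4 * m)) as [->|Hne].
  { replace (8 * m - 4 * m)%nat with (4 * m)%nat by lia.
    rewrite mesh_left, !half_mesh_last by (assumption || lia). ring. }
  assert (Ij : INR (8 * m - j) = 8 * INR m - INR j).
  { rewrite minus_INR, mult_INR by lia. simpl. ring. }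
  destruct (le_lt_dec (3 * m) j) as [H3|H3].
  - replace (half_mesh th1 th2 (1 - d) m j)
      with (half_mesh th1 th2 (1 - d) m (4 * m - (4 * m - j))) by (f_equal; lia).
    rewrite half_mesh_inner by (assumption || lia).
    unfold x, mesh, layer, layer_ratio. fold th1 th2 r. decide_branches.
    assert (I4 : INR (4 * m - j) = 4 * INR m - INR j).
    { rewrite minus_INR, mult_INR by lia. simpl. ring. }
    rewrite Ij, n_real, I4.
    replace (8 * ((8 * INR m - INR j) / (8 * INR m)) * (1 / r - 1) + 5 - 4 / r)
      with (1 - (4 * INR m - INR j) / INR m * (1 - 1 / r)) by (field; lra).
    ring.
  - destruct (le_lt_dec m j) as [H1|H1].
    + rewrite half_mesh_coarse by (assumption || lia).
      rewrite !layer_last by assumption.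
      unfold x, mesh, sigma3, sigma4, sigma1, sigma2. fold th1 th2 r. decide_branches.
      rewrite Ij, n_real. field. lra.
    + rewrite half_mesh_outer by (assumption || lia).
      unfold x, mesh, layer, layer_ratio. fold th1 th2 r. decide_branches.
      rewrite Ij, n_real.
      replace (8 * ((8 * INR m - INR j) / (8 * INR m)) * (1 - 1 / r) + 8 / r - 7)
        with (1 - INR j / INR m * (1 - 1 / r)) by (field; lra).
      ring.
Qed.

End WholeMesh.

(** * The discrete maximum principle *)

Definition scheme (eps mu : R) (a b : R -> R) (X : nat -> R) (N : nat)
    (W : nat -> R) (i : nat) : R :=
  eps * delta2 X W i + mu * a (X i) * Dstar X N W i - b (X i) * W i.

Lemma finite_argmin (N : nat) (P : nat -> R) :
  exists k, (k <= N)%nat /\ forall i, (i <= N)%nat -> P k <= P i.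
Proof.
  induction N as [|N [k [Hk Hmin]]].
  - exists 0%nat. split; [lia|]. intros i Hi. replace i with 0%nat by lia. lra.
  - destruct (Rle_dec (P k) (P (S N))) as [H|H].
    + exists k. split; [lia|]. intros i Hi.
      destruct (Nat.eq_dec i (S N)) as [->|]; [exact H | apply Hmin; lia].
    + exists (S N). split; [lia|]. intros i Hi.
      destruct (Nat.eq_dec i (S N)) as [->|]; [lra|].
      specialize (Hmin i ltac:(lia)). lra.
Qed.

Lemma quotient_nonneg (p q : R) : 0 <= p -> 0 < q -> 0 <= p / q.
Proof. intros Hp Hq. apply Rmult_le_pos; [exact Hp | left; now apply Rinv_0_lt_compat]. Qed.

(** Upwinding chooses the quotient whose sign at a minimum agrees with that of [a], so convection
    and diffusion are both nonnegative without a restriction on the mesh width, and the reaction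
    term is positive. *)
Lemma scheme_at_negative_min (eps mu : R) (a b : R -> R) (X P : nat -> R) (N i : nat) :
  0 < eps -> 0 < mu -> 0 < b (X (S i)) ->
  X i < X (S i) < X (S (S i)) ->
  ((S i < N / 2)%nat -> a (X (S i)) <= 0) ->
  ((N / 2 <= S i)%nat -> 0 <= a (X (S i))) ->
  P (S i) <= P i -> P (S i) <= P (S (S i)) -> P (S i) < 0 ->
  0 < scheme eps mu a b X N P (S i).
Proof.
  intros He Hm Hb HX Ha1 Ha2 P1 P2 Pneg.
  assert (Q1 : 0 <= (P i - P (S i)) / (X (S i) - X i)) by nonneg.
  assert (Q2 : 0 <= Dplus X P (S i)) by nonneg.
  assert (Q1' : Dminus X P (S i) <= 0).
  { replace (Dminus X P (S i)) with (- ((P i - P (S i)) / (X (S i) - X i)))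
      by (unfold Dminus; simpl pred; field; lra). lra. }
  assert (Q3 : 0 <= delta2 X P (S i)).
  { unfold delta2. simpl pred. apply quotient_nonneg; lra. }
  assert (Q4 : 0 <= a (X (S i)) * Dstar X N P (S i)).
  { unfold Dstar. destruct (Nat.ltb_spec (S i) (N / 2)) as [H|H].
    - specialize (Ha1 H). nra.
    - specialize (Ha2 H). nra. }
  unfold scheme.
  assert (0 <= eps * delta2 X P (S i)) by nonneg.
  assert (0 <= mu * (a (X (S i)) * Dstar X N P (S i))) by nonneg.
  assert (b (X (S i)) * P (S i) < 0) by nra.
  lra.
Qed.

(** A negative minimum at [N / 2] is moved away: there the forward quotient is nonnegative, so by
    the flux inequality the backward one is too, and the left neighbour is also minimal. That
    neighbour is either an ordinary node or the boundary. *)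
Lemma discrete_max_principle (eps mu : R) (a b : R -> R) (X P : nat -> R) (N : nat) :
  0 < eps -> 0 < mu -> (0 < N / 2 < N)%nat ->
  (forall i, (i < N)%nat -> X i < X (S i)) ->
  (forall i, (0 < i < N)%nat -> i <> (N / 2)%nat -> 0 < b (X i)) ->
  (forall i, (0 < i < N / 2)%nat -> a (X i) <= 0) ->
  (forall i, (N / 2 < i < N)%nat -> 0 <= a (X i)) ->
  (forall i, (0 < i < N)%nat -> i <> (N / 2)%nat -> scheme eps mu a b X N P i <= 0) ->
  Dplus X P (N / 2) <= Dminus X P (N / 2) ->
  0 <= P 0%nat -> 0 <= P N ->
  forall i, (i <= N)%nat -> 0 <= P i.
Proof.
  intros He Hm HN HX Hb Ha1 Ha2 HL HI H0 HN0 i Hi.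
  destruct (finite_argmin N P) as [k [Hk Hmin]].
  destruct (Rle_dec 0 (P k)) as [Hpos|Hneg].
  { apply Rle_trans with (1 := Hpos), Hmin, Hi. }
  exfalso.
  assert (Main : forall j, (0 < j < N)%nat -> j <> (N / 2)%nat -> P j <= P k -> False).
  { intros j Hj Hne Hle. destruct j as [|j]; [lia|].
    assert (Hs : 0 < scheme eps mu a b X N P (S j)).
    { apply scheme_at_negative_min; trivial.
      - now apply Hb.
      - split; apply HX; lia.
      - intros Hlt; apply Ha1; lia.
      - intros Hge; apply Ha2; lia.
      - apply Rle_trans with (1 := Hle), Hmin; lia.
      - apply Rle_trans with (1 := Hle), Hmin; lia.
      - lra. }
    specialize (HL (S j) Hj Hne). lra. }
  assert (k <> 0%nat) by (intros ->; lra).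
  assert (k <> N) by (intros ->; lra).
  destruct (Nat.eq_dec k (N / 2)) as [E|E]; [|apply (Main k); lia || lra].
  destruct k as [|j]; [lia|]. rewrite <- E in HI.
  assert (X1 := HX j ltac:(lia)). assert (X2 := HX (S j) ltac:(lia)).
  assert (P1 := Hmin j ltac:(lia)). assert (P2 := Hmin (S (S j)) ltac:(lia)).
  assert (Q2 : 0 <= Dplus X P (S j)) by nonneg.
  assert (Pj : P j <= P (S j)).
  { assert (Q : 0 <= Dminus X P (S j) * (X (S j) - X j)) by nonneg.
    replace (Dminus X P (S j) * (X (S j) - X j)) with (P (S j) - P j) in Q
      by (unfold Dminus; simpl pred; field; lra).
    lra. }
  destruct (Nat.eq_dec j 0) as [->|Hj]; [lra|].
  apply (Main j); lia || lra.
Qed.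

Lemma half_scheme_ext (eps mu : R) (A b : R -> R) (X W W' : nat -> R) (n i : nat) :
  (forall k, (k <= n)%nat -> W k = W' k) -> (0 < i < n)%nat ->
  half_scheme eps mu A b X W i = half_scheme eps mu A b X W' i.
Proof.
  intros HW Hi. unfold half_scheme, delta2, Dplus, Dminus.
  rewrite !HW by lia. reflexivity.
Qed.

Lemma Dminus_ext (X X' W W' : nat -> R) (n : nat) :
  (forall k, (k <= n)%nat -> X k = X' k) ->
  (forall k, (k <= n)%nat -> W k = W' k) -> Dminus X W n = Dminus X' W' n.
Proof. intros HX HW. unfold Dminus. now rewrite !HX, !HW by lia. Qed.

Lemma max_norm_le (N : nat) (u : nat -> R) (B : R) :
  (forall i, (i <= N)%nat -> Rabs (u i) <= B) -> max_norm N u <= B.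
Proof.
  induction N as [|N IH]; intros H; simpl; [now apply H|].
  apply Rmax_lub; [apply IH; intros; apply H; lia | now apply H].
Qed.

(** * Gluing the two halves and comparing with the barrier *)

Section Assembly.

Variables alpha rho gamma eps mu d K y0 y1 u1 : R.
Variable m : nat.
Variables a b f y : R -> R.
Variables AL bL vL uL AR bR vR uR : R -> R.
Variable Y : nat -> R.

Let N := (8 * m)%nat.
Let n := INR N.
Let th1 := theta1 alpha rho eps mu.
Let th2 := theta2 alpha rho eps mu.
Let x := mesh alpha rho eps mu d N.
Let XL := half_mesh th1 th2 d m.
Let XR := half_mesh th1 th2 (1 - d) m.

Hypothesis m_pos : (1 <= m)%nat.
Hypothesis d_range : 0 < d < 1.
Hypothesis eps_pos : 0 < eps.
Hypothesis mu_pos : 0 < mu.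
Hypothesis gamma_pos : 0 < gamma.
Hypothesis th1_pos : 0 < th1.
Hypothesis th2_pos : 0 < th2.
Hypothesis fit_left : layer m th2 m + layer m th1 m < d.
Hypothesis fit_right : layer m th2 m + layer m th1 m < 1 - d.
Hypothesis left_data : forall t, 0 <= t < d ->
  a t = - AL t /\ b t = bL t /\ f t = - (bL t * vL t) /\ 0 <= AL t /\ gamma <= bL t.
Hypothesis right_data : forall t, 0 <= t < 1 - d ->
  a (1 - t) = AR t /\ b (1 - t) = bR t /\ f (1 - t) = - (bR t * vR t) /\ 0 <= AR t
  /\ gamma <= bR t.
Hypothesis discrete : discrete_solution a b f eps mu y0 y1 N x Y.

Lemma half_N : (N / 2 = 4 * m)%nat.
Proof. unfold N. replace (8 * m)%nat with (4 * m * 2)%nat by lia. now apply Nat.div_mul. Qed.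

Lemma x_left (i : nat) : (i <= 4 * m)%nat -> x i = XL i.
Proof. intros Hi. now apply mesh_left. Qed.

Lemma x_right (j : nat) : (j <= 4 * m)%nat -> x (N - j)%nat = 1 - XR j.
Proof. intros Hj. now apply mesh_right. Qed.

Lemma XL_interior (i : nat) : (0 < i < 4 * m)%nat -> 0 < XL i < d.
Proof. now apply half_mesh_interior. Qed.

Lemma XR_interior (i : nat) : (0 < i < 4 * m)%nat -> 0 < XR i < 1 - d.
Proof. now apply half_mesh_interior. Qed.

Lemma x_increasing (i : nat) : (i < N)%nat -> x i < x (S i).
Proof.
  intros Hi. destruct (le_lt_dec (4 * m) i) as [H|H].
  - set (j := (N - S i)%nat).
    replace i with (N - S j)%nat by (unfold j; lia).
    replace (S (N - S j))%nat with (N - j)%nat by (unfold j; lia).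
    rewrite !x_right by (unfold j, N in *; lia).
    assert (Q : XR j < XR (S j)) by (apply half_mesh_increasing; trivial; unfold j, N in *; lia).
    lra.
  - rewrite !x_left by lia. now apply half_mesh_increasing.
Qed.

Let mirror (W : nat -> R) (j : nat) : R := W (N - j)%nat.

Lemma scheme_left (W : nat -> R) (i : nat) : (0 < i < 4 * m)%nat ->
  scheme eps mu a b x N W i = half_scheme eps mu AL bL XL W i.
Proof.
  intros Hi. assert (Rg := XL_interior i Hi).
  destruct (left_data (XL i) ltac:(lra)) as [Ea [Eb _]].
  unfold scheme, half_scheme, Dstar. rewrite half_N.
  replace (i <? 4 * m)%nat with true by (symmetry; apply Nat.ltb_lt; lia).
  unfold delta2, Dplus, Dminus. rewrite !x_left by lia. rewrite Ea, Eb.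
  ring.
Qed.

Lemma Dminus_right (W : nat -> R) (j : nat) : (0 < j <= 4 * m)%nat ->
  Dplus x W (N - j) = - Dminus XR (mirror W) j.
Proof.
  intros Hj. destruct j as [|j]; [lia|].
  unfold Dplus, Dminus, mirror. simpl pred.
  replace (S (N - S j)) with (N - j)%nat by (unfold N; lia).
  rewrite !x_right by lia.
  assert (Q : XR j < XR (S j)) by (apply half_mesh_increasing; trivial; lia).
  field. lra.
Qed.

Lemma Dplus_right (W : nat -> R) (j : nat) : (j < 4 * m)%nat ->
  Dminus x W (N - j) = - Dplus XR (mirror W) j.
Proof.
  intros Hj. unfold Dplus, Dminus, mirror.
  replace (pred (N - j)) with (N - S j)%nat by (unfold N; lia).
  rewrite !x_right by lia.
  assert (Q : XR j < XR (S j)) by (apply half_mesh_increasing; trivial; lia).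
  field. lra.
Qed.

Lemma scheme_right (W : nat -> R) (j : nat) : (0 < j < 4 * m)%nat ->
  scheme eps mu a b x N W (N - j) = half_scheme eps mu AR bR XR (mirror W) j.
Proof.
  intros Hj. assert (Rg := XR_interior j Hj).
  destruct (right_data (XR j) ltac:(lra)) as [Ea [Eb _]].
  unfold scheme, half_scheme, Dstar. rewrite half_N.
  replace (N - j <? 4 * m)%nat with false by (symmetry; apply Nat.ltb_ge; unfold N; lia).
  unfold delta2. rewrite Dminus_right, Dplus_right by lia.
  destruct j as [|j]; [lia|].
  replace (S (N - S j)) with (N - j)%nat by (unfold N; lia).
  replace (pred (N - S j)) with (N - S (S j))%nat by (unfold N; lia).
  rewrite !x_right by lia. rewrite Ea, Eb. simpl pred.
  replace (1 - XR j - (1 - XR (S (S j)))) with (XR (S (S j)) - XR j) by ring.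
  unfold mirror, Rdiv. ring.
Qed.

Lemma node_cases (i : nat) : (0 < i < N)%nat -> i <> (N / 2)%nat ->
  (0 < i < 4 * m)%nat \/ exists j, (0 < j < 4 * m)%nat /\ i = (N - j)%nat.
Proof.
  rewrite half_N. intros Hi Hne. destruct (le_lt_dec (4 * m) i) as [H|H].
  - right. exists (N - i)%nat. unfold N in *. lia.
  - left. lia.
Qed.

(** Under reflection the forward quotient at the interface becomes minus a backward one. The flux
    inequality thereby takes a form symmetric in the two halves. *)
Lemma whole_max_principle (P : nat -> R) :
  (forall i, (0 < i < 4 * m)%nat -> half_scheme eps mu AL bL XL P i <= 0) ->
  (forall j, (0 < j < 4 * m)%nat -> half_scheme eps mu AR bR XR (mirror P) j <= 0) ->
  0 <= Dminus XL P (4 * m) + Dminus XR (mirror P) (4 * m) ->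
  0 <= P 0%nat -> 0 <= P N ->
  forall i, (i <= N)%nat -> 0 <= P i.
Proof.
  intros HL HR HI H0 HN.
  apply (discrete_max_principle eps mu a b x P N); trivial.
  - rewrite half_N. unfold N. lia.
  - exact x_increasing.
  - intros i Hi Hne. destruct (node_cases i Hi Hne) as [H|[j [H ->]]].
    + rewrite x_left by lia. assert (Rg := XL_interior i H).
      destruct (left_data (XL i) ltac:(lra)) as [_ [-> [_ [_ Q]]]]. lra.
    + rewrite x_right by lia. assert (Rg := XR_interior j H).
      destruct (right_data (XR j) ltac:(lra)) as [_ [-> [_ [_ Q]]]]. lra.
  - intros i Hi. rewrite half_N in Hi. rewrite x_left by lia. assert (Rg := XL_interior i Hi).
    destruct (left_data (XL i) ltac:(lra)) as [-> [_ [_ [Q _]]]]. lra.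
  - intros i Hi. destruct (node_cases i ltac:(lia) ltac:(lia)) as [H|[j [H ->]]].
    { rewrite half_N in Hi. lia. }
    rewrite x_right by lia. assert (Rg := XR_interior j H).
    destruct (right_data (XR j) ltac:(lra)) as [-> [_ [_ [Q _]]]]. lra.
  - intros i Hi Hne. destruct (node_cases i Hi Hne) as [H|[j [H ->]]].
    + rewrite scheme_left by exact H. now apply HL.
    + rewrite scheme_right by exact H. now apply HR.
  - rewrite half_N.
    replace (4 * m)%nat with (N - 4 * m)%nat at 1 by (unfold N; lia).
    rewrite Dminus_right by lia.
    rewrite (Dminus_ext x XL P P (4 * m)); [lra | | trivial].
    intros; now apply x_left.
Qed.

Lemma half_scheme_affine (A' b' : R -> R) (X W W1 W2 W3 : nat -> R) (k k1 k2 k3 : R) (i : nat) :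
  (forall j, W j = k + k1 * W1 j + k2 * W2 j + k3 * W3 j) ->
  half_scheme eps mu A' b' X W i =
    - (k * b' (X i)) + k1 * half_scheme eps mu A' b' X W1 i
    + k2 * half_scheme eps mu A' b' X W2 i + k3 * half_scheme eps mu A' b' X W3 i.
Proof.
  intros HW. unfold half_scheme, delta2, Dplus, Dminus. rewrite !HW. unfold Rdiv. ring.
Qed.

Lemma Dminus_affine (X W W1 W2 W3 : nat -> R) (k k1 k2 k3 : R) (i : nat) :
  (forall j, W j = k + k1 * W1 j + k2 * W2 j + k3 * W3 j) ->
  Dminus X W i = k1 * Dminus X W1 i + k2 * Dminus X W2 i + k3 * Dminus X W3 i.
Proof. intros HW. unfold Dminus. rewrite !HW. unfold Rdiv. ring. Qed.

Lemma discrete_left (i : nat) : (0 < i < 4 * m)%nat ->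
  half_scheme eps mu AL bL XL Y i = - (bL (XL i) * vL (XL i)).
Proof.
  intros Hi. destruct discrete as [Eq _].
  rewrite <- scheme_left by exact Hi. unfold scheme.
  rewrite Eq by (try rewrite half_N; unfold N; lia).
  rewrite x_left by lia. assert (Rg := XL_interior i Hi).
  destruct (left_data (XL i) ltac:(lra)) as [_ [_ [-> _]]]. reflexivity.
Qed.

Lemma discrete_right (j : nat) : (0 < j < 4 * m)%nat ->
  half_scheme eps mu AR bR XR (mirror Y) j = - (bR (XR j) * vR (XR j)).
Proof.
  intros Hj. destruct discrete as [Eq _].
  rewrite <- scheme_right by exact Hj. unfold scheme.
  rewrite Eq by (try rewrite half_N; unfold N; lia).
  rewrite x_right by lia. assert (Rg := XR_interior j Hj).
  destruct (right_data (XR j) ltac:(lra)) as [_ [_ [-> _]]]. reflexivity.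
Qed.

Lemma discrete_interface : Dminus XL Y (4 * m) + Dminus XR (mirror Y) (4 * m) = 0.
Proof.
  destruct discrete as [_ [_ [_ E]]]. rewrite half_N in E.
  replace (4 * m)%nat with (N - 4 * m)%nat in E at 2 by (unfold N; lia).
  rewrite Dminus_right in E by lia.
  rewrite (Dminus_ext x XL Y Y (4 * m)) in E; [lra | | trivial].
  intros; now apply x_left.
Qed.

Lemma discrete_stability (F B : R) :
  (forall t, 0 <= t < d -> Rabs (bL t * vL t) <= F) ->
  (forall t, 0 <= t < 1 - d -> Rabs (bR t * vR t) <= F) ->
  F <= gamma * B -> Rabs y0 <= B -> Rabs y1 <= B ->
  forall i, (i <= N)%nat -> Rabs (Y i) <= B.
Proof.
  intros FL FR HB B0 B1 i Hi.
  assert (HB0 : 0 <= B) by (apply Rle_trans with (2 := B0); apply Rabs_pos).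
  assert (Main : forall s, s = 1 \/ s = -1 -> forall i, (i <= N)%nat -> 0 <= B + s * Y i).
  { intros s Hs. destruct discrete as [_ [E0 [E1 _]]].
    apply (whole_max_principle (fun j => B + s * Y j)).
    - intros j Hj.
      rewrite (half_scheme_affine AL bL XL _ Y Y Y B s 0 0) by (intros; ring).
      rewrite discrete_left by exact Hj. assert (Rg := XL_interior j Hj).
      destruct (left_data (XL j) ltac:(lra)) as [_ [_ [_ [_ Q]]]].
      assert (V := FL (XL j) ltac:(lra)). apply Rabs_le_between in V.
      assert (gamma * B <= bL (XL j) * B) by scaled.
      destruct Hs; subst s; lra.
    - intros j Hj.
      rewrite (half_scheme_affine AR bR XR _ (mirror Y) (mirror Y) (mirror Y) B s 0 0)
        by (intros; unfold mirror; ring).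
      rewrite discrete_right by exact Hj. assert (Rg := XR_interior j Hj).
      destruct (right_data (XR j) ltac:(lra)) as [_ [_ [_ [_ Q]]]].
      assert (V := FR (XR j) ltac:(lra)). apply Rabs_le_between in V.
      assert (gamma * B <= bR (XR j) * B) by scaled.
      destruct Hs; subst s; lra.
    - rewrite (Dminus_affine XL _ Y Y Y B s 0 0) by (intros; ring).
      rewrite (Dminus_affine XR _ (mirror Y) (mirror Y) (mirror Y) B s 0 0)
        by (intros; unfold mirror; ring).
      assert (E := discrete_interface).
      replace (Dminus XR (mirror Y) (4 * m)) with (- Dminus XL Y (4 * m)) by lra. lra.
    - rewrite E0. destruct Hs; subst s; abs_lra.
    - rewrite E1. destruct Hs; subst s; abs_lra. }
  assert (H1 := Main 1 (or_introl eq_refl) i Hi).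
  assert (H2 := Main (-1) (or_intror eq_refl) i Hi).
  abs_lra.
Qed.

Hypothesis K_ge_1 : 1 <= K.
Hypothesis y_left : forall t, 0 <= t <= d -> y t = uL t.
Hypothesis y_right : forall t, 0 <= t <= 1 - d -> y (1 - t) = uR t.
Hypothesis y_at_0 : y 0 = y0.
Hypothesis y_at_1 : y 1 = y1.
Hypothesis consistent_left : half_consistent d eps mu th1 th2 K m AL bL vL uL u1.
Hypothesis consistent_right :
  half_consistent (1 - d) eps mu th1 th2 K m AR bR vR uR (- u1).

(** The barrier slope at the interface is at least [th1 / 36], so the weight [36 * K / n] covers a
    flux defect of [K * th1 / n]. In the interior this weight costs up to [36 * K * K / n], which
    together with the bounded truncation error [K / n] is paid by a constant through [gamma]. *)
Definition error_const : R := (36 * K * K + K) / gamma + 36 * K.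

Let Phi (i : nat) : R := decay (th1 / 8) (Rabs (x i - d)).
Let U (i : nat) : R := y (x i).

Lemma Phi_left (i : nat) : (i <= 4 * m)%nat -> Phi i = decay (th1 / 8) (d - XL i).
Proof.
  intros Hi. unfold Phi. rewrite x_left by exact Hi.
  assert (Rg := half_mesh_range m m_pos th1 th2 d th1_pos th2_pos fit_left i Hi). fold XL in Rg.
  f_equal. rewrite Rabs_minus_sym. apply Rabs_pos_eq. lra.
Qed.

Lemma Phi_right (j : nat) : (j <= 4 * m)%nat ->
  mirror Phi j = decay (th1 / 8) (1 - d - XR j).
Proof.
  intros Hj. unfold mirror, Phi. rewrite x_right by exact Hj.
  assert (Rg := half_mesh_range m m_pos th1 th2 (1 - d) th1_pos th2_pos fit_right j Hj).
  fold XR in Rg.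
  f_equal. rewrite Rabs_pos_eq; lra.
Qed.

Lemma Phi_range (i : nat) : 0 <= Phi i <= 1.
Proof.
  split; [left; apply decay_pos|].
  apply decay_le_1; [lra | apply Rabs_pos].
Qed.

Lemma U_left (i : nat) : (i <= 4 * m)%nat -> U i = uL (XL i).
Proof.
  intros Hi. unfold U. rewrite x_left by exact Hi.
  apply y_left. now apply half_mesh_range.
Qed.

Lemma U_right (j : nat) : (j <= 4 * m)%nat -> mirror U j = uR (XR j).
Proof.
  intros Hj. unfold mirror, U. rewrite x_right by exact Hj.
  apply y_right. now apply half_mesh_range.
Qed.

(* The constant absorbs the bounded part of the truncation error, [Phi] the part
   that is large in the interface layer and the defect of the flux condition. *)
Lemma error_signed (s : R) : s = 1 \/ s = -1 ->
  forall i, (i <= N)%nat ->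
    0 <= (36 * K * K + K) / gamma * / n + 36 * K * / n * Phi i + s * (Y i - U i).
Proof.
  intros Hs.
  assert (Hn : 8 <= n) by now apply mesh_size_ge_8.
  set (k1 := (36 * K * K + K) / gamma * / n). set (k2 := 36 * K * / n).
  assert (Hk1 : gamma * k1 = (36 * K * K + K) * / n) by (unfold k1; field; lra).
  assert (Hk1' : 0 <= k1) by nonneg.
  destruct discrete as [_ [E0 [E1 _]]].
  destruct consistent_left as [CL [IL SL]]. destruct consistent_right as [CR [IR SR]].
  fold XL in CL, IL, SL. fold XR in CR, IR, SR.
  (* The barrier supplies [36 / 8 * K * T / n], more than the [K * T / n] in the truncation error;
     the terms without [T] are balanced by [gamma * k1]. *)
  assert (Alg : forall beta T tau Lphi, 0 <= T -> gamma <= beta ->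
     Rabs tau <= K * / n * (1 + T) -> Lphi <= K - T / 8 ->
     - (k1 * beta) + k2 * Lphi + s * (- tau) <= 0).
  { intros beta T tau Lphi HT Hbeta Htau HLphi.
    assert (Q1 : gamma * k1 <= beta * k1) by scaled.
    assert (Q2 : k2 * Lphi <= k2 * (K - T / 8)) by scaled.
    assert (Q3 : s * - tau <= K * / n * (1 + T)).
    { destruct Hs; subst s; abs_lra. }
    assert (Q4 : 0 <= K * / n * T) by nonneg.
    unfold k2 in *. lra. }
  apply (whole_max_principle (fun i => k1 + k2 * Phi i + s * (Y i - U i))).
  - intros i Hi. destruct (CL i Hi) as [T [HT [Ta Tb]]].
    rewrite (half_scheme_affine AL bL XL _ Phi Y U k1 k2 s (- s)) by (intros; ring).
    rewrite discrete_left by exact Hi.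
    rewrite (half_scheme_ext _ _ _ _ _ _ _ (4 * m) i Phi_left Hi).
    rewrite (half_scheme_ext _ _ _ _ _ _ _ (4 * m) i U_left Hi).
    assert (Rg := XL_interior i Hi).
    destruct (left_data (XL i) ltac:(lra)) as [_ [_ [_ [_ Q]]]].
    assert (G := Alg _ _ _ _ HT Q Ta Tb). lra.
  - intros i Hi. destruct (CR i Hi) as [T [HT [Ta Tb]]].
    rewrite (half_scheme_affine AR bR XR _ (mirror Phi) (mirror Y) (mirror U) k1 k2 s (- s))
      by (intros; unfold mirror; ring).
    rewrite discrete_right by exact Hi.
    rewrite (half_scheme_ext _ _ _ _ _ _ _ (4 * m) i Phi_right Hi).
    rewrite (half_scheme_ext _ _ _ _ _ _ _ (4 * m) i U_right Hi).
    assert (Rg := XR_interior i Hi).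
    destruct (right_data (XR i) ltac:(lra)) as [_ [_ [_ [_ Q]]]].
    assert (G := Alg _ _ _ _ HT Q Ta Tb). lra.
  - rewrite (Dminus_affine XL _ Phi Y U k1 k2 s (- s)) by (intros; ring).
    rewrite (Dminus_affine XR _ (mirror Phi) (mirror Y) (mirror U) k1 k2 s (- s))
      by (intros; unfold mirror; ring).
    rewrite (Dminus_ext XL XL _ _ (4 * m) (fun _ _ => eq_refl) Phi_left).
    rewrite (Dminus_ext XL XL _ _ (4 * m) (fun _ _ => eq_refl) U_left).
    rewrite (Dminus_ext XR XR _ _ (4 * m) (fun _ _ => eq_refl) Phi_right).
    rewrite (Dminus_ext XR XR _ _ (4 * m) (fun _ _ => eq_refl) U_right).
    assert (DI := discrete_interface).
    set (DYL := Dminus XL Y (4 * m)) in *. set (DYR := Dminus XR (mirror Y) (4 * m)) in *.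
    set (DUL := Dminus XL (fun j => uL (XL j)) (4 * m)) in *.
    set (DUR := Dminus XR (fun j => uR (XR j)) (4 * m)) in *.
    set (DPL := Dminus XL (fun j => decay (th1 / 8) (d - XL j)) (4 * m)) in *.
    set (DPR := Dminus XR (fun j => decay (th1 / 8) (1 - d - XR j)) (4 * m)) in *.
    fold N n in IL, IR.
    (* The exact slopes are [u1] on the left and [- u1] on the reflected right and cancel in the
       sum. Two defects of at most [K * th1 / n] remain, one for each side of the barrier kink. *)
    assert (Q1 : k2 * (th1 / 36) <= k2 * DPL) by scaled.
    assert (Q2 : k2 * (th1 / 36) <= k2 * DPR) by scaled.
    replace (k2 * (th1 / 36)) with (K * (th1 * / n)) in Q1, Q2 by (unfold k2; field; lra).
    apply Rabs_le_between in IL. apply Rabs_le_between in IR.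
    replace DYR with (- DYL) by lra.
    destruct Hs; subst s; lra.
  - assert (P := Phi_range 0).
    unfold U. rewrite E0, x_left by lia.
    unfold XL. rewrite half_mesh_0 by assumption. rewrite y_at_0.
    assert (0 <= k2 * Phi 0) by nonneg. lra.
  - assert (P := Phi_range N).
    unfold U. rewrite E1.
    replace (x N) with (x (N - 0)%nat) by (f_equal; lia).
    rewrite x_right by lia. unfold XR. rewrite half_mesh_0 by assumption.
    rewrite Rminus_0_r, y_at_1.
    assert (0 <= k2 * Phi N) by nonneg. lra.
Qed.

Lemma error_bound (i : nat) : (i <= N)%nat -> Rabs (Y i - y (x i)) <= error_const * / n.
Proof.
  intros Hi.
  assert (Hn : 8 <= n) by now apply mesh_size_ge_8.
  assert (H1 := error_signed 1 (or_introl eq_refl) i Hi).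
  assert (H2 := error_signed (-1) (or_intror eq_refl) i Hi).
  fold (U i).
  assert (P := Phi_range i).
  assert (Q : 36 * K * / n * Phi i <= 36 * K * / n * 1).
  { apply Rmult_le_compat_l; [nonneg | lra]. }
  unfold error_const. abs_lra.
Qed.

End Assembly.

(** * Stability of the boundary value problem and the uniform error estimate *)

Lemma continuous_stability (d eps mu gamma Ba F B : R) (a b f u u1 : R -> R) :
  0 < d < 1 -> 0 < eps -> 0 < mu -> 0 < gamma -> 0 <= B ->
  (forall x, 0 < x < 1 -> x <> d ->
     Rabs (a x) <= Ba /\ gamma <= b x /\ Rabs (f x) <= F) ->
  F <= gamma * B ->
  (forall x, continuity_pt u x) ->
  (forall x, 0 < x < 1 -> is_derive u x (u1 x)) ->
  (forall x, 0 < x < 1 -> continuity_pt u1 x) ->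
  (forall x, 0 < x < d \/ d < x < 1 ->
     is_derive u1 x ((f x + b x * u x - mu * a x * u1 x) / eps)) ->
  Rabs (u 0) <= B -> Rabs (u 1) <= B ->
  forall x, 0 <= x <= 1 -> Rabs (u x) <= B.
Proof.
  intros Hd He Hm Hg HB Hab HF Cu Du Cu1 Du1 H0 H1 x Hx.
  assert (Main : forall s, s = 1 \/ s = -1 -> 0 <= 1 * B + s * u x).
  { intros s Hs.
    apply (max_principle eps mu gamma Ba 0 d 1 a b (fun t => 1 * B + s * u t)
      (fun t => 1 * 0 + s * u1 t)
      (fun t => 1 * 0 + s * ((f t + b t * u t - mu * a t * u1 t) / eps))); trivial.
    - intros t _. apply (continuity_pt_lin2 (fun _ => B) u); [|apply Cu].
      apply continuity_pt_const. now intros ? ?.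
    - intros t Ht. apply (is_derive_lin2 (fun _ => B) u); [|now apply Du].
      apply is_derive_Reals, derivable_pt_lim_const.
    - intros t Ht. apply (continuity_pt_lin2 (fun _ => 0) u1); [|now apply Cu1].
      apply continuity_pt_const. now intros ? ?.
    - intros t Ht Hne. apply (is_derive_lin2 (fun _ => 0) u1); [|apply Du1; lra].
      apply is_derive_Reals, derivable_pt_lim_const.
    - intros t Ht Hne. destruct (Hab t Ht Hne) as [Ha [Hb _]]. now split.
    - intros t Ht Hne. destruct (Hab t Ht Hne) as [_ [Hb Hf]].
      replace (_ - _) with (s * f t - b t * B) by (field; lra).
      assert (gamma * B <= b t * B) by scaled.
      destruct Hs; subst s; abs_lra.
    - destruct Hs; subst s; abs_lra.
    - destruct Hs; subst s; abs_lra. }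
  assert (Q1 := Main 1 (or_introl eq_refl)).
  assert (Q2 := Main (-1) (or_intror eq_refl)).
  abs_lra.
Qed.

Theorem theorem5p1 :
  forall (d y0 y1 gamma alpha1 alpha2 : R) (a b f : R -> R),
    0 < d < 1 ->
    Ck 7 (fun x => 0 <= x <= 1) b ->
    piecewise_Ck 7 d a ->
    piecewise_Ck 7 d f ->
    0 < gamma -> 0 < alpha1 -> 0 < alpha2 ->
    (forall x, 0 <= x <= 1 -> gamma <= b x) ->
    (forall x, 0 <= x < d -> a x <= - alpha1) ->
    (forall x, d < x <= 1 -> alpha2 <= a x) ->
    let alpha := Rmin alpha1 alpha2 in
    let rho := rho_of d a b in
    exists C : R, 0 < C /\
      forall (eps mu : R) (N : nat) (y : R -> R) (Y : nat -> R),
        0 < eps <= 1 ->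
        0 < mu <= 1 ->
        (0 < N)%nat ->
        Nat.divide 8 N ->
        sigma1 alpha rho eps mu N + sigma2 alpha rho eps mu N < d ->
        sigma3 alpha rho eps mu N + sigma4 alpha rho eps mu N < 1 - d ->
        (sqrt alpha * mu <= sqrt (rho * eps) -> sqrt eps < / INR N) ->
        (sqrt alpha * mu > sqrt (rho * eps) -> Rmax (eps / mu) mu < / INR N) ->
        let x := mesh alpha rho eps mu d N in
        bvp_solution d a b f eps mu y0 y1 y ->
        discrete_solution a b f eps mu y0 y1 N x Y ->
        max_norm N (fun i => Y i - y (x i)) <= C * / INR N.
Proof.
  intros d y0 y1 gamma alpha1 alpha2 a b f Hd Cb [[gl [Cgl Egl]] [gr [Cgr Egr]]]
    [[fl [Cfl Efl]] [fr [Cfr Efr]]] Hg Ha1 Ha2 Hb HaL HaR alpha rho.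
  assert (Hal : 0 < alpha) by now apply Rmin_pos.
  assert (Hal1 : alpha <= alpha1) by apply Rmin_l.
  assert (Hal2 : alpha <= alpha2) by apply Rmin_r.
  (* Data of the halves, extended by constants; the right half is written in the variable [1 - x].
     Reflection changes the sign of the first-order term, so [A] is [- a] on the left and [a] on the
     right, positive on both. *)
  set (AL := fun x => - gl (clamp 0 d x)).
  set (AR := fun x => gr (clamp d 1 (1 - x))).
  set (bL := fun x => b (clamp 0 1 x)).
  set (bR := fun x => b (clamp 0 1 (1 - x))).
  set (FL := fun x => fl (clamp 0 d x)).
  set (FR := fun x => fr (clamp d 1 (1 - x))).
  set (vL := fun x => - (FL x * / bL x)).
  set (vR := fun x => - (FR x * / bR x)).
  assert (bL_low : forall x, gamma <= bL x) by (intros; apply Hb, clamp_range; lra).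
  assert (bR_low : forall x, gamma <= bR x) by (intros; apply Hb, clamp_range; lra).
  assert (Refl : forall k g, smooth k d 1 g -> smooth k 0 (1 - d) (fun x => g (1 - x))).
  { intros k g H. replace 0 with (1 - 1) by ring. now apply smooth_reflect. }
  assert (SAL : smooth 7 0 d AL) by (apply smooth_opp, Ck_smooth; [lra | exact Cgl]).
  assert (SFL : smooth 7 0 d FL) by (apply Ck_smooth; [lra | exact Cfl]).
  assert (SAR : smooth 7 0 (1 - d) AR).
  { apply (Refl 7%nat (fun x => gr (clamp d 1 x))), Ck_smooth; [lra | exact Cgr]. }
  assert (SFR : smooth 7 0 (1 - d) FR).
  { apply (Refl 7%nat (fun x => fr (clamp d 1 x))), Ck_smooth; [lra | exact Cfr]. }
  assert (Sb : smooth 7 0 1 bL) by (apply Ck_smooth; [lra | exact Cb]).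
  assert (SbL : smooth 7 0 d bL) by (apply (smooth_sub 7 0 1); [lra | lra | exact Sb]).
  assert (SbR : smooth 7 0 (1 - d) bR).
  { apply (Refl 7%nat bL), (smooth_sub 7 0 1); [lra | lra | exact Sb]. }
  assert (SvL : smooth 7 0 d vL).
  { apply smooth_opp, smooth_mult; [exact SFL|]. apply smooth_inv; [|exact SbL].
    intros x. specialize (bL_low x). lra. }
  assert (SvR : smooth 7 0 (1 - d) vR).
  { apply smooth_opp, smooth_mult; [exact SFR|]. apply smooth_inv; [|exact SbR].
    intros x. specialize (bR_low x). lra. }
  assert (EL : forall t, 0 <= t < d -> a t = - AL t /\ b t = bL t /\
            f t = - (bL t * vL t) /\ 0 <= AL t /\ gamma <= bL t).
  { intros t Ht. specialize (bL_low t). specialize (HaL t Ht). unfold vL, FL.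
    assert (Ea : a t = - AL t) by (unfold AL; rewrite clamp_id, Egl by lra; ring).
    rewrite Efl by exact Ht. rewrite clamp_id by lra.
    repeat split; try lra; [unfold bL; now rewrite clamp_id by lra | field; lra]. }
  assert (ER : forall t, 0 <= t < 1 - d -> a (1 - t) = AR t /\ b (1 - t) = bR t /\
            f (1 - t) = - (bR t * vR t) /\ 0 <= AR t /\ gamma <= bR t).
  { intros t Ht. specialize (bR_low t). specialize (HaR (1 - t) ltac:(lra)). unfold vR, FR.
    assert (Ea : a (1 - t) = AR t) by (unfold AR; rewrite clamp_id, Egr by lra; ring).
    rewrite Efr by lra. rewrite clamp_id by lra.
    repeat split; try lra; [unfold bR; now rewrite clamp_id by lra | field; lra]. }
  assert (EFL : forall t, - (bL t * vL t) = FL t).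
  { intros t. specialize (bL_low t). unfold vL. field. lra. }
  assert (EFR : forall t, - (bR t * vR t) = FR t).
  { intros t. specialize (bR_low t). unfold vR. field. lra. }
  assert (Hd1 : 0 <= d) by lra. assert (Hd2 : 0 <= 1 - d) by lra.
  destruct (continuity_bounded 0 d AL Hd1 (smooth_continuity _ _ _ _ SAL)) as [B1 [P1 Q1]].
  destruct (continuity_bounded 0 (1 - d) AR Hd2 (smooth_continuity _ _ _ _ SAR))
    as [B2 [P2 Q2]].
  destruct (continuity_bounded 0 d FL Hd1 (smooth_continuity _ _ _ _ SFL)) as [B3 [P3 Q3]].
  destruct (continuity_bounded 0 (1 - d) FR Hd2 (smooth_continuity _ _ _ _ SFR))
    as [B4 [P4 Q4]].
  set (F := B3 + B4).
  assert (ALpos : forall t, 0 <= t < d -> alpha <= AL t).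
  { intros t Ht. destruct (EL t Ht) as [E _]. specialize (HaL t Ht). lra. }
  assert (ARpos : forall t, 0 <= t < 1 - d -> alpha <= AR t).
  { intros t Ht. destruct (ER t Ht) as [E _]. specialize (HaR (1 - t) ltac:(lra)). lra. }
  assert (Sides : forall x, 0 <= x <= 1 -> x <> d ->
     (0 < Rabs (a x) <= B1 + B2 + 1) /\ Rabs (f x) <= F).
  { intros x Hx Hne. destruct (Rlt_dec x d) as [Hlt|Hge].
    - destruct (EL x ltac:(lra)) as [-> [_ [-> _]]]. rewrite EFL.
      specialize (ALpos x ltac:(lra)). specialize (Q1 x ltac:(lra)).
      specialize (Q3 x ltac:(lra)).
      rewrite Rabs_Ropp. rewrite (Rabs_pos_eq (AL x)) in * by lra. unfold F. lra.
    - destruct (ER (1 - x) ltac:(lra)) as [E [_ [E' _]]].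
    rewrite EFR in E'.
      replace (1 - (1 - x)) with x in E, E' by ring. rewrite E, E'.
      specialize (ARpos (1 - x) ltac:(lra)). specialize (Q2 (1 - x) ltac:(lra)).
      specialize (Q4 (1 - x) ltac:(lra)).
      rewrite (Rabs_pos_eq (AR (1 - x))) in * by lra. unfold F. lra. }
  destruct (rho_of_spec d gamma (B1 + B2 + 1) a b Hd Hg ltac:(lra) Hb
    (fun x Hx Hne => proj1 (Sides x Hx Hne))) as [Hrho Hrho_le].
  fold rho in Hrho, Hrho_le.
  destruct (half_data_exists d alpha rho gamma AL bL vL) as
    [AL1 [bL1 [vL1 [vL2 [vL3 [ML [HML dataL]]]]]]]; trivial; try lra;
    try (apply (smooth_le 7); [lia | assumption]).
  { intros x Hx. destruct (EL x Hx) as [Ea [Eb _]]. specialize (ALpos x Hx).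
    specialize (Hrho_le x ltac:(lra) ltac:(lra)).
    rewrite Ea, Rabs_Ropp, Rabs_pos_eq in Hrho_le by lra. lra. }
  destruct (half_data_exists (1 - d) alpha rho gamma AR bR vR) as
    [AR1 [bR1 [vR1 [vR2 [vR3 [MR [HMR dataR]]]]]]]; trivial; try lra;
    try (apply (smooth_le 7); [lia | assumption]).
  { intros x Hx. destruct (ER x Hx) as [Ea [Eb _]]. specialize (ARpos x Hx).
    specialize (Hrho_le (1 - x) ltac:(lra) ltac:(lra)).
    rewrite Ea, Rabs_pos_eq in Hrho_le by lra. lra. }
  assert (HF : 0 <= F / gamma) by nonneg.
  (* A common bound for the data and, by the maximum principles with [F / gamma] and the boundary
     values, for [y] and [Y]. *)
  set (M := 1 + ML + MR + Rabs y0 + Rabs y1 + F / gamma).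
  assert (A0 := Rabs_pos y0). assert (A1 := Rabs_pos y1).
  assert (HM : 1 <= M /\ ML <= M /\ MR <= M /\ Rabs y0 <= M /\ Rabs y1 <= M /\ F / gamma <= M)
    by (unfold M; lra).
  clearbody M. destruct HM as [HM1 [HM2 [HM3 [HM4 [HM5 HM6]]]]].
  specialize (dataL M HM2). specialize (dataR M HM3).
  assert (HFM : F <= gamma * M).
  { replace F with (gamma * (F / gamma)) by (field; lra). scaled. }
  destruct (regime_of_mesh alpha rho Hal Hrho) as [C [HC Hreg]].
  destruct (half_consistent_exists d alpha rho gamma M C) as [KL consL]; try lra.
  destruct (half_consistent_exists (1 - d) alpha rho gamma M C) as [KR consR]; try lra.
  set (K := Rmax 1 (Rmax KL KR)).
  assert (HK : 1 <= K) by apply Rmax_l.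
  assert (HKLR : KL <= K /\ KR <= K).
  { generalize (Rmax_r 1 (Rmax KL KR)), (Rmax_l KL KR), (Rmax_r KL KR). fold K. lra. }
  (* Above this value of [sqrt n] the layers are short enough for the consistency estimates on both
     halves. *)
  set (R0 := 32 * C / d + 32 * C / (1 - d)).
  assert (R0a : 0 <= 32 * C / d) by nonneg.
  assert (R0b : 0 <= 32 * C / (1 - d)) by nonneg.
  assert (HE : 0 < error_const gamma K).
  { unfold error_const.
    assert (0 <= (36 * K * K + K) / gamma) by nonneg. lra. }
  assert (HS : 0 <= 2 * M * R0 ^ 2) by nonneg.
  (* The second summand covers the meshes with [n <= R0 ^ 2], where the error is at most [2 * M]. *)
  exists (error_const gamma K + 2 * M * R0 ^ 2). split; [lra|].
  intros eps mu N y Y Heps Hmu HN [m Hm] Hs12 Hs34 Hc1 Hc2 x Hy HY.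
  rewrite Nat.mul_comm in Hm. subst N.
  assert (Hm : (1 <= m)%nat) by lia.
  assert (Hn := mesh_size_ge_8 m Hm). set (n := INR (8 * m)) in *.
  destruct (Hreg eps mu Heps Hmu) as [reg size].
  destruct (size n ltac:(lra) Hc1 Hc2) as [size1 size2].
  set (th1 := theta1 alpha rho eps mu) in *. set (th2 := theta2 alpha rho eps mu) in *.
  assert (Ht1 := rg_th1 reg). assert (Ht2 := rg_th2 reg).
  assert (FitL : layer m th2 m + layer m th1 m < d).
  { rewrite !layer_last by assumption. exact Hs12. }
  assert (FitR : layer m th2 m + layer m th1 m < 1 - d).
  { rewrite !layer_last by assumption. unfold sigma3, sigma4 in Hs34.
    rewrite Rplus_comm. exact Hs34. }
  destruct (bvp_facts d eps mu y0 y1 a b f y Hd ltac:(lra) Hy)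
    as [u [u1 [Euy [Cu [Du [Cu1 [Du1 [Eu0 Eu1]]]]]]]].
  assert (Bu : forall t, 0 <= t <= 1 -> Rabs (u t) <= M).
  { apply (continuous_stability d eps mu gamma (B1 + B2 + 1) F M a b f u u1); trivial; try lra.
    - intros t Ht Hne. destruct (Sides t ltac:(lra) Hne) as [[_ S1] S2].
      repeat split; trivial. apply Hb; lra.
    - now rewrite Eu0.
    - now rewrite Eu1. }
  assert (solL : half_solution d eps mu M AL bL vL u u1).
  { constructor; trivial.
    - intros t Ht; apply Cu1; lra.
    - intros t Ht; apply Du; lra.
    - intros t Ht. apply (is_derive_eq _ _ _ _ (Du1 t ltac:(lra))).
      destruct (EL t ltac:(lra)) as [-> [-> [-> _]]]. field. lra.
    - intros t Ht; apply Bu; lra. }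
  assert (solR : half_solution (1 - d) eps mu M AR bR vR
                   (fun t => u (1 - t)) (fun t => - u1 (1 - t))).
  { constructor.
    - intros t. now apply continuity_pt_reflect.
    - intros t Ht. apply (continuity_pt_opp (fun t => u1 (1 - t))).
      apply continuity_pt_reflect, Cu1; lra.
    - intros t Ht. apply is_derive_reflect, Du; lra.
    - intros t Ht.
      apply (is_derive_eq _ _ (- - ((f (1 - t) + b (1 - t) * u (1 - t)
                                     - mu * a (1 - t) * u1 (1 - t)) / eps))).
      + apply (is_derive_opp (fun t => u1 (1 - t))).
        apply (is_derive_reflect u1), Du1; lra.
      + destruct (ER t ltac:(lra)) as [-> [-> [-> _]]]. field. lra.
    - intros t Ht; apply Bu; lra. }
  assert (Hy0 : y 0 = y0) by (rewrite <- Euy, Eu0 by lra; reflexivity).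
  assert (Hy1 : y 1 = y1) by (rewrite <- Euy, Eu1 by lra; reflexivity).
  apply max_norm_le. intros i Hi.
  destruct (Rle_dec R0 (sqrt n)) as [Large|Small].
  - apply Rle_trans with (error_const gamma K * / n); [|scaled].
    apply (error_bound alpha rho gamma eps mu d K y0 y1 (u1 d) m a b f y AL bL vL u
      AR bR vR (fun t => u (1 - t)) Y); trivial; try lra.
    + intros t Ht. symmetry. apply Euy. lra.
    + intros t Ht. symmetry. apply Euy. lra.
    + apply (consL K eps mu th1 th2 AL AL1 bL bL1 vL vL1 vL2 vL3 u u1); trivial; [lra|].
      unfold R0 in Large. fold n. lra.
    (* The interface is the point [1 - d] of the reflected half, and the reflected derivative
       changes sign. *)
    + replace (- u1 d) with (- u1 (1 - (1 - d))) by (do 2 f_equal; ring).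
      apply (consR K eps mu th1 th2 AR AR1 bR bR1 vR vR1 vR2 vR3
        (fun t => u (1 - t)) (fun t => - u1 (1 - t))); trivial; [lra|].
      unfold R0 in Large. fold n. lra.
  - assert (BY : Rabs (Y i) <= M).
    { apply (discrete_stability alpha rho gamma eps mu d y0 y1 m a b f AL bL vL AR bR vR Y
        Hm ltac:(lra) ltac:(lra) Hg Ht1 Ht2 FitL FitR EL ER HY F M); trivial.
      - intros t Ht. specialize (Q3 t ltac:(lra)).
        rewrite <- Rabs_Ropp, EFL. unfold F; lra.
      - intros t Ht. specialize (Q4 t ltac:(lra)).
        rewrite <- Rabs_Ropp, EFR. unfold F; lra. }
    assert (Rx : 0 <= x i <= 1).
    { assert (L : forall j, (j <= 4 * m)%nat ->
        0 <= half_mesh th1 th2 d m j <= d /\ 0 <= half_mesh th1 th2 (1 - d) m j <= 1 - d)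
        by (intros; split; now apply half_mesh_range).
      destruct (le_lt_dec i (4 * m)) as [H|H].
      - unfold x. rewrite mesh_left by assumption.
        destruct (L i H) as [L1 _]. fold th1 th2. lra.
      - replace i with (8 * m - (8 * m - i))%nat by lia.
        unfold x. rewrite mesh_right by (assumption || lia).
        destruct (L (8 * m - i)%nat ltac:(lia)) as [_ L2]. fold th1 th2. lra. }
    assert (By : Rabs (y (x i)) <= M) by (rewrite <- Euy by exact Rx; now apply Bu).
    assert (Hnr : n <= R0 ^ 2).
    { rewrite <- (sqrt_sqrt n) by lra. assert (0 <= sqrt n) by apply sqrt_pos.
      simpl. rewrite Rmult_1_r. apply Rmult_le_compat; lra. }
    apply Rle_trans with (2 * M).
    + unfold Rminus. apply Rle_trans with (1 := Rabs_triang _ _). rewrite Rabs_Ropp. lra.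
    + apply Rmult_le_reg_r with n; [lra|].
      replace ((error_const gamma K + 2 * M * R0 ^ 2) * / n * n)
        with (error_const gamma K + 2 * M * R0 ^ 2) by (field; lra).
      assert (2 * M * n <= 2 * M * R0 ^ 2) by scaled. lra.
Qed.
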